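(* Let $m,\ell\in\mathbb N$ with $2\ell>m$ and let $\nu$ be a finite non-zero Borel measure on the open unit cube $(0,1)^m$. Let $(\lambda_n^\nu)_{n\in\mathbb N}$ be the decreasing sequence of eigenvalues of the polyharmonic operator $T_\nu$. Then $$\limsup_{n\to\infty}\frac{\log(\lambda_n^\nu)}{\log(n)}\le-\frac{1}{s_{2\ell-m}}\le-\left(\frac{2\ell-m}{\overline{\dim}_M(\nu)}+1\right)\le-\frac{2\ell}{m}.$$
   Context: Let $\mathbf Q=(0,1]^m$ and let $H_0^\ell$ be the completion of $\mathcal C_c^\infty((0,1)^m)$ with respect to the Sobolev norm of $W_2^\ell((0,1)^m)$ (real-valued functions). On $H_0^\ell$ put $J_\nu(u,v)=\int uv\,d\nu$ and $I_\ell(u,v)=\int_{\mathbf Q}\sum_{|\alpha|=\ell}D^\alpha u\,D^\alpha v\,d\Lambda$, where $\Lambda$ is Lebesgue measure and, since $2\ell>m$, $H_0^\ell$ embeds compactly into $\mathcal C(\overline{\mathbf Q})$ and continuous representatives are used. $I_\ell^{1/2}$ is an equivalent norm on $H_0^\ell$. The polyharmonic operator $T_\nu$ is the compact non-negative self-adjoint operator on $(H_0^\ell,I_\ell(\cdot,\cdot))$ determined by $J_\nu(u,w)=I_\ell(T_\nu u,w)$ for all $u,w\in H_0^\ell$. Thus $f\in H_0^\ell\setminus\{0\}$ is an eigenfunction with eigenvalue $\lambda$ iff $J_\nu(f,g)=\lambda I_\ell(f,g)$ for all $g\in H_0^\ell$. The eigenvalues are listed in decreasing order with multiplicity, $\lambda_1^\nu\ge\lambda_2^\nu\ge\dots\to0$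 (if there are only finitely many positive ones, the sequence is continued by zeros). For $n\in\mathbb N$ let $\mathcal D_n$ be the set of dyadic cubes $\prod_{k=1}^m(l_k2^{-n},(l_k+1)2^{-n}]$, $l_k\in\mathbb Z$, with positive $\nu$-measure. For $s\in\mathbb R$ put $\beta_n^\nu(s)=\log\left(\sum_{C\in\mathcal D_n}\nu(C)^s\right)/\log(2^n)$ and $\beta_\nu(s)=\limsup_{n\to\infty}\beta_n^\nu(s)$. For $b>0$, $s_b=\inf\{s>0:\beta_\nu(s)-bs\le0\}$. $\overline{\dim}_M(\nu)=\beta_\nu(0)$ is the upper Minkowski dimension of $\operatorname{supp}\nu$. Conventions: $\log 0=-\infty$, $1/0=+\infty$ and $c/0=+\infty$ for $c>0$. *)

(* Defs.v *)
From HB Require Import structures.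
From mathcomp Require Import all_boot all_order all_algebra.
From mathcomp Require Import all_classical all_reals all_analysis.
From mathcomp Require Import measurable_realfun.

Set Implicit Arguments.
Unset Strict Implicit.
Unset Printing Implicit Defensive.

Import Order.TTheory GRing.Theory Num.Theory.
Import numFieldNormedType.Exports.

Local Open Scope classical_set_scope.
Local Open Scope ring_scope.

(* The Borel sigma-algebra of R^m = 'rV[R]_m. *)
HB.instance Definition _ (R : realType) (m : nat) :=
  @isMeasurable.Build (sigma_display (@open 'rV[R]_m)) 'rV[R]_m
    <<s @open 'rV[R]_m >> (@sigma_algebra0 _ setT _) (@sigma_algebraC _ _)
    (@sigma_algebra_bigcup _ setT _).

Definition rVcons (R : realType) (m : nat) (p : R * 'rV[R]_m) : 'rV[R]_m.+1 :=
  row_mx (const_mx p.1 : 'rV_1) p.2.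

Definition rVuncons (R : realType) (m : nat) (x : 'rV[R]_m.+1) :
    R * 'rV[R]_m :=
  (x ord0 ord0, rsubmx (x : 'rV_(1 + m))).

Lemma rVcons0 (R : realType) (m : nat) (p : R * 'rV[R]_m) :
  rVcons p ord0 ord0 = p.1.
Proof.
have -> : @ord0 m = lshift m (ord0 : 'I_1) by exact: val_inj.
by apply: etrans (row_mxEl _ _ _ _) _; rewrite mxE.
Qed.

Lemma rVconsS (R : realType) (m : nat) (p : R * 'rV[R]_m) (j : 'I_m) :
  rVcons p ord0 (lift ord0 j) = p.2 ord0 j.
Proof.
have -> : lift ord0 j = rshift 1 j by exact: val_inj.
exact: row_mxEr.
Qed.

Lemma rVconsK (R : realType) (m : nat) : cancel (@rVcons R m) (@rVuncons R m).
Proof.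
move=> [a y]; rewrite /rVuncons rVcons0; congr pair.
by rewrite /rVcons row_mxKr.
Qed.

Lemma rV_open_measurable (R : realType) (m : nat) (U : set 'rV[R]_m) :
  open U -> measurable U.
Proof. by move=> oU; exact: sub_sigma_algebra. Qed.

Lemma measurable_rVuncons (R : realType) (m : nat) :
  measurable_fun setT (@rVuncons R m).
Proof.
apply: measurable_fun_pair.
- apply: (measurability _ (RGenOpens.measurableE R)).
  move=> _ [_ [a [b ->] <-]]; rewrite setTI; apply: rV_open_measurable.
  move: (@coord_continuous R 1 m.+1 ord0 ord0) => /continuousP; apply.
  exact: interval_open.
- apply: (@measurability _ _ _ _ _ _ (@open 'rV[R]_m)) => //.
  move=> _ [U oU <-]; rewrite setTI; apply: rV_open_measurable.
  have cf : continuous (fun x : 'rV[R]_m.+1 => rsubmx (x : 'rV_(1 + m))).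
    move=> x A /nbhs_ballP[e /= e0 eA]; apply/nbhs_ballP; exists e => //= y.
    by move=> [_ xy]; apply: eA; split => // i j; rewrite !mxE; exact: xy.
  by move/continuousP : cf; exact.
Qed.

Definition rational_box (R : realType) (m : nat) (q : 'rV[rat]_m) (n : nat) :
    set 'rV[R]_m :=
  [set y : 'rV[R]_m |
    forall i : 'I_m, `|y ord0 i - ratr (q ord0 i)| < n.+1%:R^-1].

Lemma rV_open_bigcup (R : realType) (m : nat) (U : set 'rV[R]_m) : open U ->
  U = \bigcup_(c in [set c : 'rV[rat]_m * nat |
    @rational_box R m c.1 c.2 `<=` U]) @rational_box R m c.1 c.2.
Proof.
move=> oU; apply/seteqP; split => [x Ux|x [c Uc]]; last exact: Uc.
have /nbhs_ballP[e /= e0 xeU] : nbhs x U by exact: open_nbhs_nbhs.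
have [n ne] : exists n : nat, 2 / n.+1%:R < e.
  exists (Num.truncn (2 / e)).
  rewrite ltr_pdivrMr ?ltr0Sn// -ltr_pdivrMl// mulrC.
  exact: truncnS_gt.
have q0 (i : 'I_m) : exists q : rat, `|x ord0 i - ratr q| < n.+1%:R^-1.
  have : x ord0 i - n.+1%:R^-1 < x ord0 i + n.+1%:R^-1.
    by rewrite ltrBlDr -addrA ltrDl addr_gt0// invr_gt0 ltr0Sn.
  move=> /rat_in_itvoo[q]; rewrite in_itv/= => qx.
  by exists q; rewrite distrC ltr_distl.
pose q i := sval (cid (q0 i)).
have qP i : `|x ord0 i - ratr (q i)| < n.+1%:R^-1 := svalP (cid (q0 i)).
exists (\row_i q i, n) => /= [y yq|i]; last by rewrite mxE.
apply: xeU; split => // a i; rewrite ord1.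
have := yq i; rewrite mxE => {}yq.
rewrite /ball/= (le_lt_trans _ ne)//.
rewrite (le_trans (ler_distD (ratr (q i)) _ _))//.
by rewrite (mulrDl 1 1) mul1r lerD// ltW// distrC.
Qed.

Lemma measurable_rVcons (R : realType) (m : nat) :
  measurable_fun setT (@rVcons R m).
Proof.
apply: (@measurability _ _ _ _ _ _ (@open 'rV[R]_m.+1)) => //.
move=> _ [U oU <-]; rewrite setTI (rV_open_bigcup oU) preimage_bigcup.
rewrite bigcup_mkcond; apply: countable_bigcupT_measurable => // -[q n].
case: ifPn => // _.
pose B : set 'rV[R]_m := rational_box (\row_i q ord0 (lift ord0 i)) n.
rewrite (_ : _ @^-1` _ = ball (ratr (q ord0 ord0) : R) n.+1%:R^-1 `*` B).
  apply: measurableX; first exact: measurable_ball.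
  apply: rV_open_measurable.
  rewrite (_ : B = ball (\row_i (ratr (q ord0 (lift ord0 i)) : R)) n.+1%:R^-1).
    exact: ball_open.
  apply/seteqP; split => y.
    move=> By; split => [|a i]; rewrite ?invr_gt0// (ord1 a).
    by have := By i; rewrite !mxE /ball/=  distrC.
  by move=> [_ By] i; have := By ord0 i; rewrite !mxE /ball/= distrC.
apply/seteqP; split => [[a y]/= ay|[a y]/= [ay By] i].
  split => [|i]; first by have := ay ord0; rewrite rVcons0/= /ball/= distrC.
  by have := ay (lift ord0 i); rewrite rVconsS mxE.
case: (unliftP ord0 i) => [j ->|->].
  by rewrite rVconsS; have := By j; rewrite mxE.
by rewrite rVcons0/= distrC.
Qed.

Lemma pushforward_sigma_finite (R : realType) (d d' : measure_display)
    (T : measurableType d) (T' : measurableType d')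
    (mu : set T -> \bar R) (f : T -> T') (g : T' -> T) :
  measurable_fun setT g -> cancel f g ->
  sigma_finite setT mu -> sigma_finite setT (pushforward mu f).
Proof.
move=> mg fK [F FT Foo].
exists (fun n => g @^-1` F n).
  by rewrite -preimage_bigcup -FT preimage_setT.
move=> n; have [mF muF] := Foo n; split.
  by rewrite -[X in measurable X]setTI; exact: mg.
rewrite /pushforward (_ : _ @^-1` _ = F n)//.
by apply/seteqP; split => x /=; rewrite fK.
Qed.

Section rV_product.
Context (R : realType) (m : nat)
  (mu : {sigma_finite_measure set 'rV[R]_m -> \bar R}).
Local Open Scope ereal_scope.

Definition rV_product : set 'rV[R]_m.+1 -> \bar R :=
  pushforward (lebesgue_measure \x mu) (@rVcons R m).

Let rV_product_measure : {measure set 'rV[R]_m.+1 -> \bar R}.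
Proof.
refine (pushforward (lebesgue_measure \x mu) (@rVcons R m) :
  {measure set 'rV[R]_m.+1 -> \bar R}).
exact: measurable_rVcons.
Defined.

HB.instance Definition _ := isMeasure.Build _ _ _ rV_product
  (measure0 rV_product_measure) (@measure_ge0 _ _ _ rV_product_measure)
  (@measure_semi_sigma_additive _ _ _ rV_product_measure).

Let rV_product_sigma_finite : sigma_finite setT rV_product.
Proof.
apply: (pushforward_sigma_finite (@measurable_rVuncons R m) (@rVconsK R m)).
have /sigma_finiteP[F [TF ndF Foo]] := sigma_finiteT (@lebesgue_measure R).
have /sigma_finiteP[G [TG ndG Goo]] := sigma_finiteT mu.
exists (fun n => F n `*` G n).
  rewrite -setXTT TF TG predeqE => -[x y]; split.
    move=> [/= [n _ Fnx] [k _ Gky]]; exists (maxn n k) => //; split.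
    - by move: x Fnx; exact/subsetPset/ndF/leq_maxl.
    - by move: y Gky; exact/subsetPset/ndG/leq_maxr.
  by move=> [n _ []/= ? ?]; split; exists n.
move=> k; have [? ?] := Foo k; have [? ?] := Goo k.
split; first exact: measurableX.
by rewrite product_measure1E// lte_mul_pinfty// ge0_fin_numE.
Qed.

HB.instance Definition _ := Measure_isSigmaFinite.Build _ _ _ rV_product
  rV_product_sigma_finite.

End rV_product.

(* Lebesgue measure on the Borel sets of R^m: the iterated product of the
   one-dimensional Lebesgue measure (R^0 is a point). *)
Fixpoint lebesgue_rV (R : realType) (m : nat) :
    {sigma_finite_measure set 'rV[R]_m -> \bar R} :=
  if m is m'.+1 then rV_product (lebesgue_rV R m')
  else \d_(0 : 'rV[R]_0).

Definition open_unit_cube (R : realType) (m : nat) : set 'rV[R]_m :=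
  [set x : 'rV[R]_m | forall i : 'I_m, 0 < x ord0 i < 1].

Definition unit_cube (R : realType) (m : nat) : set 'rV[R]_m :=
  [set x : 'rV[R]_m | forall i : 'I_m, 0 < x ord0 i <= 1].

Definition partial (R : realType) (m : nat) (i : 'I_m)
    (f : 'rV[R]_m -> R) : 'rV[R]_m -> R :=
  fun x => 'D_(delta_mx ord0 i : 'rV[R]_m) f x.

Definition smooth (R : realType) (m : nat) (f : 'rV[R]_m -> R) : Prop :=
  forall s : seq 'I_m,
    continuous (foldr (@partial R m) f s) /\
    forall (i : 'I_m) (x : 'rV[R]_m),
      derivable (foldr (@partial R m) f s) x (delta_mx ord0 i : 'rV[R]_m).

(* C_c^oo((0,1)^m), each function being extended by zero to R^m. *)
Definition test_function (R : realType) (m : nat) (f : 'rV[R]_m -> R) : Prop :=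
  [/\ smooth f,
      compact (closure [set x | f x != 0]) &
      closure [set x | f x != 0] `<=` @open_unit_cube R m].

(* Every multi-index of order at most l has all its entries at most l. *)
Definition multi_index (m l : nat) := {ffun 'I_m -> 'I_l.+1}.

Definition mi_order (m l : nat) (a : multi_index m l) : nat :=
  (\sum_(i < m) a i)%N.

Definition mi_partial (R : realType) (m l : nat) (a : multi_index m l)
    (f : 'rV[R]_m -> R) : 'rV[R]_m -> R :=
  foldr (fun i g => iter (a i) (partial i) g) f (enum 'I_m).

Definition square_integrable (R : realType) (m : nat) (f : 'rV[R]_m -> R) :
    Prop :=
  measurable_fun (@unit_cube R m) f /\
  (\int[lebesgue_rV R m]_(x in @unit_cube R m) ((f x) ^+ 2)%:E < +oo)%E.

(* Squared distance, in the norm of W_2^l, of the smooth function f to the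
   family of L^2 functions (g a)_{|a| <= l}. *)
Definition sobolev_sqdist (R : realType) (m l : nat) (f : 'rV[R]_m -> R)
    (g : multi_index m l -> 'rV[R]_m -> R) : \bar R :=
  (\sum_(a : multi_index m l | (mi_order a <= l)%N)
    \int[lebesgue_rV R m]_(x in @unit_cube R m)
      ((mi_partial a f x - g a x) ^+ 2)%:E)%E.

(* The completion of the test functions in the norm of W_2^l is the closure
   of {(D^a f)_{|a| <= l} : f a test function} in the Hilbert sum of copies of
   L^2 of the cube.  A point g of this closure is given here together with
   the continuous representative u of its component of index 0; u is
   a uniform limit of test functions, so its extension by zero outside
   of (0,1)^m is continuous on R^m and is determined by the point. *)
Definition sobolev_limit (R : realType) (m l : nat) (u : 'rV[R]_m -> R)
    (g : multi_index m l -> 'rV[R]_m -> R) : Prop :=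
  [/\ continuous u /\ (forall x, ~ @open_unit_cube R m x -> u x = 0),
      g [ffun=> ord0] = u,
      (forall a, (mi_order a <= l)%N -> square_integrable (g a)) &
      exists phi : nat -> 'rV[R]_m -> R,
        (forall k, test_function (phi k)) /\
        sobolev_sqdist (phi k) g @[k --> \oo] --> 0%E].

Definition H0 (R : realType) (m l : nat) : set ('rV[R]_m -> R) :=
  [set u | exists g, @sobolev_limit R m l u g].

(* D^a u for u in H_0^l and |a| <= l.  Integration by parts against test
   functions shows that the g below is unique up to null sets and consists
   of the weak derivatives of u. *)
Definition sobolev_deriv (R : realType) (m l : nat) (a : multi_index m l)
    (u : 'rV[R]_m -> R) : 'rV[R]_m -> R :=
  xget (fun _ _ => 0) [set g | @sobolev_limit R m l u g] a.

Definition I_form (R : realType) (m l : nat) (u v : 'rV[R]_m -> R) : R :=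
  \int[lebesgue_rV R m]_(x in @unit_cube R m)
    \sum_(a : multi_index m l | mi_order a == l)
      sobolev_deriv a u x * sobolev_deriv a v x.

Definition J_form (R : realType) (m : nat)
    (nu : {measure set 'rV[R]_m -> \bar R}) (u v : 'rV[R]_m -> R) : R :=
  \int[nu]_x (u x * v x).

Definition polyharmonic (R : realType) (m l : nat)
    (nu : {measure set 'rV[R]_m -> \bar R}) (u : 'rV[R]_m -> R) :
    'rV[R]_m -> R :=
  xget (fun=> 0) [set v | H0 l v /\
    forall w, H0 l w -> J_form nu u w = I_form l v w].

Definition eigenspace_of (R : realType) (m l : nat)
    (nu : {measure set 'rV[R]_m -> \bar R}) (t : R) : set ('rV[R]_m -> R) :=
  [set f | H0 l f /\ polyharmonic l nu f = (fun x => t * f x)].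

(* For a linear subspace E. *)
Definition has_dim (R : realType) (T : Type) (E : set (T -> R)) (k : nat) :
    Prop :=
  exists b : 'I_k -> T -> R,
    (forall i, E (b i)) /\
    forall f, E f ->
      exists! c : 'I_k -> R, f = (fun x => \sum_(i < k) c i * b i x).

(* lam n is the (n+1)-st eigenvalue: lam is decreasing, and each positive
   number occurs in it as often as its multiplicity as an eigenvalue, so
   that all the other terms are zero. *)
Definition eigenvalue_sequence (R : realType) (m l : nat)
    (nu : {measure set 'rV[R]_m -> \bar R}) (lam : nat -> R) : Prop :=
  [/\ nonincreasing_seq lam,
      (forall n, 0 <= lam n),
      lam n @[n --> \oo] --> 0 &
      forall t : R, 0 < t -> exists k : nat,
        has_dim (eigenspace_of l nu t) k /\ ([set n | lam n = t] #= `I_k)%card].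

Definition dyadic_cube (R : realType) (m n : nat) (p : 'I_m -> int) :
    set 'rV[R]_m :=
  [set x : 'rV[R]_m | forall i : 'I_m,
    (p i)%:~R / 2 ^+ n < x ord0 i <= (p i + 1)%:~R / 2 ^+ n].

Definition dyadic_cubes (R : realType) (m : nat)
    (nu : {measure set 'rV[R]_m -> \bar R}) (n : nat) : set (set 'rV[R]_m) :=
  [set C | (exists p : 'I_m -> int, C = @dyadic_cube R m n p) /\
    (0 < nu C)%E].

Section spectral_partition.
Context (R : realType) (m : nat) (nu : {measure set 'rV[R]_m -> \bar R}).
Local Open Scope ereal_scope.

Definition beta_n (n : nat) (s : R) : \bar R :=
  lne (\esum_(C in dyadic_cubes nu n) nu C `^ s) / (ln (2 ^+ n)%R)%:E.

Definition beta (s : R) : \bar R := limn_esup (fun n => beta_n n s).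

Definition s_param (b : R) : \bar R :=
  ereal_inf [set s%:E | s in [set s : R |
    (0 < s)%R /\ beta s - (b * s)%:E <= 0]].

Definition upper_minkowski_dim : \bar R := beta 0%R.

End spectral_partition.

(* Main.v *)
Require Import Defs.
From mathcomp Require Import all_boot all_order all_algebra.
From mathcomp Require Import all_classical all_reals all_analysis.
From mathcomp Require Import measurable_realfun.
From mathcomp Require Import ring lra zify.

Set Implicit Arguments.
Unset Strict Implicit.
Unset Printing Implicit Defensive.
Import Order.TTheory GRing.Theory Num.Theory.
Import numFieldNormedType.Exports.
Local Open Scope classical_set_scope.
Local Open Scope ring_scope.

(** The eigenvalues are bounded from above by the min-max principle: if [n] linear
    functionals on [H_0^l] are such that [J(u,u) <= tau I(u,u)] on their common kernel, then
    the eigenvalue number [n + 1] is at most [tau] ([eigenvalue_le]).  Indeed, on the span of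
    the first [n + 1] eigenfunctions [J] dominates the last of these eigenvalues times [I],
    and this span contains a non-zero vector of the kernel.

    The functionals come from a partition of the cube into dyadic cubes.  Let [C] be a dyadic
    cube of side [h], and let [u] be such that all the derivatives of [u] of order less than
    [l] have mean zero on [C].  Since [2 l > m], a Sobolev inequality holds:
    [u ^ 2 <= c h ^ (2 l - m) E] on [C], where [E] is the integral over [C] of the squares of
    the derivatives of order [l] ([local_sobolev]).  Hence the integral of [u ^ 2] over [C]
    with respect to [nu] is at most [c v(C) E], where [v(C) = nu(C) h ^ (2 l - m)].  Starting
    from the unit cube, each cube with [v(C) > t] is cut into its [2 ^ m] children, and this
    stops because [v] tends to zero uniformly with the side.  On the cubes that remain
    [v <= t], so that [tau = c t] is admissible.  Apart from the unit cube they are children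
    of cubes with [v(C) > t], and the number of the latter is at most [t ^ (- s)] times the
    sum of [v(C) ^ s] over all dyadic cubes ([adaptive_partition]).

    Put [b = 2 l - m] and let [s_b] be the value of [s_param] at [b].  That sum is finite as
    soon as [s > s_b]: for some [s0 < s] one has
    [beta s0 <= b s0], and passing from [s0] to [s] gains a factor which decays geometrically
    in the level ([partition_sums_bounded]).  Therefore about [t ^ (- s)] functionals
    suffice for [tau = c t], so [lam n] is at most a constant times [n ^ (- 1 / s)], and [s]
    may be taken arbitrarily close to [s_b].  The other two inequalities are elementary: by
    concavity [beta s <= (1 - s) beta 0], which gives [s_b <= d / (b + d)] for
    [d = beta 0], and [d <= m] because there are [2 ^ (n m)] dyadic cubes of level [n].

    The proof of the Sobolev inequality uses only averages over cubes.  The L1 Poincare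
    inequality compares the average of [|f|] over a half cube with the average over the cube,
    up to the side times averages of the first derivatives.  For the derivatives of order [l]
    the Cauchy-Schwarz inequality bounds the average over the [k]-th cube of a nested
    sequence by [2 ^ (k m / 2)] times the square mean over the initial cube.  Descending
    through the orders, each step gains a factor [2 ^ (- k)], and at order zero the averages
    stay bounded; at a point of all these cubes they converge to the value of the function.
    The Poincare inequality is proved for smooth functions and extends to the completion
    because all its terms are continuous in L1.  The weak derivatives of a
    point of the completion are unique by a closability argument ([sobolev_limit0]), and [I]
    is positive definite by the inequality of Friedrichs ([sobolev_definite]). *)

(** * Boxes and iterated integrals *)

Section boxes.
Context {R : realType}.
Implicit Types (m : nat) (h : R).

Definition box m (c : 'I_m -> R) h : set 'rV[R]_m :=
  [set x : 'rV[R]_m | forall i, c i < x ord0 i <= c i + h].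

Definition tail_corner m (c : 'I_m.+1 -> R) : 'I_m -> R := fun i => c (lift ord0 i).

Lemma unit_cube_box m : @unit_cube R m = box (fun=> 0) 1.
Proof.
by apply/seteqP; split => x /= + i => /(_ i); rewrite add0r.
Qed.

Lemma preimage_rVcons_box m (c : 'I_m.+1 -> R) h :
  @rVcons R m @^-1` box c h = `]c ord0, c ord0 + h]%classic `*` box (tail_corner c) h.
Proof.
apply/seteqP; split => [[a y]/= ay|[a y]/= [ay By] i].
  split => [|i]; first by have := ay ord0; rewrite rVcons0/= in_itv.
  by have := ay (lift ord0 i); rewrite rVconsS.
case: (unliftP ord0 i) => [j ->|->].
  by rewrite rVconsS; have := By j.
by rewrite rVcons0/=; move: ay; rewrite in_itv.
Qed.

Lemma continuous_measurable_rV m (f : 'rV[R]_m -> R) (D : set 'rV[R]_m) :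
  continuous f -> measurable_fun D f.
Proof.
move=> cf; apply: (@measurable_funS _ _ _ _ setT) => //.
apply: (measurability _ (RGenOpens.measurableE R)).
move=> _ [_ [a [b ->] <-]]; rewrite setTI; apply: rV_open_measurable.
by move: cf => /continuousP; apply; exact: interval_open.
Qed.

Lemma measurable_coord m (i : 'I_m) :
  measurable_fun setT (fun x : 'rV[R]_m => x ord0 i).
Proof. by apply: continuous_measurable_rV; exact: coord_continuous. Qed.

Lemma measurable_box m (c : 'I_m -> R) h : measurable (box c h).
Proof.
rewrite (_ : box c h = \big[setI/setT]_(i < m)
    ((fun x : 'rV[R]_m => x ord0 i) @^-1` `]c i, c i + h]%classic)).
  apply: bigsetI_measurable => i _. rewrite -[X in measurable X]setTI.
  exact: measurable_coord.
rewrite -bigcap_seq; apply/seteqP; split => x /=.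
  by move=> bx i _; rewrite /= in_itv/=; exact: bx.
by move=> bx i; have := bx i (mem_index_enum i); rewrite /= in_itv.
Qed.

Local Open Scope ereal_scope.

Section tonelli.
Context (m : nat) (c : 'I_m.+1 -> R) (h : R) (f : 'rV[R]_m.+1 -> \bar R).
Hypothesis mf : measurable_fun setT f.
Hypothesis f0 : forall x, 0 <= f x.

Let g : R * 'rV[R]_m -> \bar R :=
  (f \o @rVcons R m) \_ (`]c ord0, (c ord0 + h)%R]%classic `*` box (tail_corner c) h).

Let mg : measurable_fun setT g.
Proof.
apply/(measurable_restrictT _ _).1.
  apply: measurableX => //; exact: measurable_box.
apply: measurable_funTS; apply: measurableT_comp => //.
exact: measurable_rVcons.
Qed.

Let g0 x : 0 <= g x.
Proof. by rewrite /g patchE; case: ifPn => // _; exact: f0. Qed.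

Let intE : \int[lebesgue_rV R m.+1]_(x in box c h) f x =
  \int[lebesgue_measure \x lebesgue_rV R m]_z g z.
Proof.
rewrite [LHS]/= /rV_product ge0_integral_pushforward//.
- by rewrite preimage_rVcons_box integral_mkcond.
- exact: measurable_rVcons.
- exact: measurable_box.
- exact: measurable_funTS.
Qed.

(** For non-negative functions the order of integration is free, so the first coordinate may
    be integrated last, as here, or first, as in [tonelli_box2]; every estimate below that
    proceeds by induction on the dimension rests on this pair. *)
Lemma tonelli_box1 : \int[lebesgue_rV R m.+1]_(x in box c h) f x =
  \int[lebesgue_measure]_(a in `]c ord0, (c ord0 + h)%R])
    \int[lebesgue_rV R m]_(y in box (tail_corner c) h) f (rVcons (a, y)).
Proof.
rewrite intE fubini_tonelli1// [RHS]integral_mkcond.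
apply: eq_integral => a _; rewrite patchE; case: ifPn => aI.
  rewrite [RHS]integral_mkcond; apply: eq_integral => y _.
  rewrite /g !patchE; congr (if _ then _ else _).
  by rewrite in_setX/= aI.
apply: integral0_eq => y _.
rewrite /g patchE; case: ifPn => //.
by rewrite in_setX/= (negbTE aI).
Qed.

Lemma tonelli_box2 : \int[lebesgue_rV R m.+1]_(x in box c h) f x =
  \int[lebesgue_rV R m]_(y in box (tail_corner c) h)
    \int[lebesgue_measure]_(a in `]c ord0, (c ord0 + h)%R]) f (rVcons (a, y)).
Proof.
rewrite intE fubini_tonelli2// [RHS]integral_mkcond.
apply: eq_integral => y _; rewrite patchE; case: ifPn => yB.
  rewrite [RHS]integral_mkcond; apply: eq_integral => a _.
  rewrite /g !patchE; congr (if _ then _ else _).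
  by rewrite in_setX/= yB andbT.
apply: integral0_eq => a _.
rewrite /g patchE; case: ifPn => //.
by rewrite in_setX/= (negbTE yB) andbF.
Qed.

End tonelli.

Lemma lebesgue_rV_box m (c : 'I_m -> R) h : (0 <= h)%R ->
  lebesgue_rV R m (box c h) = (h ^+ m)%:E.
Proof.
move=> h0; elim: m c => [|m IH] c.
  rewrite /= diracE mem_set ?expr0//= => -[] //.
rewrite -[LHS]mul1e -integral_cst; last exact: measurable_box.
rewrite (@tonelli_box1 _ _ _ (cst 1))//.
rewrite (eq_integral (fun=> (h ^+ m)%:E)); last first.
  move=> a _; rewrite integral_cst; last exact: measurable_box.
  by rewrite mul1e; exact: IH.
rewrite integral_cst//= lebesgue_measure_itv/= lte_fin ltrDl.
case: ltP => h1; first by rewrite -EFinD addrAC subrr add0r -EFinM exprSr.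
have -> : h = 0%R by apply/eqP; rewrite eq_le h0 h1.
by rewrite mule0 exprS mul0r.
Qed.

End boxes.

Section integral_helpers.
Local Open Scope ereal_scope.

(** Monotonicity without measurability: the integral of a non-negative function is
    a supremum over the simple functions below it. *)
Lemma ge0_le_integral_sup d (T : measurableType d) (R : realType)
    (mu : {measure set T -> \bar R}) (D : set T) (f g : T -> \bar R) :
  (forall x, D x -> 0 <= f x) -> (forall x, D x -> f x <= g x) ->
  \int[mu]_(x in D) f x <= \int[mu]_(x in D) g x.
Proof.
move=> f0 fg; rewrite !(integral_mkcond D).
have f'0 x : 0 <= (f \_ D) x by apply: erestrict_ge0.
have g'0 x : 0 <= (g \_ D) x.
  by apply: erestrict_ge0 => // t Dt; exact: le_trans (f0 _ Dt) (fg _ Dt).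
rewrite !ge0_integralTE//; apply: le_ereal_sup => _ [h hf <-].
by exists h => // x; apply: le_trans (hf x) _; exact: lee_restrict.
Qed.

Context {R : realType}.

Lemma measurable_integral_patch d (T : measurableType d) d' (U : measurableType d')
    (mu : {sigma_finite_measure set U -> \bar R}) (D : set U) (k : T * U -> \bar R) :
  measurable D -> measurable_fun setT k -> (forall z, 0 <= k z) ->
  measurable_fun setT (fun t => \int[mu]_(y in D) k (t, y)).
Proof.
move=> mD mk k0.
have -> : (fun t => \int[mu]_(y in D) k (t, y)) =
    fubini_F mu (k \_ (setT `*` D)).
  apply/funext => t; rewrite /fubini_F [LHS]integral_mkcond.
  congr integral; apply/funext => y; rewrite !patchE; congr (if _ then _ else _).
  by rewrite in_setX/= in_setT.
apply: measurable_fun_fubini_tonelli_F.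
  apply/(measurable_restrictT _ _).1; first exact: measurableX.
  exact: measurable_funTS.
by move=> z; rewrite patchE; case: ifPn.
Qed.

End integral_helpers.

(** * Continuously differentiable functions and their slices *)

Section slices.
Context {R : realType}.
Implicit Types m : nat.

Local Notation e_ i := (delta_mx ord0 i : 'rV[R]__).

Definition C1 m (f : 'rV[R]_m -> R) : Prop :=
  continuous f /\ forall i,
    (forall x, derivable f x (delta_mx ord0 i : 'rV[R]_m)) /\
    continuous (partial i f).

Lemma continuous_rVcons m : continuous (@rVcons R m).
Proof.
move=> [a y] A /nbhs_ballP[e /= e0 eA]; apply/nbhs_ballP; exists e => //= -[b z].
move=> [/= ab [_ yz]]; apply: eA; split => // i j; rewrite (ord1 i).
case: (unliftP ord0 j) => [k ->|->]; first by rewrite !rVconsS/=; exact: yz.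
by rewrite !rVcons0.
Qed.

Lemma continuous_rVcons1 m (a : R) : continuous (fun y : 'rV[R]_m => rVcons (a, y)).
Proof.
move=> y A /continuous_rVcons/nbhs_ballP[e /= e0 eA].
by apply/nbhs_ballP; exists e => //= z yz; apply: eA; split => //=; exact: ballxx.
Qed.

Lemma continuous_rVcons2 m (y : 'rV[R]_m) : continuous (fun a : R => rVcons (a, y)).
Proof.
move=> a A /continuous_rVcons/nbhs_ballP[e /= e0 eA].
by apply/nbhs_ballP; exists e => //= z yz; apply: eA; split => //=; exact: ballxx.
Qed.

Lemma rVcons_lift m (a t : R) (y : 'rV[R]_m) (j : 'I_m) :
  t *: delta_mx ord0 (lift ord0 j) + rVcons (a, y) =
  rVcons (a, t *: delta_mx ord0 j + y).
Proof.
apply/rowP => k; rewrite mxE [X in X + _]mxE [X in _ * X + _]mxE/=.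
case: (unliftP ord0 k) => [i ->|->]; rewrite ?(rVconsS, rVcons0)/=.
  by rewrite !mxE/= (inj_eq lift_inj).
by rewrite mulr0 add0r.
Qed.

Lemma rVcons_ord0 m (a t : R) (y : 'rV[R]_m) :
  t *: delta_mx ord0 ord0 + rVcons (a, y) = rVcons (t *: 1 + a, y).
Proof.
apply/rowP => k; rewrite mxE [X in X + _]mxE [X in _ * X + _]mxE/=.
case: (unliftP ord0 k) => [i ->|->]; rewrite ?(rVconsS, rVcons0)/=.
  by rewrite mulr0 add0r.
by [].
Qed.

Lemma derivable_slice m (f : 'rV[R]_m.+1 -> R) a y j :
  derivable f (rVcons (a, y)) (delta_mx ord0 (lift ord0 j)) =
  derivable (fun y => f (rVcons (a, y))) y (delta_mx ord0 j).
Proof.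
rewrite /derivable; set u := (X in cvg (X @ _)); set v := (X in _ = cvg (X @ _)).
suff -> : u = v by []; apply/funext => h; rewrite /u /v /=.
by rewrite rVcons_lift.
Qed.

Lemma partial_slice m (f : 'rV[R]_m.+1 -> R) a j :
  partial j (fun y => f (rVcons (a, y))) =
  (fun y => partial (lift ord0 j) f (rVcons (a, y))).
Proof.
apply/funext => y; rewrite /partial /derive; set u := (X in lim (X @ _)); set v := (X in _ = lim (X @ _)).
suff -> : u = v by []; apply/funext => h; rewrite /u /v /=.
by rewrite rVcons_lift.
Qed.

Lemma derivable_slice0 m (f : 'rV[R]_m.+1 -> R) (a : R) y :
  derivable f (rVcons (a, y)) (delta_mx ord0 ord0) =
  derivable (fun a => f (rVcons (a, y))) a (1:R).
Proof.
rewrite /derivable; set u := (X in cvg (X @ _)); set v := (X in _ = cvg (X @ _)).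
suff -> : u = v by []; apply/funext => h; rewrite /u /v /=.
by rewrite rVcons_ord0.
Qed.

Lemma partial_slice0 m (f : 'rV[R]_m.+1 -> R) (a : R) y :
  'D_1 (fun a : R => f (rVcons (a, y))) a = partial ord0 f (rVcons (a, y)).
Proof.
rewrite /partial /derive; set u := (X in lim (X @ _)); set v := (X in _ = lim (X @ _)).
suff -> : u = v by []; apply/funext => h; rewrite /u /v /=.
by rewrite rVcons_ord0.
Qed.

Lemma C1_slice m (f : 'rV[R]_m.+1 -> R) a :
  C1 f -> C1 (fun y => f (rVcons (a, y))).
Proof.
move=> [cf df]; split.
  by move=> y; apply: continuous_comp; [exact: continuous_rVcons1|exact: cf].
move=> i; split => [y|].
  by rewrite -derivable_slice; exact: (df (lift ord0 i)).1.
rewrite partial_slice => y.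
by apply: continuous_comp; [exact: continuous_rVcons1|exact: (df _).2].
Qed.

Lemma continuous_slice0 m (f : 'rV[R]_m.+1 -> R) y :
  continuous f -> continuous (fun a => f (rVcons (a, y))).
Proof.
by move=> cf a; apply: continuous_comp; [exact: continuous_rVcons2|exact: cf].
Qed.

End slices.

Section dim1.
Context {R : realType}.
Local Notation leb := (@lebesgue_measure R).
Local Open Scope ereal_scope.

Lemma FTC2_real (F : R -> R) a b : (a < b)%R ->
  (forall x : R, derivable F x 1%R) -> continuous (fun x : R => 'D_1 F x)%R ->
  \int[leb]_(x in `[a, b]) ('D_1 F x)%R%:E = (F b - F a)%:E.
Proof.
move=> ab dF cF; rewrite EFinB; apply: continuous_FTC2 => //.
- by apply: continuous_subspaceT.
- have cF' : continuous F.
    by move=> x; apply: differentiable_continuous; apply/derivable1_diffP.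
  split => //.
  + by apply: cvg_at_right_filter; exact: cF'.
  + by apply: cvg_at_left_filter; exact: cF'.
- by move=> x _; rewrite derive1E.
Qed.

(** The fundamental theorem of calculus, with a bound that does not depend on the two points:
    this uniformity is what the Poincare inequality needs. *)
Lemma increment_le_integral (F : R -> R) c h a b :
  (forall x : R, derivable F x 1%R) -> continuous (fun x : R => 'D_1 F x)%R ->
  (c <= a <= c + h)%R -> (c <= b <= c + h)%R ->
  `|F a - F b|%:E <= \int[leb]_(x in `]c, (c + h)%R]) `|'D_1 F x|%R%:E.
Proof.
move=> dF cF.
wlog ab : a b / (a <= b)%R.
  move=> H ah bh; case: (leP a b) => ab; first exact: H.
  by rewrite distrC; apply: H => //; exact: ltW.
move=> /andP[ca ah] /andP[cb bh].
move: ab; rewrite le_eqVlt => /predU1P[->|ab].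
  by rewrite subrr normr0; apply: integral_ge0.
have mF D : measurable_fun D (fun x : R => 'D_1 F x)%R.
  by apply: measurable_funTS; exact: continuous_measurable_fun.
have mN D : measurable_fun D (fun x : R => `|'D_1 F x|%:E)%R.
  by apply/measurable_EFinP; apply: measurableT_comp; [exact: normr_measurable|exact: mF].
rewrite distrC -[X in X <= _]/(`|(F b - F a)%:E|) -FTC2_real//.
rewrite integral_itv_obnd_cbnd; last first.
  exact: mN.
apply: (le_trans (le_abse_integral _ _ _)) => //; first by apply/measurable_EFinP; exact: mF.
apply: ge0_subset_integral => //.
  exact: mN.
by apply: subset_itv; rewrite bnd_simp.
Qed.

End dim1.

(** * The Poincare inequality in L1 *)

Section poincare.
Context {R : realType}.
Local Notation leb := (@lebesgue_measure R).
Local Open Scope ereal_scope.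

Lemma measurable_norm_increment m (f : 'rV[R]_m -> R) : continuous f ->
  measurable_fun setT (fun z : 'rV[R]_m * 'rV[R]_m => `|f z.1 - f z.2|%:E)%R.
Proof.
move=> cf; apply/measurable_EFinP.
apply: measurableT_comp; first exact: normr_measurable.
apply: measurable_funB.
  apply: (@measurableT_comp _ _ _ _ _ _ f); last exact: measurable_fst.
  exact: continuous_measurable_rV.
apply: (@measurableT_comp _ _ _ _ _ _ f); last exact: measurable_snd.
exact: continuous_measurable_rV.
Qed.

Lemma measurable_norm_rV m (f : 'rV[R]_m -> R) D : continuous f ->
  measurable_fun D (fun x : 'rV[R]_m => `|f x|%:E)%R.
Proof.
move=> cf; apply/measurable_EFinP.
apply: measurableT_comp; first exact: normr_measurable.
exact: continuous_measurable_rV.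
Qed.

Lemma lebesgue_itvoc (c h : R) : (0 <= h)%R ->
  leb `]c, (c + h)%R]%classic = h%:E.
Proof.
move=> h0; rewrite lebesgue_measure_itv/= lte_fin ltrDl.
case: ltP => h1; first by rewrite -EFinD addrAC subrr add0r.
by congr EFin; apply/eqP; rewrite eq_le h0 h1.
Qed.

Lemma integral_cst_itvoc (c h : R) (x : \bar R) : (0 <= h)%R ->
  \int[leb]_(b in `]c, (c + h)%R]) x = x * h%:E.
Proof.
by move=> h0; rewrite integral_cst//; congr (_ * _); exact: lebesgue_itvoc.
Qed.

Lemma integral_cst_box m (c : 'I_m -> R) (h : R) (x : \bar R) : (0 <= h)%R ->
  \int[lebesgue_rV R m]_(b in box c h) x = x * (h ^+ m)%:E.
Proof.
move=> h0; rewrite integral_cst; last exact: measurable_box.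
by congr (_ * _); exact: lebesgue_rV_box.
Qed.

(** Induction on the dimension.  A segment from [x] to [y] is replaced by a path that first
    changes the coordinates other than the first one, which costs the inequality for the
    slice through [x], and then moves along the first axis, which costs the integral [G] of
    the first partial derivative over a whole line. *)
Lemma poincare m (f : 'rV[R]_m -> R) (c : 'I_m -> R) h : (0 < h)%R -> C1 f ->
  \int[lebesgue_rV R m]_(x in box c h) \int[lebesgue_rV R m]_(y in box c h)
    `|f x - f y|%R%:E
  <= (h ^+ m.+1)%:E *
     \sum_(i < m) \int[lebesgue_rV R m]_(x in box c h) `|partial i f x|%R%:E.
Proof.
move=> h0; elim: m f c => [|m IH] f c Cf.
  rewrite big_ord0 mule0 integral0_eq// => x _; apply: integral0_eq => y _.
  by rewrite (_ : x = y) ?subrr ?normr0//; apply/rowP => -[].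
have cf := Cf.1.
set I := `]c ord0, (c ord0 + h)%R]%classic; set B := box (tail_corner c) h.
have mB : measurable B by exact: measurable_box.
have mI : measurable I by exact: measurable_itv.
have hm0 : (0 <= h ^+ m)%R by rewrite exprn_ge0// ltW.
pose F x := \int[lebesgue_rV R m.+1]_(y in box c h) `|f x - f y|%R%:E.
rewrite -/F tonelli_box1; last 2 first.
- apply: (@measurable_integral_patch R _ _ _ _ _ _ (fun z => `|f z.1 - f z.2|%R%:E)).
  + exact: measurable_box.
  + exact: measurable_norm_increment.
  + by move=> z; rewrite lee_fin.
- by move=> x; apply: integral_ge0 => y _; rewrite lee_fin.
pose G y' := \int[leb]_(b in I) `|partial ord0 f (rVcons (b, y'))|%R%:E.
pose D a x' := \int[lebesgue_rV R m]_(y' in B)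
  `|f (rVcons (a, x')) - f (rVcons (a, y'))|%R%:E.
pose K := \int[lebesgue_rV R m]_(y' in B) G y'.
have G0 y : 0 <= G y by apply: integral_ge0 => b _; rewrite lee_fin.
have D0 a y : 0 <= D a y by apply: integral_ge0 => b _; rewrite lee_fin.
have K0 : 0 <= K by apply: integral_ge0 => y' _.
have mG : measurable_fun setT G.
  apply: (@measurable_integral_patch R _ _ _ _ leb _ (fun z : 'rV[R]_m * R => `|partial ord0 f (rVcons (z.2, z.1))|%R%:E)) => //.
  apply/measurable_EFinP; apply: measurableT_comp; first exact: normr_measurable.
  apply: (@measurableT_comp _ _ _ _ _ _ (partial ord0 f)).
    exact: continuous_measurable_rV (Cf.2 ord0).2.
  apply: (@measurableT_comp _ _ _ _ _ _ (@rVcons R m)).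
    exact: measurable_rVcons.
  exact: measurable_swap.
have mD a : measurable_fun setT (D a).
  apply: (@measurable_integral_patch R _ _ _ _ _ _ (fun z : 'rV[R]_m * 'rV[R]_m =>
     `|f (rVcons (a, z.1)) - f (rVcons (a, z.2))|%R%:E)) => //.
  apply: (@measurable_norm_increment _ (fun y => f (rVcons (a, y)))).
  exact: (C1_slice a Cf).1.
have mS j : measurable_fun setT (fun a : R =>
    \int[lebesgue_rV R m]_(y in B) `|partial (lift ord0 j) f (rVcons (a, y))|%R%:E).
  apply: (@measurable_integral_patch R _ _ _ _ _ _ (fun z : R * 'rV[R]_m => `|partial (lift ord0 j) f (rVcons z)|%R%:E)) => //.
  apply/measurable_EFinP; apply: measurableT_comp; first exact: normr_measurable.
  apply: (@measurableT_comp _ _ _ _ _ _ (partial (lift ord0 j) f)).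
    exact: continuous_measurable_rV (Cf.2 _).2.
  exact: measurable_rVcons.
have KE : K = \int[lebesgue_rV R m.+1]_(x in box c h) `|partial ord0 f x|%R%:E.
  rewrite tonelli_box2//.
  by apply: measurable_norm_rV; exact: (Cf.2 _).2.
have FD a x' : I a -> F (rVcons (a, x')) <= h%:E * (D a x' + K).
  move=> Ia; rewrite /F tonelli_box1; last 2 first.
  - apply/measurable_EFinP; apply: measurableT_comp; first exact: normr_measurable.
    by apply: measurable_funB => //; exact: continuous_measurable_rV.
  - by move=> x; rewrite lee_fin.
  apply: (@le_trans _ _ (\int[leb]_(b in I) (D a x' + K))); last first.
    by rewrite integral_cst_itvoc ?(ltW h0)// [X in X <= _]muleC lexx.
  apply: ge0_le_integral_sup => b Ib; first by apply: integral_ge0 => y' _; rewrite lee_fin.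
  rewrite /D /K -ge0_integralD//; first last.
  - exact: measurable_funTS.
  - apply/measurable_EFinP; apply: measurableT_comp; first exact: normr_measurable.
    apply: measurable_funB => //.
    by apply: continuous_measurable_rV; exact: (C1_slice a Cf).1.
  apply: ge0_le_integral_sup => y' _; first by rewrite lee_fin.
  apply: (@le_trans _ _ (`|f (rVcons (a, x')) - f (rVcons (a, y'))|%R%:E +
     `|f (rVcons (a, y')) - f (rVcons (b, y'))|%R%:E)).
    by rewrite -EFinD lee_fin ler_distD.
  rewrite leeD2l//.
  have -> : G y' = \int[leb]_(s in I) `|'D_1 (fun s : R => f (rVcons (s, y'))) s|%R%:E.
    by apply: eq_integral => s _; rewrite partial_slice0.
  apply: (@increment_le_integral _ (fun s : R => f (rVcons (s, y')))).
    - by move=> x; rewrite -derivable_slice0; exact: (Cf.2 ord0).1.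
    - under eq_fun do rewrite partial_slice0.
      by apply: continuous_slice0; exact: (Cf.2 ord0).2.
    - by move: Ia; rewrite /I/= in_itv/= => /andP[/ltW -> ->].
    - by move: Ib; rewrite /I/= in_itv/= => /andP[/ltW -> ->].
pose S j a := \int[lebesgue_rV R m]_(y in B)
  `|partial (lift ord0 j) f (rVcons (a, y))|%R%:E.
have S0 j a : 0 <= S j a by apply: integral_ge0 => y _; rewrite lee_fin.
have step a : I a -> \int[lebesgue_rV R m]_(x' in B) F (rVcons (a, x')) <=
    h%:E * ((h ^+ m.+1)%:E * (\sum_(j < m) S j a) + (h ^+ m)%:E * K).
  move=> Ia; apply: (@le_trans _ _ (\int[lebesgue_rV R m]_(x' in B)
      (h%:E * (D a x' + K)))).
    apply: ge0_le_integral_sup => x' _; last exact: FD.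
    by apply: integral_ge0 => y' _; rewrite lee_fin.
  rewrite ge0_integralZl_EFin//; last 3 first.
  - by move=> x' _; rewrite adde_ge0.
  - apply: emeasurable_funD; first exact: measurable_funTS.
    exact: measurable_cst.
  - exact: ltW.
  rewrite lee_pmul2l// ge0_integralD//; last exact: measurable_funTS.
  rewrite leeD//; last first.
    by rewrite integral_cst_box ?(ltW h0)// [X in X <= _]muleC lexx.
  have -> : \sum_(j < m) S j a = \sum_(j < m) \int[lebesgue_rV R m]_(y in B)
      `|partial j (fun y => f (rVcons (a, y))) y|%R%:E.
    by apply: eq_bigr => j _; apply: eq_integral => y _; rewrite partial_slice.
  exact: IH (C1_slice a Cf).
apply: (@le_trans _ _ (\int[leb]_(a in I)
   (h%:E * ((h ^+ m.+1)%:E * (\sum_(j < m) S j a) + (h ^+ m)%:E * K)))).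
  apply: ge0_le_integral_sup => a Ia; last exact: step.
  by apply: integral_ge0 => x' _; apply: integral_ge0 => y' _; rewrite lee_fin.
have mSum : measurable_fun I (fun a => \sum_(j < m) S j a).
  by apply: emeasurable_sum => j; apply: measurable_funTS; exact: mS.
have hm1 : (0 <= h ^+ m.+1)%R by rewrite exprn_ge0// ltW.
rewrite ge0_integralZl_EFin//; last 3 first.
- move=> a _; rewrite adde_ge0// mule_ge0//.
  by apply: sume_ge0.
- apply: emeasurable_funD; last exact: measurable_cst.
  apply: measurable_funeM; exact: mSum.
- exact: ltW.
rewrite ge0_integralD//; last 3 first.
- by move=> a _; rewrite mule_ge0//; apply: sume_ge0.
- exact: measurable_funeM.
- by move=> a _; rewrite mule_ge0.
rewrite ge0_integralZl_EFin//; last by move=> a _; apply: sume_ge0.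
rewrite ge0_integral_sum//; last by move=> j; apply: measurable_funTS; exact: mS.
rewrite integral_cst_itvoc ?(ltW h0)// big_ord_recl -KE.
have -> : \sum_(i < m) \int[leb]_(a in I) S i a =
    \sum_(i < m) \int[lebesgue_rV R m.+1]_(x in box c h)
      `|partial (lift ord0 i) f x|%R%:E.
  apply: eq_bigr => j _; rewrite tonelli_box1//.
  by apply: measurable_norm_rV; exact: (Cf.2 _).2.
set T := \sum_(i < m) _.
have T0 : 0 <= T by apply: sume_ge0 => j _; apply: integral_ge0 => y _; rewrite lee_fin.
have -> : h%:E * ((h ^+ m.+1)%:E * T + (h ^+ m)%:E * K * h%:E) =
    (h ^+ m.+2)%:E * K + (h ^+ m.+2)%:E * T.
  rewrite ge0_muleDr ?mule_ge0 ?lee_fin//; [|exact: ltW..].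
  rewrite addeC; congr (_ + _); last by rewrite muleA -EFinM -exprS.
  by rewrite (muleAC (h ^+ m)%:E) -EFinM muleA -EFinM -exprSr -exprS.
by rewrite -ge0_muleDr.
Qed.

End poincare.

(** * Smooth functions *)

Section line.
Context {R : realType} {m : nat}.
Implicit Types (f : 'rV[R]_m -> R) (x z v : 'rV[R]_m).
Local Notation e_ i := (delta_mx ord0 i : 'rV[R]_m).

Lemma is_derive_line f z v s : derivable f (z + s *: v) v ->
  is_derive s (1 : R) (fun s : R => f (z + s *: v)) ('D_v f (z + s *: v)).
Proof.
move=> df.
have E (h : R) : f (z + (h *: 1 + s) *: v) = f (h *: v + (z + s *: v)).
  by rewrite scalerDl [h *: 1]mulr1 addrCA.
split.
  move: df; rewrite /derivable; set u := (X in cvg (X @ _)).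
  set w := (X in _ -> cvg (X @ _)).
  by suff -> : u = w by []; apply/funext => h; rewrite /u /w /= E.
rewrite /derive; set u := (X in lim (X @ _)); set w := (X in _ = lim (X @ _)).
by suff -> : u = w by []; apply/funext => h; rewrite /u /w /= E.
Qed.

(** The mean value theorem, applied to the first differences in the direction [j] as a function
    of the displacement in the direction [i], and then to the derivative so obtained. *)
Lemma mixed_difference f i j x h : 0 < h -> C1 f -> C1 (partial i f) ->
  exists s t : R, [/\ 0 < s < h, 0 < t < h &
    f (x + h *: e_ i + h *: e_ j) - f (x + h *: e_ i)
      - (f (x + h *: e_ j) - f x) =
    partial j (partial i f) (x + s *: e_ i + t *: e_ j) * h * h].
Proof.
move=> h0 [cf df] [cg dg].
pose F (s : R) := f (x + h *: e_ j + s *: e_ i) - f (x + s *: e_ i).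
have dF s : is_derive s (1 : R) F
    (partial i f (x + h *: e_ j + s *: e_ i) - partial i f (x + s *: e_ i)).
  by apply: is_deriveB; apply: is_derive_line; exact: (df i).1.
have cF : {within `[0, h], continuous F}.
  by apply: derivable_within_continuous => s _; case: (dF s).
have [s s0h Es] := MVT h0 (fun s _ => dF s) cF.
pose G (t : R) := partial i f (x + s *: e_ i + t *: e_ j).
have dG t : is_derive t (1 : R) G (partial j (partial i f) (x + s *: e_ i + t *: e_ j)).
  by apply: is_derive_line; exact: (dg j).1.
have cG : {within `[0, h], continuous G}.
  by apply: derivable_within_continuous => t _; case: (dG t).
have [t t0h Et] := MVT h0 (fun t _ => dG t) cG.
exists s, t; split; first by move: s0h; rewrite in_itv.
  by move: t0h; rewrite in_itv.
move: Es Et; rewrite /F /G !scale0r !addr0 subr0.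
rewrite (addrAC x (h *: e_ j) (h *: e_ i)) (addrAC x (h *: e_ j) (s *: e_ i)).
by move=> -> ->.
Qed.

(** Both mixed derivatives are limits of the same symmetric second difference
    quotient. *)
Lemma partialC f i j : C1 f -> C1 (partial i f) -> C1 (partial j f) ->
  continuous (partial j (partial i f)) -> continuous (partial i (partial j f)) ->
  partial i (partial j f) = partial j (partial i f).
Proof.
move=> Cf Ci Cj cji cij; apply/funext => x; apply/eqP; rewrite -subr_eq0.
apply/negPn/negP => ne0.
set A := partial i _ in cij ne0; set B := partial j (partial i f) in cji ne0.
pose d := `|A x - B x| / 2.
have d0 : 0 < d by rewrite divr_gt0// normr_gt0.
have /nbhs_ballP[e1 /= e10 P1] : \forall y \near x, `|A x - A y| < d.
  by have /cvgrPdist_lt := cij x; apply.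
have /nbhs_ballP[e2 /= e20 P2] : \forall y \near x, `|B x - B y| < d.
  by have /cvgrPdist_lt := cji x; apply.
pose h := Num.min e1 e2 / 3.
have h0 : 0 < h by rewrite divr_gt0// lt_min e10.
have nearx a b i' j' : 0 < a < h -> 0 < b < h ->
    ball x (Num.min e1 e2) (x + a *: e_ i' + b *: e_ j').
  move=> /andP[a0 ah] /andP[b0 bh]; split; first by rewrite lt_min e10.
  move=> u k; rewrite /ball/= !mxE.
  rewrite -addrA opprD addrA subrr sub0r normrN.
  have E c (p q : bool) : 0 < c -> `|c * (p && q)%:R| <= c.
    move=> c0; case: (p && q); last by rewrite mulr0 normr0 ltW.
    by rewrite mulr1 gtr0_norm.
  apply: le_lt_trans (ler_normD _ _) _.
  apply: (@le_lt_trans _ _ (a + b)); first by rewrite lerD ?E.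
  by move: ah bh; rewrite /h; lra.
have [s [t [sh th E1]]] := @mixed_difference f i j x h h0 Cf Ci.
have [s' [t' [s'h t'h E2]]] := @mixed_difference f j i x h h0 Cf Cj.
have E : B (x + s *: e_ i + t *: e_ j) = A (x + s' *: e_ j + t' *: e_ i).
  apply: (@mulIf _ h); first by rewrite gt_eqF.
  apply: (@mulIf _ h); first by rewrite gt_eqF.
  apply: etrans (esym E1) _; apply: etrans _ E2.
  rewrite (addrAC x (h *: e_ j) (h *: e_ i)).
  have abcd (p q r u : R) : p - q - (r - u) = p - r - (q - u) by ring.
  exact: abcd.
clearbody A B.
have he1 : Num.min e1 e2 <= e1 by rewrite ge_min lexx.
have he2 : Num.min e1 e2 <= e2 by rewrite ge_min lexx orbT.
have := P1 _ (le_ball he1 (nearx _ _ j i s'h t'h)).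
have := P2 _ (le_ball he2 (nearx _ _ i j sh th)).
rewrite E /= /d; move: (A x) (B x) (A _) => p q y qy py.
have := ltrD py qy; rewrite -splitr (distrC q) => /(le_lt_trans (ler_distD _ _ _)).
by rewrite ltxx.
Qed.

End line.

Section smooth_functions.
Context {R : realType} {m : nat}.
Implicit Types (f g : 'rV[R]_m -> R) (s t : seq 'I_m).
Local Notation e_ i := (delta_mx ord0 i : 'rV[R]_m).
Local Notation D_ s f := (foldr (@partial R m) f s).

Lemma smooth_C1 f s : smooth f -> C1 (D_ s f).
Proof.
move=> sf; split; first exact: (sf s).1.
by move=> i; split; [exact: (sf s).2|exact: (sf (i :: s)).1].
Qed.

Lemma smooth_partials f s : smooth f -> smooth (D_ s f).
Proof. by move=> sf t; rewrite -foldr_cat; exact: sf. Qed.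

Lemma smooth_partialC f i j : smooth f ->
  partial i (partial j f) = partial j (partial i f).
Proof.
move=> sf; apply: partialC.
- exact: (smooth_C1 [::]).
- exact: (smooth_C1 [:: i]).
- exact: (smooth_C1 [:: j]).
- exact: (sf [:: j; i]).1.
- exact: (sf [:: i; j]).1.
Qed.

(** By the symmetry of mixed derivatives only the multiplicities of the directions matter; this
    reconciles multi-indices with sequences of directions. *)
Lemma partials_perm f s t : smooth f -> perm_eq s t -> D_ s f = D_ t f.
Proof.
move=> sf; elim: s t => [|i s IH] t.
  by rewrite perm_sym => /perm_nilP ->.
move=> st; have it : i \in t by rewrite -(perm_mem st) mem_head.
case/splitPr: it st => t1 t2 st.
have /IH : perm_eq s (t1 ++ t2).
  by rewrite -(perm_cons i); rewrite (perm_trans st)// perm_catC/= perm_cons perm_catC.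
rewrite /= => ->; elim: t1 {st} => //= j t1 <-.
exact/smooth_partialC/smooth_partials.
Qed.

Lemma C1_lin f g a : C1 f -> C1 g ->
  C1 (fun x => a * f x + g x) /\ forall i, partial i (fun x => a * f x + g x) =
    (fun x => a * partial i f x + partial i g x).
Proof.
move=> Cf Cg.
have E i x : is_derive x (e_ i) (fun x => a * f x + g x)
    (a * partial i f x + partial i g x).
  apply: (@is_deriveD _ _ _ (fun x => a * f x) g).
    apply: (@is_deriveZ _ _ _ f); apply: DeriveDef => //; exact: (Cf.2 i).1.
  by apply: DeriveDef => //; exact: (Cg.2 i).1.
have pE i : partial i (fun x => a * f x + g x) =
    (fun x => a * partial i f x + partial i g x).
  by apply/funext => x; rewrite /partial; have [_ ->] := E i x.
have clin (u v : 'rV[R]_m -> R) : continuous u -> continuous v ->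
    continuous (fun x => a * u x + v x).
  move=> cu cv x; apply: (@continuousD _ _ _ (fun x => a * u x) v); last exact: cv.
  by apply: (@continuousM _ _ (fun=> a) u); [exact: cst_continuous|exact: cu].
split => //; split; first exact: clin Cf.1 Cg.1.
move=> i; split; first by move=> x; case: (E i x).
rewrite pE; exact: clin (Cf.2 i).2 (Cg.2 i).2.
Qed.

Lemma partials_lin f g a s : smooth f -> smooth g ->
  D_ s (fun x => a * f x + g x) = (fun x => a * D_ s f x + D_ s g x).
Proof.
move=> sf sg; elim: s => //= i s ->.
by apply: (C1_lin _ _ _).2; exact: smooth_C1.
Qed.

Lemma smooth_lin f g a : smooth f -> smooth g ->
  smooth (fun x => a * f x + g x).
Proof.
move=> sf sg s; rewrite partials_lin//.
have [[c d] _] := C1_lin a (smooth_C1 s sf) (smooth_C1 s sg).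
by split => // i x; exact: (d i).1.
Qed.

Lemma C1_mul f g : C1 f -> C1 g ->
  C1 (fun x => f x * g x) /\ forall i, partial i (fun x => f x * g x) =
    (fun x => partial i f x * g x + f x * partial i g x).
Proof.
move=> Cf Cg.
have E i x : is_derive x (e_ i) (fun x => f x * g x)
    (f x * partial i g x + g x * partial i f x).
  apply: (@is_deriveM _ _ f g).
    by apply: DeriveDef => //; exact: (Cf.2 i).1.
  by apply: DeriveDef => //; exact: (Cg.2 i).1.
have pE i : partial i (fun x => f x * g x) =
    (fun x => partial i f x * g x + f x * partial i g x).
  apply/funext => x; rewrite /partial; have [_ ->] := E i x.
  by rewrite addrC mulrC.
have cmul (u v : 'rV[R]_m -> R) : continuous u -> continuous v ->
    continuous (fun x => u x * v x).
  by move=> cu cv x; apply: (@continuousM _ _ u v); [exact: cu|exact: cv].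
split => //; split; first exact: cmul Cf.1 Cg.1.
move=> i; split; first by move=> x; case: (E i x).
rewrite pE => x.
apply: (@continuousD _ _ _ (fun x => partial i f x * g x) (fun x => f x * partial i g x)).
  exact: (cmul _ _ (Cf.2 i).2 Cg.1 x).
exact: (cmul _ _ Cf.1 (Cg.2 i).2 x).
Qed.

End smooth_functions.

(** * Multi-indices *)

Section multi_indices.
Context {R : realType} {m l : nat}.
Implicit Types (a : multi_index m l) (i : 'I_m) (f : 'rV[R]_m -> R).

Definition mi_seq a : seq 'I_m := flatten [seq nseq (a i) i | i <- enum 'I_m].

Lemma mi_partialE a f : mi_partial a f = foldr (@partial R m) f (mi_seq a).
Proof.
rewrite /mi_partial /mi_seq; elim: (enum 'I_m) => //= i s ->.
by rewrite foldr_cat; elim: (nat_of_ord (a i)) => //= n ->.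
Qed.

Lemma count_mi_seq a i : count_mem i (mi_seq a) = a i :> nat.
Proof.
rewrite /mi_seq count_flatten -map_comp sumnE big_map big_enum/=.
rewrite (bigD1 i)//= count_nseq/= eqxx mul1n big1 ?addn0// => j ji.
by rewrite count_nseq/= (negbTE ji).
Qed.

Lemma size_mi_seq a : size (mi_seq a) = mi_order a.
Proof.
rewrite /mi_seq size_flatten /shape -map_comp sumnE big_map big_enum/=.
by apply: eq_bigr => i _; rewrite size_nseq.
Qed.

Definition mi_incr a i : multi_index m l :=
  [ffun j => if j == i then inord (a j).+1 else a j].

Lemma mi_entry a i : (a i <= mi_order a)%N.
Proof. by rewrite /mi_order (bigD1 i)//= leq_addr. Qed.

Lemma mi_incrE a i j : (mi_order a < l)%N ->
  mi_incr a i j = (a j + (j == i))%N :> nat.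
Proof.
move=> al; rewrite ffunE; case: eqP => [->|_]; last by rewrite addn0.
by rewrite inordK ?addn1// ltnS (leq_ltn_trans (mi_entry a i)).
Qed.

Lemma mi_order_incr a i : (mi_order a < l)%N ->
  mi_order (mi_incr a i) = (mi_order a).+1.
Proof.
move=> al; rewrite /mi_order.
under eq_bigr do rewrite mi_incrE//.
rewrite big_split/= -[RHS]addn1; congr (_ + _)%N.
by rewrite (bigD1 i)//= eqxx big1// => j /negbTE ->.
Qed.

(** Although [mi_partial] differentiates in a fixed order of the coordinates, one more
    derivative in any direction leads to a derivative of the same family. *)
Lemma mi_partial_incr a i f : (mi_order a < l)%N -> smooth f ->
  mi_partial (mi_incr a i) f = partial i (mi_partial a f).
Proof.
move=> al sf; rewrite !mi_partialE.
rewrite (@partials_perm _ _ _ _ (i :: mi_seq a))//.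
apply/allP => j _ /=.
by rewrite !count_mi_seq mi_incrE//= addnC (eq_sym i).
Qed.

End multi_indices.

(** * Test functions *)

Section integrability.
Context {R : realType} {m : nat}.
Implicit Types (f g : 'rV[R]_m -> R) (c : 'I_m -> R) (h : R).

Lemma continuous_bounded_box f c h : continuous f ->
  exists2 M : R, 0 < M & forall x : 'rV[R]_m,
    (forall i, c i <= x ord0 i <= c i + h) -> `|f x| <= M.
Proof.
move=> cf.
have cK : compact [set x : 'rV[R]_m | forall i, `[c i, c i + h]%classic (x ord0 i)].
  by apply: (@rV_compact _ _ (fun i => `[c i, c i + h]%classic)) => i; exact: segment_compact.
have /compact_bounded[M [Mr HM]] := continuous_compact (continuous_subspaceT cf) cK.
exists (`|M| + 1); first by rewrite ltr_wpDl.
move=> x xc; apply: (HM (`|M| + 1)); first by rewrite ltr_pwDr// ler_norm.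
by exists x => // i; rewrite /= in_itv/=; exact: xc.
Qed.

Lemma continuous_integrable_box f c h : 0 <= h -> continuous f ->
  (lebesgue_rV R m).-integrable (box c h) (EFin \o f).
Proof.
move=> h0 cf; have [M M0 fM] := continuous_bounded_box c h cf.
apply: measurable_bounded_integrable.
- exact: measurable_box.
- by rewrite [X in (X < _)%E]lebesgue_rV_box// ltry.
- exact: continuous_measurable_rV.
- exists M; split; first exact: num_real.
  move=> M' MM' x /= bx; apply: le_trans (ltW MM'); apply: fM => i.
  by have /andP[/ltW -> ->] := bx i.
Qed.

Lemma continuous_integrable_cube f : continuous f ->
  (lebesgue_rV R m).-integrable (@unit_cube R m) (EFin \o f).
Proof. by rewrite unit_cube_box; exact: continuous_integrable_box. Qed.

End integrability.

Section test_functions.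
Context {R : realType}.
Local Notation D_ s f := (foldr (@partial R _) f s).
Local Notation "\int_cube f" := (\int[lebesgue_rV R _]_(x in @unit_cube R _) f x)
  (at level 36).

(** A substitute for test functions whose stability under differentiation is immediate;
    of the compact support only the vanishing outside the open cube is retained. *)
Definition vanishing m (f : 'rV[R]_m -> R) : Prop :=
  smooth f /\ forall s x, ~ @open_unit_cube R m x -> D_ s f x = 0.

Lemma test_vanishing m (f : 'rV[R]_m -> R) : test_function f -> vanishing f.
Proof.
move=> [sf _ fsub]; split => // s x xC.
have {xC} : ~ closure [set x | f x != 0] x by move/fsub.
elim: s x => [|i s IH] x xK.
  by apply/eqP/negPn/negP => /= fx; apply: xK; exact: subset_closure.
rewrite /= /partial (@near_eq_derive _ _ _ _ (cst 0)) ?derive_cst//.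
have : open (~` closure [set x | f x != 0]).
  by apply: closed_openC; exact: closed_closure.
rewrite openE => /(_ x xK); rewrite /interior => xn.
by apply: filterS xn => y; exact: IH.
Qed.

Lemma vanishing_partials m (f : 'rV[R]_m -> R) s : vanishing f -> vanishing (D_ s f).
Proof.
move=> [sf f0]; split; first exact: smooth_partials.
by move=> t x xC; rewrite -foldr_cat f0.
Qed.

Lemma test_lin m (f g : 'rV[R]_m -> R) a : test_function f -> test_function g ->
  test_function (fun x => a * f x + g x).
Proof.
move=> [sf kf Kf] [sg kg Kg].
have sub : closure [set x | a * f x + g x != 0] `<=`
    closure [set x | f x != 0] `|` closure [set x | g x != 0].
  rewrite -closureU; apply: closureS => x /=.
  have [->|] := eqVneq (f x) 0; last by left.
  by rewrite mulr0 add0r; right.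
split; first exact: smooth_lin.
  apply: (subclosed_compact _ (compactU kf kg) sub).
  exact: closed_closure.
by move=> x /sub[/Kf|/Kg].
Qed.

Lemma test0 m : test_function (fun _ : 'rV[R]_m => (0 : R)).
Proof.
have E s : D_ s (fun _ : 'rV[R]_m => (0 : R)) = (fun=> 0).
  by elim: s => //= i s ->; apply/funext => x; rewrite /partial derive_cst.
have S0 : closure [set x : 'rV[R]_m | (0 : R) != 0] = set0.
  by rewrite (_ : [set _ | _] = set0) ?closure0// -subset0 => x /=; rewrite eqxx.
split; last by rewrite S0.
  by move=> s; rewrite E; split; [exact: cst_continuous|move=> i x; exact: derivable_cst].
by rewrite S0; exact: compact0.
Qed.

Lemma outside_rVcons1 m (a : R) (y : 'rV[R]_m) :
  ~ @open_unit_cube R m y -> ~ @open_unit_cube R m.+1 (rVcons (a, y)).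
Proof. by move=> yC ay; apply: yC => i; have := ay (lift ord0 i); rewrite rVconsS. Qed.

Lemma outside_rVcons0 m (a : R) (y : 'rV[R]_m) :
  ~ (0 < a < 1) -> ~ @open_unit_cube R m.+1 (rVcons (a, y)).
Proof. by move=> a0 ay; apply: a0; have := ay ord0; rewrite rVcons0. Qed.

(** The constant [M] makes the integrand non-negative, so that the order of
    integration is free; the last integral to be computed is that of a derivative. *)
Lemma integral_partialD m (F : 'rV[R]_m -> R) (i : 'I_m) M : 0 <= M -> C1 F ->
  (forall x, ~ @open_unit_cube R m x -> F x = 0) ->
  (forall x, - M <= partial i F x) ->
  (\int[lebesgue_rV R m]_(x in @unit_cube R m) (partial i F x + M)%:E = M%:E)%E.
Proof.
move=> M0; elim: m F i => [|m IH] F i CF F0 FM; first by have := ltn_ord i.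
have mDF j : measurable_fun setT (fun x => (partial j F x + M)%:E).
  apply/measurable_EFinP; apply: measurable_funD => //.
  exact: continuous_measurable_rV (CF.2 j).2.
have DF0 x : (0 <= (partial i F x + M)%:E)%E.
  by rewrite lee_fin -lerBlDr sub0r.
rewrite unit_cube_box; case: (unliftP ord0 i) => [j|] iE.
  rewrite tonelli_box1//.
  under eq_integral.
    move=> a _.
      rewrite (_ : (\int[_]_(y in _) _)%E = M%:E); first over.
    transitivity (\int[lebesgue_rV R m]_(x in @unit_cube R m)
      (partial j (fun y => F (rVcons (a, y))) x + M)%:E)%E.
      by rewrite unit_cube_box; apply: eq_integral => y _; rewrite partial_slice iE.
    apply: IH => [|y yC|y]; [exact: C1_slice|apply: F0; exact: outside_rVcons1|].
    by rewrite partial_slice -iE.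
  by rewrite integral_cst_itvoc// mule1.
rewrite tonelli_box2//.
under eq_integral.
  move=> y _.
  rewrite (_ : (\int[_]_(a in _) _)%E = M%:E); first over.
  rewrite iE; pose G (a : R) := F (rVcons (a, y)) + M * a.
  have dG (a : R) : is_derive a (1 : R) G (partial ord0 F (rVcons (a, y)) + M).
    apply: is_deriveD; last first.
      by rewrite -[X in is_derive _ _ _ X]mulr1; apply: is_deriveZ.
    by rewrite -partial_slice0; apply: DeriveDef => //; rewrite -derivable_slice0;
      exact: (CF.2 ord0).1.
  have GE : (fun a : R => 'D_1 G a) = (fun a => partial ord0 F (rVcons (a, y)) + M).
    by apply/funext => a; case: (dG a).
  have cG : continuous (fun a : R => 'D_1 G a).
    rewrite GE => a; apply: (@continuousD _ _ _ (fun a : R => partial ord0 F (rVcons (a, y))) (fun=> M)); last exact: cst_continuous.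
    by apply: continuous_slice0; exact: (CF.2 ord0).2.
  rewrite integral_itv_obnd_cbnd; last first.
    apply/measurable_EFinP; rewrite -GE; apply: measurable_funTS.
    exact: continuous_measurable_fun.
  rewrite add0r -[RHS]/(M%:E).
  transitivity (\int[lebesgue_measure]_(a in `[(0:R)%R, (1:R)%R]) ('D_1 G a)%R%:E)%E.
    by apply: eq_integral => a _; rewrite (congr1 (fun f => f a) GE).
  rewrite FTC2_real//.
  congr EFin; rewrite /G !F0; last 2 first.
  - by apply: outside_rVcons0; rewrite ltxx.
  - by apply: outside_rVcons0; rewrite ltxx andbF.
  by rewrite mulr0 mulr1 !add0r subr0.
by rewrite integral_cst_box// expr1n mule1.
Qed.

(** In the direction [i] the derivative integrates to the difference of the values on two
    opposite faces. *)
Lemma Rintegral_partial m (F : 'rV[R]_m -> R) (i : 'I_m) : C1 F ->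
  (forall x, ~ @open_unit_cube R m x -> F x = 0) ->
  (forall x, ~ @open_unit_cube R m x -> partial i F x = 0) ->
  \int[lebesgue_rV R m]_(x in @unit_cube R m) partial i F x = 0.
Proof.
move=> CF F0 DF0; have ciF := (CF.2 i).2.
have [M M0 HM] := continuous_bounded_box (fun=> 0) 1 ciF.
have DM x : - M <= partial i F x.
  have [/HM|xC] := pselect (forall i, 0 <= x ord0 i <= 0 + 1).
    by rewrite ler_norml => /andP[].
  rewrite DF0 ?oppr_le0 ?ltW// => xo; apply: xC => j; rewrite add0r.
  by have /andP[/ltW -> /ltW ->] := xo j.
have := integral_partialD (ltW M0) CF F0 DM.
have mC : measurable (@unit_cube R m) by rewrite unit_cube_box; exact: measurable_box.
have iF := continuous_integrable_cube ciF.
have iM : (lebesgue_rV R m).-integrable (@unit_cube R m) (EFin \o (fun=> M)).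
  by apply: continuous_integrable_cube; exact: cst_continuous.
move=> E; have : \int[lebesgue_rV R m]_(x in @unit_cube R m) (partial i F x + M) = M.
  by rewrite /Rintegral E.
rewrite RintegralD// [X in _ + X](_ : _ = M) => [/eqP|].
  by rewrite -subr_eq0 addrK => /eqP.
rewrite /Rintegral unit_cube_box.
by rewrite (_ : (\int[_]_(_ in _) _)%E = M%:E)// integral_cst_box// expr1n mule1.
Qed.

Lemma integration_by_parts_partial m (f g : 'rV[R]_m -> R) i :
  vanishing f -> vanishing g ->
  \int[lebesgue_rV R m]_(x in @unit_cube R m) (partial i f x * g x) =
  - \int[lebesgue_rV R m]_(x in @unit_cube R m) (f x * partial i g x).
Proof.
move=> [sf f0] [sg g0].
have Cf := smooth_C1 [::] sf; have Cg := smooth_C1 [::] sg.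
have [Cfg fgE] := C1_mul Cf Cg.
have mC : measurable (@unit_cube R m) by rewrite unit_cube_box; exact: measurable_box.
apply/eqP; rewrite -subr_eq0 opprK -RintegralD//; last 2 first.
- apply: continuous_integrable_cube => x.
  by apply: (@continuousM _ _ (partial i f) g); [exact: (Cf.2 i).2|exact: Cg.1].
- apply: continuous_integrable_cube => x.
  by apply: (@continuousM _ _ f (partial i g)); [exact: Cf.1|exact: (Cg.2 i).2].
rewrite -(Rintegral_partial (i := i) Cfg); last 2 first.
- by move=> x xC; rewrite (f0 [::] _ xC) mul0r.
- move=> x xC; rewrite fgE (f0 [::] _ xC).
  by rewrite (f0 [:: i] _ xC : partial i f x = 0) !mul0r addr0.
by rewrite fgE.
Qed.

(** Integration by parts, once for each entry of [s]: up to a sign, [h] is the derivative of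
    [g] in the same directions, taken in the reverse order. *)
Lemma partials_adjoint m (g : 'rV[R]_m -> R) s : vanishing g ->
  exists2 h : 'rV[R]_m -> R, vanishing h & forall f, vanishing f ->
  \int[lebesgue_rV R m]_(x in @unit_cube R m) (D_ s f x * g x) =
  \int[lebesgue_rV R m]_(x in @unit_cube R m) (f x * h x).
Proof.
elim: s g => [|i s IH] g vg; first by exists g.
have [h vh hE] := IH (partial i g) (vanishing_partials [:: i] vg).
have mC : measurable (@unit_cube R m) by rewrite unit_cube_box; exact: measurable_box.
have [s0 z0] := test_vanishing (@test0 m).
exists (fun x => (-1) * h x + 0).
  split; first exact: smooth_lin vh.1 s0.
  move=> t x xC; rewrite partials_lin//; last exact: vh.1.
  by rewrite vh.2// z0// mulr0 addr0.
move=> f vf; rewrite /= integration_by_parts_partial//; last exact: vanishing_partials.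
rewrite hE// -[LHS]mulN1r -RintegralZl//; last first.
  apply: continuous_integrable_cube => x.
  by apply: (@continuousM _ _ f h); [exact: (vf.1 [::]).1|exact: (vh.1 [::]).1].
by apply: eq_Rintegral => x _; rewrite addr0 mulrCA.
Qed.

(** The value of [F] at a point is an integral of the first partial derivative along a line
    starting on the face where the first coordinate is zero. *)
Lemma friedrichs m (F : 'rV[R]_m.+1 -> R) : vanishing F ->
  (\int[lebesgue_rV R m.+1]_(x in @unit_cube R m.+1) `|F x|%:E <=
   \int[lebesgue_rV R m.+1]_(x in @unit_cube R m.+1) `|partial ord0 F x|%:E)%E.
Proof.
move=> [sF F0]; have CF := smooth_C1 [::] sF.
rewrite unit_cube_box tonelli_box2//; last by apply: measurable_norm_rV; exact: CF.1.
rewrite tonelli_box2//; last by apply: measurable_norm_rV; exact: (CF.2 _).2.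
apply: ge0_le_integral_sup => y _; first by apply: integral_ge0 => a _; rewrite lee_fin.
set K := (X in (_ <= X)%E).
apply: (@le_trans _ _ (\int[lebesgue_measure]_(a in `](0:R)%R, (0 + 1)%R]) K)%E).
  apply: ge0_le_integral_sup => a aI; first by rewrite lee_fin.
  rewrite (_ : K = \int[lebesgue_measure]_(s in `](0:R)%R, (0 + 1)%R])
    `|'D_1 (fun s : R => F (rVcons (s, y))) s|%:E)%E; last first.
    by apply: eq_integral => s _; rewrite partial_slice0.
  have E : F (rVcons (0, y)) = 0.
    by apply: (F0 [::]); apply: outside_rVcons0; rewrite ltxx.
  have -> : F (rVcons (a, y)) = F (rVcons (a, y)) - F (rVcons (0, y)) by rewrite E subr0.
  apply: (@increment_le_integral _ (fun s : R => F (rVcons (s, y)))).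
  - by move=> x; rewrite -derivable_slice0; exact: (CF.2 ord0).1.
  - under eq_fun do rewrite partial_slice0.
    by apply: continuous_slice0; exact: (CF.2 ord0).2.
  - by move: aI; rewrite /= in_itv/= => /andP[/ltW a0 a1]; apply/andP; split.
  - by rewrite lexx add0r ler01.
by rewrite integral_cst_itvoc// mule1.
Qed.

End test_functions.

(** * Square integrable functions on the unit cube *)

Section L2.
Context {R : realType} {m : nat}.
Implicit Types (f g : 'rV[R]_m -> R) (B : set 'rV[R]_m).
Local Notation mu := (lebesgue_rV R m).
Local Notation Q := (@unit_cube R m).
Local Notation L2 := (@square_integrable R m).

Definition sqint f : R := \int[mu]_(x in Q) (f x ^+ 2).

Lemma measurable_cube : measurable Q.
Proof. by rewrite unit_cube_box; exact: measurable_box. Qed.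
Local Hint Resolve measurable_cube : core.

Lemma sqint_ge0 f : 0 <= sqint f.
Proof. by apply: Rintegral_ge0 => x _; exact: sqr_ge0. Qed.

Lemma L2_sq f : L2 f -> mu.-integrable Q (EFin \o (fun x => f x ^+ 2)).
Proof.
move=> [mf foo]; apply/integrableP; split.
  by apply/measurable_EFinP; exact: measurable_funX.
rewrite (_ : (\int[_]_(x in _) _)%E = (\int[mu]_(x in Q) ((f x) ^+ 2)%:E)%E)//.
by apply: eq_integral => x _ /=; rewrite ger0_norm// sqr_ge0.
Qed.

Lemma sq_L2 f : measurable_fun Q f ->
  mu.-integrable Q (EFin \o (fun x => f x ^+ 2)) -> L2 f.
Proof.
move=> mf /integrableP[_ foo]; split => //; apply: le_lt_trans foo.
rewrite (_ : (\int[_]_(x in _) `|_|)%E = (\int[mu]_(x in Q) ((f x) ^+ 2)%:E)%E)//.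
by apply: eq_integral => x _ /=; rewrite ger0_norm// sqr_ge0.
Qed.

Lemma continuous_L2 f : continuous f -> L2 f.
Proof.
move=> cf; apply: sq_L2; first exact: continuous_measurable_rV.
apply: continuous_integrable_cube => x.
by apply: (@continuousM _ _ f f); exact: cf.
Qed.

Lemma L2_mul f g : L2 f -> L2 g -> mu.-integrable Q (EFin \o (fun x => f x * g x)).
Proof.
move=> Lf Lg.
have i2 := integrableD measurable_cube (L2_sq Lf) (L2_sq Lg).
apply: le_integrable i2 => //.
  by apply/measurable_EFinP; apply: measurable_funM; [exact: Lf.1|exact: Lg.1].
move=> x _ /=; rewrite lee_fin [X in _ <= X]ger0_norm ?addr_ge0 ?sqr_ge0//.
rewrite normrM; move: (normr_ge0 (f x)) (normr_ge0 (g x)).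
rewrite -[f x ^+ 2]real_normK ?num_real// -[g x ^+ 2]real_normK ?num_real//.
move: (`|f x|) (`|g x|) => p q p0 q0; nra.
Qed.

Lemma L2_integrable f : L2 f -> mu.-integrable Q (EFin \o f).
Proof.
move=> Lf; have := L2_mul Lf (continuous_L2 (@cst_continuous _ _ (1 : R))).
by apply: eq_integrable => // x _ /=; rewrite mulr1.
Qed.

Lemma L2_lin f g a : L2 f -> L2 g -> L2 (fun x => a * f x + g x).
Proof.
move=> Lf Lg; apply: sq_L2.
  apply: measurable_funD; last exact: Lg.1.
  by apply: measurable_funM => //; exact: Lf.1.
have i1 := integrableZl measurable_cube (a ^+ 2) (L2_sq Lf).
have i2 := integrableZl measurable_cube (2 * a) (L2_mul Lf Lg).
have := integrableD measurable_cube (integrableD measurable_cube i1 i2) (L2_sq Lg).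
by apply: eq_integrable => // x _ /=; rewrite -!EFinM -!EFinD; congr EFin; ring.
Qed.

Lemma L2_sub f g : L2 f -> L2 g -> L2 (fun x => f x - g x).
Proof.
move=> Lf Lg; have := L2_lin (-1) Lg Lf.
by under eq_fun do rewrite mulN1r addrC.
Qed.

Lemma sqint_lin f g a : L2 f -> L2 g ->
  sqint (fun x => a * f x + g x) <= 2 * a ^+ 2 * sqint f + 2 * sqint g.
Proof.
move=> Lf Lg; have i1 := integrableZl measurable_cube (2 * a ^+ 2) (L2_sq Lf).
have i2 := integrableZl measurable_cube 2 (L2_sq Lg).
rewrite /sqint -RintegralZl//; last exact: L2_sq.
rewrite -RintegralZl//; last exact: L2_sq.
rewrite -RintegralD//; apply: le_Rintegral => //.
- exact: L2_sq (L2_lin _ Lf Lg).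
- exact: (integrableD measurable_cube i1 i2).
- move=> x _; move: (f x) (g x) => p q.
  have := sqr_ge0 (a * p - q); rewrite sqrrB sqrrD !exprMn; lra.
Qed.

(** The Cauchy-Schwarz inequality with a parameter, which avoids square roots. *)
Lemma Rintegral_mul_le f g e : 0 < e -> L2 f -> L2 g ->
  `|\int[mu]_(x in Q) (f x * g x)| <= e * sqint f + e^-1 * sqint g.
Proof.
move=> e0 Lf Lg; have i1 := integrableZl measurable_cube e (L2_sq Lf).
have i2 := integrableZl measurable_cube e^-1 (L2_sq Lg).
rewrite /sqint -RintegralZl//; last exact: L2_sq.
rewrite -RintegralZl//; last exact: L2_sq.
rewrite -RintegralD//.
apply: le_trans (le_normr_Rintegral measurable_cube (L2_mul Lf Lg)) _.
apply: le_Rintegral => //.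
- exact: integrable_norm (L2_mul Lf Lg).
- exact: (integrableD measurable_cube i1 i2).
- move=> x _ /=; rewrite normrM.
  rewrite -[f x ^+ 2]real_normK ?num_real// -[g x ^+ 2]real_normK ?num_real//.
  move: (`|f x|) (`|g x|) (normr_ge0 (f x)) (normr_ge0 (g x)) => p q p0 q0.
  have -> : e * p ^+ 2 + e^-1 * q ^+ 2 = e^-1 * ((e * p) ^+ 2 + q ^+ 2).
    by rewrite mulrDr exprMn expr2 -(mulrA e e) mulKf// gt_eqF.
  rewrite ler_pdivlMl// mulrA.
  have : 0 <= e * p by rewrite mulr_ge0// ltW.
  move: (e * p) => r r0; nra.
Qed.

Lemma L1_le_sqint f e : 0 < e -> L2 f ->
  \int[mu]_(x in Q) `|f x| <= e + e^-1 * sqint f.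
Proof.
move=> e0 Lf.
have L1 : L2 (fun=> (1 : R)) by apply: continuous_L2; exact: cst_continuous.
have Lnf : L2 (fun x => `|f x|).
  apply: sq_L2; first by apply: measurableT_comp => //; exact: Lf.1.
  by have := L2_sq Lf; apply: eq_integrable => // x _ /=; rewrite real_normK ?num_real.
have := Rintegral_mul_le e0 L1 Lnf.
have -> : sqint (fun=> 1) = 1.
  rewrite /sqint /Rintegral unit_cube_box.
  by rewrite (_ : (\int[_]_(_ in _) _)%E = 1%:E)// expr1n integral_cst_box// expr1n mule1.
have -> : sqint (fun x => `|f x|) = sqint f.
  by apply: eq_Rintegral => x _; rewrite real_normK ?num_real.
rewrite mulr1; apply: le_trans; rewrite ger0_norm//; last first.
  by apply: Rintegral_ge0 => x _; rewrite mul1r.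
by under [leRHS]eq_Rintegral do rewrite mul1r.
Qed.

Lemma sqint0_ae f : L2 f -> sqint f = 0 -> {ae mu, forall x, Q x -> f x = 0}.
Proof.
move=> Lf; have iN := integrable_fin_num measurable_cube (L2_sq Lf).
rewrite /sqint /Rintegral => /(congr1 (@EFin R)); rewrite fineK// => E.
have : (\int[mu]_(x in Q) `|(f x ^+ 2)%:E| = 0)%E.
  by rewrite -[RHS]E; apply: eq_integral => x _ /=; rewrite ger0_norm// sqr_ge0.
move=> /(ae_eq_integral_abs mu measurable_cube).
move=> H; have {}H := H (measurable_int _ (L2_sq Lf)).
apply: filterS H => x Hx Qx; have := Hx Qx => /= -[] /eqP.
by rewrite sqrf_eq0 => /eqP.
Qed.

End L2.

(** * Points of the completion *)

Section sobolev.
Context {R : realType} {m l : nat}.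
Implicit Types (u f : 'rV[R]_m -> R) (B : set 'rV[R]_m)
  (a : multi_index m l) (g : multi_index m l -> 'rV[R]_m -> R).
Local Notation mu := (lebesgue_rV R m).
Local Notation Q := (@unit_cube R m).
Local Notation L2 := (@square_integrable R m).

Lemma sqintE f : L2 f -> (\int[mu]_(x in Q) ((f x) ^+ 2)%:E)%E = (sqint f)%:E.
Proof.
move=> Lf; rewrite /sqint /Rintegral fineK//.
exact: (integrable_fin_num measurable_cube (L2_sq Lf)).
Qed.

Lemma test_L2 f a : test_function f -> L2 (mi_partial a f).
Proof.
by move=> [sf _ _]; apply: continuous_L2; rewrite mi_partialE; exact: (sf _).1.
Qed.

Lemma sobolev_L2 u g a : sobolev_limit u g -> (mi_order a <= l)%N -> L2 (g a).
Proof. by case=> _ _ + _; exact. Qed.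

(** Together with the converse [approx_sobolev], this replaces the convergent sequence by a
    statement about one approximating function at a time. *)
Lemma sobolev_approx u g e : sobolev_limit u g -> 0 < e ->
  exists2 phi, test_function phi & forall a, (mi_order a <= l)%N ->
    sqint (fun x => mi_partial a phi x - g a x) <= e.
Proof.
move=> [_ _ Lg [phi [tphi]]] + e0 => /fine_cvgP[Fin /cvgrPdist_lt/(_ e e0) Cv].
have [k _ /(_ k (leqnn k))/= [Fk Ck]] : \forall k \near \oo,
    sobolev_sqdist (phi k) g \is a fin_num /\
    `|0 - fine (sobolev_sqdist (phi k) g)| < e by near do split.
exists (phi k) => // a al.
have La : L2 (fun x => mi_partial a (phi k) x - g a x).
  by apply: L2_sub; [exact: test_L2|exact: Lg].
rewrite -lee_fin -sqintE//.
apply: (@le_trans _ _ (sobolev_sqdist (phi k) g)).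
  rewrite /sobolev_sqdist (bigD1 a)//= leeDl// sume_ge0// => b _.
  by apply: integral_ge0 => x _; rewrite lee_fin sqr_ge0.
rewrite -[X in (X <= _)%E]fineK// lee_fin.
by apply: ltW; apply: le_lt_trans Ck; rewrite sub0r normrN ler_norm.
Unshelve. all: by end_near. Qed.

Lemma approx_sobolev u g :
  continuous u -> (forall x, ~ @open_unit_cube R m x -> u x = 0) ->
  g [ffun=> ord0] = u -> (forall a, (mi_order a <= l)%N -> L2 (g a)) ->
  (forall e, 0 < e -> exists2 phi, test_function phi &
    forall a, (mi_order a <= l)%N ->
      sqint (fun x => mi_partial a phi x - g a x) <= e) ->
  sobolev_limit u g.
Proof.
move=> cu u0 gu Lg H; split => //.
have H' (k : nat) : exists phi, test_function phi /\
    forall a, (mi_order a <= l)%N ->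
      sqint (fun x => mi_partial a phi x - g a x) <= k.+1%:R^-1.
  by have [phi ? ?] := H k.+1%:R^-1 (ltac:(by rewrite invr_gt0)); exists phi.
have [phi phiP] := choice H'; exists phi; split; first by move=> k; case: (phiP k).
pose N : R := #|{: multi_index m l}|%:R.
apply: (@squeeze_cvge _ _ _ _ (fun=> 0%E) _ (fun k : nat => (N * k.+1%:R^-1)%:E)).
- apply: nearW => k; apply/andP; split.
    by apply: sume_ge0 => b _; apply: integral_ge0 => x _; rewrite lee_fin sqr_ge0.
  apply: (@le_trans _ _ (\sum_(a : multi_index m l | (mi_order a <= l)%N)
      (k.+1%:R^-1)%:E)%E).
    apply: lee_sum => a al; rewrite sqintE; last first.
      by apply: L2_sub; [apply: test_L2; case: (phiP k)|exact: Lg].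
    by rewrite lee_fin; exact: (phiP k).2.
  rewrite sumEFin lee_fin big_const iter_addr_0 -[X in X <= _]mulr_natl.
  by rewrite ler_wpM2r// ler_nat max_card.
- exact: cvg_cst.
- apply: cvg_EFin; first exact: nearW.
  rewrite (_ : _ \o _ = (fun k => N * harmonic k))//.
  by rewrite -(mulr0 N); exact: (cvgMl_tmp cvg_harmonic).
Qed.

Lemma sobolev_lin u v g g' c : sobolev_limit u g -> sobolev_limit v g' ->
  sobolev_limit (fun x => c * u x + v x) (fun a x => c * g a x + g' a x).
Proof.
move=> su sv; have [[cu u0] gu Lg _] := su; have [[cv v0] gv Lg' _] := sv.
apply: approx_sobolev => //.
- move=> x; apply: (@continuousD _ _ _ (fun x => c * u x) v); last exact: cv.
  by apply: (@continuousM _ _ (fun=> c) u); [exact: cst_continuous|exact: cu].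
- by move=> x xC; rewrite u0// v0// mulr0 addr0.
- by rewrite gu gv.
- by move=> a al; apply: L2_lin; [exact: Lg|exact: Lg'].
move=> e e0.
have d0 : 0 < e / (2 * c ^+ 2 + 2) by rewrite divr_gt0// ltr_wpDl// mulr_ge0// sqr_ge0.
have [p tp pP] := sobolev_approx su d0.
have [q tq qP] := sobolev_approx sv d0.
exists (fun x => c * p x + q x); first exact: test_lin.
move=> a al.
have -> : (fun x => mi_partial a (fun x => c * p x + q x) x - (c * g a x + g' a x)) =
    (fun x => c * (mi_partial a p x - g a x) + (mi_partial a q x - g' a x)).
  apply/funext => x; rewrite !mi_partialE partials_lin; [ring|by case: tp|by case: tq].
apply: le_trans (sqint_lin _ _ _) _.
- by apply: L2_sub; [exact: test_L2|exact: Lg].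
- by apply: L2_sub; [exact: test_L2|exact: Lg'].
have De : e / (2 * c ^+ 2 + 2) * (2 * c ^+ 2 + 2) = e.
  by rewrite divfK// gt_eqF// ltr_wpDl// mulr_ge0// sqr_ge0.
rewrite -[leRHS]De mulrDr; apply: lerD.
  by rewrite mulrC ler_wpM2r ?pP// mulr_ge0// sqr_ge0.
by rewrite mulrC ler_wpM2r ?qP.
Qed.

Lemma sobolev0 : sobolev_limit (fun _ : 'rV[R]_m => 0) (fun (_ : multi_index m l) _ => 0).
Proof.
apply: approx_sobolev => //.
- exact: cst_continuous.
- by move=> a _; apply: continuous_L2; exact: cst_continuous.
move=> e e0; exists (fun=> 0); first exact: test0.
move=> a _; rewrite (_ : sqint _ = 0) ?ltW//.
rewrite /sqint mi_partialE (_ : foldr _ _ _ = fun=> 0).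
  by rewrite /Rintegral integral0_eq// => x _; rewrite subrr expr0n.
by elim: (mi_seq a) => //= i s ->; apply/funext => x; rewrite /partial derive_cst.
Qed.

Lemma sobolev_sum (I : Type) (s : seq I) (c : I -> R) (U : I -> 'rV[R]_m -> R)
    (G : I -> multi_index m l -> 'rV[R]_m -> R) :
  (forall i, sobolev_limit (U i) (G i)) ->
  sobolev_limit (fun x => \sum_(i <- s) c i * U i x)
                (fun a x => \sum_(i <- s) c i * G i a x).
Proof.
move=> H; elim: s => [|i s IH].
  by under eq_fun do rewrite big_nil; under [in X in sobolev_limit _ X]eq_fun do
    under eq_fun do rewrite big_nil; exact: sobolev0.
under eq_fun do rewrite big_cons.
under [in X in sobolev_limit _ X]eq_fun do under eq_fun do rewrite big_cons.
exact: sobolev_lin.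
Qed.

(** Closability.  If the test functions [p], [q] approximate the point, then the integral of
    [D^a q * D^a p] is small when [p] is kept fixed and [q] tends to zero in L2, since the
    derivatives can be moved to [p]; but it is close to the integral of [h a ^ 2].  Testing
    against the approximating functions themselves makes a density theorem superfluous. *)
Lemma sobolev_limit0 (h : multi_index m l -> 'rV[R]_m -> R) a :
  sobolev_limit (fun=> 0) h -> (mi_order a <= l)%N ->
  sqint (h a) = 0.
Proof.
move=> s0 al; have [_ h0 Lh _] := s0.
have Lha := Lh _ al.
suff H eta : 0 < eta -> sqint (h a) <= eta.
  apply/eqP; rewrite eq_le sqint_ge0 andbT leNgt; apply/negP => p0.
  by have := H (sqint (h a) / 2) (divr_gt0 p0 (ltr0Sn _ 1)); lra.
move=> eta0.
have e10 : 0 < eta / 8 by rewrite divr_gt0.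
have [p tp pP] := sobolev_approx s0 e10.
have Lp := test_L2 a tp; have vp := vanishing_partials (mi_seq a) (test_vanishing tp).
have [chi vchi chiE] := partials_adjoint (mi_seq a) vp.
have Lchi : L2 chi by apply: continuous_L2; exact: (vchi.1 [::]).1.
pose M := 1 + sqint (mi_partial a p) + sqint chi.
have M0 : 0 < M by rewrite /M; have := sqint_ge0 (mi_partial a p);
  have := sqint_ge0 chi; lra.
(* Small enough for the fixed norms of [p] and [chi] to be absorbed. *)
pose d := eta / 16 / M.
have d0 : 0 < d by rewrite divr_gt0// divr_gt0.
have e20 : 0 < eta / 16 * d by rewrite mulr_gt0// divr_gt0.
have [q tq qP] := sobolev_approx s0 e20.
have Lq := test_L2 a tq; have vq := test_vanishing tq.
have Lq0 : L2 q by apply: continuous_L2; exact: (vq.1 [::]).1.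
have B1 := Rintegral_mul_le (e := 2^-1) (ltac:(lra)) Lha (L2_sub Lha Lp).
have B2 := Rintegral_mul_le d0 Lp (L2_sub Lha Lq).
have B3 := Rintegral_mul_le d0 Lchi Lq0.
have sN (f g : 'rV[R]_m -> R) : sqint (fun x => f x - g x) = sqint (fun x => g x - f x).
  by apply: eq_Rintegral => x _; rewrite -sqrrN opprB.
have E1 := pP _ al; have E2 := qP _ al.
have E3 : sqint q <= eta / 16 * d.
  have := qP [ffun=> ord0]; rewrite h0 /mi_order.
  under eq_bigr do rewrite ffunE.
  rewrite sum_nat_const muln0 => /(_ isT).
  rewrite (_ : (fun x => _ - _) = q)//; apply/funext => x; rewrite subr0 mi_partialE.
  rewrite (_ : mi_seq _ = [::])//; apply/size0nil; rewrite size_mi_seq /mi_order.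
  by under eq_bigr do rewrite ffunE; rewrite sum_nat_const muln0.
have iI1 := L2_mul Lha (L2_sub Lha Lp).
have iI2 := L2_mul Lp (L2_sub Lha Lq).
have iI3 := L2_mul Lq Lp.
have E : sqint (h a) = \int[mu]_(x in Q) (h a x * (h a x - mi_partial a p x)) +
    \int[mu]_(x in Q) (mi_partial a p x * (h a x - mi_partial a q x)) +
    \int[mu]_(x in Q) (chi x * q x).
  have -> : \int[mu]_(x in Q) (chi x * q x) =
      \int[mu]_(x in Q) (mi_partial a q x * mi_partial a p x).
    rewrite !mi_partialE (chiE q vq); apply: eq_Rintegral => x _; exact: mulrC.
  rewrite -RintegralD//; last exact: measurable_cube.
  rewrite -RintegralD//; last 2 first.
  - exact: measurable_cube.
  - exact: (integrableD measurable_cube iI1 iI2).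
  by apply: eq_Rintegral => x _; ring.
have F2 : d * sqint (mi_partial a p) + d * sqint chi <= eta / 16.
  rewrite -mulrDr; apply: (@le_trans _ _ (d * M)).
    by rewrite ler_wpM2l ?ltW// /M; lra.
  by rewrite /d divfK// gt_eqF.
have F3 x : x <= eta / 16 * d -> d^-1 * x <= eta / 16.
  by move=> xd; rewrite ler_pdivrMl// mulrC.
rewrite sN in E1; rewrite sN in E2.
have sumup (S I1 I2 I3 X Y1 Y2 Z1 Z2 : R) : S = I1 + I2 + I3 ->
    I1 <= 2^-1 * S + 2^-1^-1 * X -> X <= eta / 8 -> I2 <= Y1 + Z1 -> I3 <= Y2 + Z2 ->
    Y1 + Y2 <= eta / 16 -> Z1 <= eta / 16 -> Z2 <= eta / 16 -> S <= eta.
  by clear -eta0; rewrite invrK; lra.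
exact: (sumup _ _ _ _ _ _ _ _ _ E (le_trans (ler_norm _) B1) E1
  (le_trans (ler_norm _) B2) (le_trans (ler_norm _) B3) F2 (F3 _ E2) (F3 _ E3)).
Qed.

Lemma sobolev_unique u g g' a : sobolev_limit u g -> sobolev_limit u g' ->
  (mi_order a <= l)%N -> {ae mu, forall x, Q x -> g a x = g' a x}.
Proof.
move=> su su' al; have := sobolev_lin (-1) su su'.
rewrite (_ : (fun x => _) = fun=> 0); last by apply/funext => x; rewrite mulN1r addNr.
move=> /sobolev_limit0/(_ al)/sqint0_ae H.
have : L2 (fun x => -1 * g a x + g' a x).
  by apply: L2_lin; [exact: sobolev_L2 su al|exact: sobolev_L2 su' al].
move=> /H; apply: filterS => x Hx Qx; have /eqP := Hx Qx.
by rewrite mulN1r addrC subr_eq0 => /eqP.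
Qed.

End sobolev.

(** * L1 estimates on boxes *)

Section L1_boxes.
Context {R : realType} {m : nat}.
Implicit Types (f : 'rV[R]_m -> R) (B W : set 'rV[R]_m) (c : 'I_m -> R) (h : R).
Local Notation mu := (lebesgue_rV R m).

Definition L1norm W f : R := \int[mu]_(x in W) `|f x|.

Lemma L1norm_ge0 W f : 0 <= L1norm W f.
Proof. exact: Rintegral_ge0. Qed.

Lemma L1normE W f : measurable W -> mu.-integrable W (EFin \o f) ->
  (\int[mu]_(x in W) `|f x|%:E)%E = (L1norm W f)%:E.
Proof.
move=> mW iW; rewrite /L1norm /Rintegral fineK//.
exact: (integrable_fin_num mW (integrable_norm iW)).
Qed.

Lemma L1normS W W' f : measurable W -> measurable W' -> W `<=` W' ->
  mu.-integrable W' (EFin \o f) -> L1norm W f <= L1norm W' f.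
Proof.
move=> mW mW' WW' iW'; have iW := integrableS mW' mW WW' iW'.
rewrite -lee_fin -!L1normE//.
apply: ge0_subset_integral => //.
by have := measurable_int _ iW' => /measurable_EFinP mf; apply/measurable_EFinP;
  exact: measurableT_comp.
Qed.

Let increment (B : set 'rV[R]_m) f x := (\int[mu]_(y in B) `|f x - f y|%:E)%E.

Let incr_ge0 B f x : (0 <= increment B f x)%E.
Proof. by apply: integral_ge0 => y _; rewrite lee_fin. Qed.

Let measurable_increment B f D : measurable B -> continuous f ->
  measurable_fun D (increment B f).
Proof.
move=> mB cf; apply: measurable_funTS.
apply: (@measurable_integral_patch R _ _ _ _ _ _
  (fun z : 'rV[R]_m * 'rV[R]_m => `|f z.1 - f z.2|%:E)) => //.
exact: measurable_norm_increment.
Qed.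

Let poincare_real f c h : 0 < h -> C1 f ->
  (\int[mu]_(x in box c h) increment (box c h) f x <=
   (h ^+ m.+1 * \sum_(i < m) L1norm (box c h) (partial i f))%:E)%E.
Proof.
move=> h0 Cf; apply: le_trans (poincare c h0 Cf) _.
rewrite EFinM -sumEFin; apply: lee_wpmul2l.
  by rewrite lee_fin exprn_ge0// ltW.
apply: lee_sum => i _; rewrite L1normE//; first exact: measurable_box.
by apply: continuous_integrable_box (Cf.2 i).2; exact: ltW.
Qed.

(** Averaging [|f x| <= |f y| + |f x - f y|] over [x] in the small box and [y] in the
    large one. *)
Lemma L1norm_subbox f c c' h : 0 < h -> C1 f -> box c' (h / 2) `<=` box c h ->
  L1norm (box c' (h / 2)) f <= 2^-1 ^+ m * L1norm (box c h) f +
    h * \sum_(i < m) L1norm (box c h) (partial i f).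
Proof.
move=> h0 Cf sub; set B := box c h; set W := box c' (h / 2).
have h20 : 0 < h / 2 by rewrite divr_gt0.
have mB : measurable B by exact: measurable_box.
have mW : measurable W by exact: measurable_box.
have iB := continuous_integrable_box c (ltW h0) Cf.1.
have iW := continuous_integrable_box c' (ltW h20) Cf.1.
have hm : 0 < h ^+ m by rewrite exprn_gt0.
have mN D : measurable_fun D (fun x => `|f x|%:E) by exact: measurable_norm_rV Cf.1.
rewrite -(ler_pM2l hm) mulrDr mulrA -exprMn.
rewrite [X in _ <= _ + X]mulrA -exprSr -lee_fin EFinD.
apply: (@le_trans _ _ (\int[mu]_(x in W) ((L1norm B f)%:E + increment B f x))%E).
  rewrite EFinM -(L1normE mW iW) -ge0_integralZl_EFin//; last exact: ltW.
  apply: ge0_le_integral_sup => x Wx; first by rewrite -EFinM lee_fin mulr_ge0 ?(ltW hm).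
  rewrite -(L1normE mB iB) /increment -ge0_integralD//; last first.
    apply/measurable_EFinP; apply: measurableT_comp => //.
    by apply: measurable_funB => //; exact: continuous_measurable_rV Cf.1.
  rewrite muleC -(integral_cst_box c _ (ltW h0)); apply: ge0_le_integral_sup => y By //.
  by rewrite -EFinD lee_fin -{1}(subrK (f y) (f x)) addrC ler_normD.
rewrite ge0_integralD//; [|by move=> x _; rewrite lee_fin L1norm_ge0|exact: measurable_increment mB Cf.1].
apply: leeD.
  by rewrite integral_cst_box ?(ltW h20)// -EFinM lee_fin mulrC.
apply: le_trans _ (poincare_real c h0 Cf).
by apply: ge0_subset_integral => //; exact: measurable_increment mB Cf.1.
Qed.

(** [f x] times the volume of the box is the integral of [f] plus the integral over [y] of
    [f x - f y]; the latter is controlled by the Poincare inequality. *)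
Lemma L1norm_mean f c h : 0 < h -> C1 f ->
  L1norm (box c h) f <= `|\int[mu]_(x in box c h) f x| +
    h * \sum_(i < m) L1norm (box c h) (partial i f).
Proof.
move=> h0 Cf; set B := box c h.
have mB : measurable B by exact: measurable_box.
have iB := continuous_integrable_box c (ltW h0) Cf.1.
have hm : 0 < h ^+ m by rewrite exprn_gt0.
have mN D : measurable_fun D (fun x => `|f x|%:E) by exact: measurable_norm_rV Cf.1.
rewrite -(ler_pM2l hm) mulrDr [X in _ <= _ + X]mulrA -exprSr -lee_fin EFinD.
set K := `|_|.
apply: (@le_trans _ _ (\int[mu]_(x in B) (K%:E + increment B f x))%E).
  rewrite EFinM -(L1normE mB iB) -ge0_integralZl_EFin//; last exact: ltW.
  apply: ge0_le_integral_sup => x Bx; first by rewrite -EFinM lee_fin mulr_ge0 ?(ltW hm).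
  have cfx : continuous (fun y => f x - f y).
    by move=> y; apply: (@continuousB _ _ _ (fun=> f x) f); [exact: cst_continuous|exact: Cf.1].
  have ix := continuous_integrable_box c (ltW h0) cfx.
  have ic := continuous_integrable_box c (ltW h0) (@cst_continuous _ _ (f x)).
  rewrite /increment (L1normE mB ix) -EFinM -EFinD lee_fin.
  have E : f x * h ^+ m = \int[mu]_(y in B) f y + \int[mu]_(y in B) (f x - f y).
    rewrite RintegralB// addrC subrK /Rintegral.
    by rewrite (_ : (\int[_]_(_ in _) _)%E = (f x * h ^+ m)%:E)// integral_cst_box ?(ltW h0).
  rewrite mulrC -[h ^+ m]gtr0_norm// -normrM E.
  apply: le_trans (ler_normD _ _) _; rewrite lerD2l.
  exact: le_normr_Rintegral.
rewrite ge0_integralD//; [|by move=> x _; rewrite lee_fin normr_ge0|exact: measurable_increment mB Cf.1].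
apply: leeD.
  by rewrite integral_cst_box ?(ltW h0)// -EFinM lee_fin mulrC.
exact: poincare_real.
Qed.

End L1_boxes.

Section L1_sobolev.
Context {R : realType} {m l : nat}.
Implicit Types (u f : 'rV[R]_m -> R) (B W : set 'rV[R]_m) (c : 'I_m -> R) (h : R)
  (a : multi_index m l) (g : multi_index m l -> 'rV[R]_m -> R).
Local Notation mu := (lebesgue_rV R m).
Local Notation Q := (@unit_cube R m).
Local Notation L2 := (@square_integrable R m).

Lemma sobolev_approx1 u g e : sobolev_limit u g -> 0 < e ->
  exists2 phi, test_function phi & forall a, (mi_order a <= l)%N ->
    L1norm Q (fun x => mi_partial a phi x - g a x) <= e.
Proof.
move=> su e0; have e2 : 0 < e / 2 by rewrite divr_gt0.
have [phi tphi phiP] := sobolev_approx su (mulr_gt0 e2 e2).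
exists phi => // a al.
have Ld : L2 (fun x => mi_partial a phi x - g a x).
  by apply: L2_sub; [exact: test_L2|exact: sobolev_L2 su al].
apply: le_trans (L1_le_sqint e2 Ld) _.
rewrite [leRHS](splitr e) lerD2l ler_pdivrMl//.
exact: phiP.
Qed.

Lemma L1norm_near W f f' e : measurable W -> W `<=` Q -> L2 f -> L2 f' ->
  L1norm Q (fun x => f x - f' x) <= e ->
  [/\ L1norm W f <= L1norm W f' + e, L1norm W f' <= L1norm W f + e &
      `|\int[mu]_(x in W) f x| <= `|\int[mu]_(x in W) f' x| + e].
Proof.
move=> mW WQ Lf Lf' fe.
have i k : L2 k -> mu.-integrable W (EFin \o k).
  by move=> /L2_integrable; apply: integrableS => //; exact: measurable_cube.
have {fe} fe : L1norm W (fun x => f x - f' x) <= e.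
  apply: le_trans fe; apply: L1normS => //; first exact: measurable_cube.
  exact: L2_integrable (L2_sub Lf Lf').
have fe' : L1norm W (fun x => f' x - f x) <= e.
  by apply: le_trans fe; rewrite /L1norm; under eq_Rintegral do rewrite distrC.
have tri p q : L2 p -> L2 q -> L1norm W (fun x => p x - q x) <= e ->
    L1norm W p <= L1norm W q + e.
  move=> Lp Lq pq; apply: (@le_trans _ _ (L1norm W q + L1norm W (fun x => p x - q x))).
    have iq := integrable_norm (i _ Lq).
    have ipq := integrable_norm (i _ (L2_sub Lp Lq)).
    rewrite /L1norm -RintegralD//; apply: le_Rintegral => //.
    - exact: integrable_norm (i _ Lp).
    - exact: (integrableD mW iq ipq).
    - by move=> x _ /=; rewrite -{1}(subrK (q x) (p x)) addrC ler_normD.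
  by rewrite lerD2l.
split; [exact: tri|exact: tri|].
rewrite -(subrK (\int[mu]_(x in W) f' x) (\int[mu]_(x in W) f x)) addrC.
apply: le_trans (ler_normD _ _) _; rewrite lerD2l.
rewrite -RintegralB//; [|exact: i|exact: i].
by apply: le_trans fe; apply: le_normr_Rintegral => //; apply: i; exact: L2_sub.
Qed.

(** Both sides of [L1norm_subbox] are continuous for the L1 convergence of the derivatives. *)
Lemma sobolev_subbox u g a c c' h : sobolev_limit u g -> (mi_order a < l)%N ->
  0 < h -> box c h `<=` Q -> box c' (h / 2) `<=` box c h ->
  L1norm (box c' (h / 2)) (g a) <= 2^-1 ^+ m * L1norm (box c h) (g a) +
    h * \sum_(i < m) L1norm (box c h) (g (mi_incr a i)).
Proof.
move=> su al h0 BQ sub; apply/ler_addgt0Pr => e e0.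
pose K : R := 1 + 2^-1 ^+ m + h * m%:R.
have K0 : 0 < K.
  by rewrite /K -addrA ltr_pwDl// addr_ge0// ?exprn_ge0// mulr_ge0// ltW.
have [phi tphi phiP] := sobolev_approx1 su (divr_gt0 e0 K0).
have sphi : smooth phi by case: tphi.
have near b W : (mi_order b <= l)%N -> measurable W -> W `<=` Q ->
    L1norm W (mi_partial b phi) <= L1norm W (g b) + e / K /\
    L1norm W (g b) <= L1norm W (mi_partial b phi) + e / K.
  move=> bl mW WQ; have [] := @L1norm_near W (mi_partial b phi) (g b) (e / K) mW WQ
    (test_L2 b tphi) (sobolev_L2 su bl) (phiP b bl).
  by [].
have Cphi : C1 (mi_partial a phi) by rewrite mi_partialE; exact: smooth_C1.
have H := L1norm_subbox h0 Cphi sub.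
have mB := @measurable_box R m c h; have mB' := @measurable_box R m c' (h / 2).
apply: le_trans (near a _ (ltnW al) mB' (subset_trans sub BQ)).2 _.
apply: (@le_trans _ _ (2^-1 ^+ m * (L1norm (box c h) (g a) + e / K) +
    h * (\sum_(i < m) (L1norm (box c h) (g (mi_incr a i)) + e / K)) + e / K)).
  rewrite lerD2r; apply: le_trans H _; apply: lerD.
    by rewrite ler_wpM2l ?exprn_ge0//; exact: (near a _ (ltnW al) mB BQ).1.
  rewrite (ler_wpM2l (ltW h0))//; apply: ler_sum => i _.
  rewrite -mi_partial_incr//; apply: (near _ _ _ mB BQ).1.
  by rewrite mi_order_incr.
rewrite big_split/= sumr_const card_ord -[e / K *+ m]mulr_natr.
have : e / K * K = e by rewrite divfK// gt_eqF.
rewrite /K; move: (e / _) => t <-.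
move: (L1norm _ _) (\sum_(i < m) _) (2^-1 ^+ m) => p q r.
by rewrite le_eqVlt; apply/orP; left; apply/eqP; ring.
Qed.

Lemma sobolev_mean u g a c h : sobolev_limit u g -> (mi_order a < l)%N ->
  0 < h -> box c h `<=` Q ->
  L1norm (box c h) (g a) <= `|\int[mu]_(x in box c h) g a x| +
    h * \sum_(i < m) L1norm (box c h) (g (mi_incr a i)).
Proof.
move=> su al h0 BQ; apply/ler_addgt0Pr => e e0.
pose K : R := 2 + h * m%:R.
have K0 : 0 < K by rewrite /K ltr_pwDl// mulr_ge0// ltW.
have [phi tphi phiP] := sobolev_approx1 su (divr_gt0 e0 K0).
have sphi : smooth phi by case: tphi.
have mB := @measurable_box R m c h.
have near b : (mi_order b <= l)%N ->
  [/\ L1norm (box c h) (mi_partial b phi) <= L1norm (box c h) (g b) + e / K,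
      L1norm (box c h) (g b) <= L1norm (box c h) (mi_partial b phi) + e / K &
      `|\int[mu]_(x in box c h) mi_partial b phi x| <=
      `|\int[mu]_(x in box c h) g b x| + e / K].
  by move=> bl; exact: (@L1norm_near _ (mi_partial b phi) (g b) (e / K) mB BQ
    (test_L2 b tphi) (sobolev_L2 su bl) (phiP b bl)).
have Cphi : C1 (mi_partial a phi) by rewrite mi_partialE; exact: smooth_C1.
have [_ n2 n3] := near a (ltnW al).
apply: le_trans n2 _.
apply: (@le_trans _ _ ((`|\int[mu]_(x in box c h) g a x| + e / K) +
    h * (\sum_(i < m) (L1norm (box c h) (g (mi_incr a i)) + e / K)) + e / K)).
  rewrite lerD2r; apply: le_trans (L1norm_mean c h0 Cphi) _; apply: lerD => //.
  rewrite (ler_wpM2l (ltW h0))//; apply: ler_sum => i _.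
  rewrite -mi_partial_incr//.
  by have [] := near (mi_incr a i); rewrite ?mi_order_incr.
rewrite big_split/= sumr_const card_ord -[e / K *+ m]mulr_natr.
have : e / K * K = e by rewrite divfK// gt_eqF.
rewrite /K; move: (e / _) => t <-.
move: `|_| (\sum_(i < m) _) => p q.
by rewrite le_eqVlt; apply/orP; left; apply/eqP; ring.
Qed.

End L1_sobolev.

(** * The local Sobolev inequality *)

Section nested_boxes.
Context {R : realType} {m : nat}.
Implicit Types (f u : 'rV[R]_m -> R) (c : 'I_m -> R) (h : R) (x : 'rV[R]_m).
Local Notation mu := (lebesgue_rV R m).

Definition half_corner x c h : 'I_m -> R :=
  fun i => if x ord0 i <= c i + h / 2 then c i else c i + h / 2.

Lemma half_cornerP x c h : 0 < h -> box c h x ->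
  box (half_corner x c h) (h / 2) x /\ box (half_corner x c h) (h / 2) `<=` box c h.
Proof.
move=> h0 bx; split => [i|y yb i].
  have /andP[b1 b2] := bx i; rewrite /half_corner; case: ifPn => [H|].
    by rewrite b1 H.
  by rewrite -ltNge => ->/=; rewrite -addrA -splitr.
have := yb i; rewrite /half_corner; case: ifPn => _ /andP[y1 y2]; apply/andP; split.
- exact: y1.
- by apply: le_trans y2 _; rewrite lerD2l ler_pdivrMr// ler_pMr// ler1n.
- by apply: le_lt_trans y1; rewrite lerDl divr_ge0// ltW.
- by apply: le_trans y2 _; rewrite -addrA -splitr.
Qed.

Fixpoint nested_corner x c h k : 'I_m -> R :=
  if k is j.+1 then half_corner x (nested_corner x c h j) (h / 2 ^+ j) else c.

Definition nested_box x c h k := box (nested_corner x c h k) (h / 2 ^+ k).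

Lemma nested_boxS x c h k : nested_box x c h k.+1 =
  box (nested_corner x c h k.+1) (h / 2 ^+ k / 2).
Proof. by rewrite /nested_box exprSr invfM mulrA. Qed.

Lemma nested_boxP x c h k : 0 < h -> box c h x ->
  [/\ nested_box x c h k x, nested_box x c h k `<=` box c h &
      nested_box x c h k.+1 `<=` nested_box x c h k].
Proof.
move=> h0 bx.
have hk j : 0 < h / 2 ^+ j by rewrite divr_gt0// exprn_gt0.
have S j : nested_box x c h j x -> nested_box x c h j.+1 x /\
    nested_box x c h j.+1 `<=` nested_box x c h j.
  by move=> bj; rewrite nested_boxS; exact: half_cornerP.
elim: k => [|k [IH1 IH2 IH3]].
  have b0 : nested_box x c h 0 = box c h by rewrite /nested_box expr0 divr1.
  have bx0 : nested_box x c h 0 x by rewrite b0.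
  by have [_ s0] := S 0%N bx0; split; rewrite ?b0// -[X in _ `<=` X]b0.
have [b1 _] := S k IH1; have [_ b2] := S k.+1 b1.
by split => //; exact: subset_trans IH3 IH2.
Qed.

(** Continuity: [|u x|] is the limit of the averages over the nested boxes. *)
Lemma le_nested_averages u x c h D : continuous u -> 0 < h -> box c h x ->
  (forall k, L1norm (nested_box x c h k) u <= D * (h / 2 ^+ k) ^+ m) -> `|u x| <= D.
Proof.
move=> cu h0 bx H; apply/ler_addgt0Pr => e e0.
have /nbhs_ballP[d /= d0 Hd] : \forall y \near x, `|u x - u y| < e.
  by have /cvgrPdist_lt := cu x; apply.
have [k hk] : exists k, h / 2 ^+ k < d.
  exists (Num.truncn (h / d)); rewrite ltr_pdivrMr ?exprn_gt0//.
  rewrite -ltr_pdivrMl// mulrC; apply: lt_le_trans (truncnS_gt _) _.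
  by rewrite -natrX ler_nat ltn_expl.
have hk0 : 0 < h / 2 ^+ k by rewrite divr_gt0// exprn_gt0.
have [bk _ _] := nested_boxP k h0 bx.
have := H k; have hm0 : 0 < (h / 2 ^+ k) ^+ m by rewrite exprn_gt0.
have iu := continuous_integrable_box (nested_corner x c h k) (ltW hk0) cu.
have mB := @measurable_box R m (nested_corner x c h k) (h / 2 ^+ k).
have L : (`|u x| - e) * (h / 2 ^+ k) ^+ m <= L1norm (nested_box x c h k) u.
  have -> : (`|u x| - e) * (h / 2 ^+ k) ^+ m =
      \int[mu]_(y in nested_box x c h k) (`|u x| - e).
    by rewrite /Rintegral (_ : (\int[_]_(_ in _) _)%E =
      ((`|u x| - e) * (h / 2 ^+ k) ^+ m)%:E)// integral_cst_box ?(ltW hk0).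
  apply: le_Rintegral => //.
  - exact: (continuous_integrable_box _ (ltW hk0) (@cst_continuous _ _ (`|u x| - e))).
  - exact: integrable_norm.
  - move=> y By /=; have /Hd : ball x d y.
      split => // j i; rewrite /ball/= (ord1 j) ltr_norml.
      have /andP[x1 x2] := bk i; have /andP[y1 y2] := By i.
      by move: hk x1 x2 y1 y2; clear; lra.
    rewrite lerBlDr => /ltW xy; rewrite -lerBlDl; apply: le_trans xy.
    exact: lerB_dist.
move=> /(le_trans L); rewrite ler_pM2r// lerBlDr//.
Qed.

End nested_boxes.

Section growth.
Context {R : realType}.
Local Notation rho := (Num.sqrt (2 : R)).

Lemma sqrt2_ge : 4 / 3 <= rho.
Proof.
rewrite -(@ler_pXn2r _ 2) ?nnegrE ?sqrtr_ge0 ?sqr_sqrtr//; lra.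
Qed.

(** The value 4/3 is a lower bound for the square root of 2, and 3 is large enough for
    [3 + 1 <= 3 r]. *)
Lemma growth_up (a : nat -> R) (D r : R) : 4 / 3 <= r -> 0 <= D ->
  a 0%N <= D -> (forall k, a k.+1 <= a k + D * r ^+ k) ->
  forall k, a k <= 3 * D * r ^+ k.
Proof.
move=> r1 D0 a0 aS; elim => [|k IH]; first by rewrite expr0; lra.
apply: le_trans (aS k) _.
have : 0 <= D * r ^+ k by rewrite mulr_ge0// exprn_ge0//; lra.
have -> : 3 * D * r ^+ k.+1 = 3 * r * (D * r ^+ k) by rewrite exprS; ring.
move: IH; rewrite -!mulrA; move: (D * r ^+ k) (a k) => y p IH y0; nra.
Qed.

(** The increments form a convergent geometric series, of sum at most [4 D]. *)
Lemma growth_down (a : nat -> R) (D : R) : 0 <= D ->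
  a 0%N <= D -> (forall k, a k.+1 <= a k + D * rho^-1 ^+ k) ->
  forall k, a k <= 8 * D.
Proof.
move=> D0 a0 aS; have r1 := sqrt2_ge.
have ri : 0 < rho^-1 by rewrite invr_gt0; lra.
have ri34 : rho^-1 <= 3 / 4 by rewrite -[leRHS]invf_div lef_pV2 ?posrE//; lra.
suff H k : a k <= 4 * D * (2 - rho^-1 ^+ k).
  move=> k; apply: le_trans (H k) _.
  by have := exprn_ge0 k (ltW ri); move: (_ ^+ k) => y y0; nra.
elim: k => [|k IH]; first by rewrite expr0; lra.
apply: le_trans (aS k) _; apply: le_trans (lerD IH (lexx _)) _; rewrite exprS.
have := exprn_ge0 k (ltW ri); move: (rho^-1) ri34 => s s34.
move: (s ^+ k) => y y0.
have : 0 <= D * y by rewrite mulr_ge0.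
move=> Dy0.
have : D * y * s <= D * y * (3 / 4) by rewrite ler_wpM2l.
by lra.
Qed.

End growth.

Section local_sobolev.
Context {R : realType} {m l : nat}.
Implicit Types (u f : 'rV[R]_m -> R) (c : 'I_m -> R) (h : R)
  (a : multi_index m l) (g : multi_index m l -> 'rV[R]_m -> R).
Local Notation mu := (lebesgue_rV R m).
Local Notation Q := (@unit_cube R m).
Local Notation L2 := (@square_integrable R m).
Local Notation rho := (Num.sqrt (2 : R)).

Definition sobolev_const_step (j : nat) : R := 2 * (3 * (2 ^+ m * m%:R)) ^+ j.
Definition sobolev_const : R := 8 * (2 ^+ m * m%:R) * sobolev_const_step l.-1.

(** Let [w a k] be the average of [|g a|] over the [k]-th nested box, scaled by a power of the
    side of the initial box.  A bound [c r ^ k] for the order [j + 1] becomes a bound [c' (r / 2) ^ k] for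
    the order [j] as long as [r / 2 > 1], and a constant bound if [r / 2 < 1]; at [r = 2] the
    averages might be unbounded.  The Cauchy-Schwarz inequality gives
    [r = 2 ^ (m / 2)] at the order [l].  This is relaxed to [r = 2 ^ (l - 1 / 2)], which is
    possible because [m <= 2 l - 1]: the bases at the lower orders are then half-integral
    powers of 2, never 1, and the order zero is the only one with [r / 2 < 1]. *)
Lemma local_sobolev u g c h S x : (m < 2 * l)%N -> sobolev_limit u g ->
  0 < h -> box c h `<=` Q -> box c h x ->
  (forall a, (mi_order a < l)%N -> \int[mu]_(y in box c h) g a y = 0) ->
  0 < S ->
  (forall a, mi_order a = l ->
    h ^+ (2 * l) * \int[mu]_(y in box c h) (g a y ^+ 2) <= h ^+ m * S ^+ 2) ->
  `|u x| <= sobolev_const * S.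
Proof.
move=> ml su h0 BQ bx mean0 S0 top.
have l0 : (0 < l)%N by move: ml; case: (l); rewrite ?muln0.
have m2l : (m <= 2 * l - 1)%N by move: ml; clear; lia.
have r1 := @sqrt2_ge R.
have rr : rho ^+ 2 = 2 by rewrite sqr_sqrtr.
have rho0 : 0 < rho by lra.
pose hk k := h / 2 ^+ k; pose Bk k := nested_box x c h k.
have hk0 k : 0 < hk k by rewrite divr_gt0// exprn_gt0.
have BkP k := nested_boxP k h0 bx.
pose w a k := h ^+ mi_order a * (L1norm (Bk k) (g a) / hk k ^+ m).
have wS a k : (mi_order a < l)%N ->
    w a k.+1 <= w a k + 2 ^+ m * (\sum_(i < m) w (mi_incr a i) k) * 2^-1 ^+ k.
  move=> al; have [_ sub subS] := BkP k.
  rewrite nested_boxS in subS.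
  have := sobolev_subbox su al (hk0 k) (subset_trans sub BQ) subS.
  rewrite -/(Bk k) -nested_boxS -/(Bk k.+1) => H.
  have hk1 : hk k.+1 = hk k / 2 by rewrite /hk exprSr invfM mulrA.
  have q0 : 0 < hk k ^+ m by rewrite exprn_gt0.
  have q10 : 0 < hk k.+1 ^+ m by rewrite exprn_gt0.
  have p0 : 0 <= h ^+ mi_order a by rewrite exprn_ge0// ltW.
  have -> : \sum_(i < m) w (mi_incr a i) k =
      h ^+ mi_order a * h * ((\sum_(i < m) L1norm (Bk k) (g (mi_incr a i))) / hk k ^+ m).
    rewrite mulr_suml mulr_sumr; apply: eq_bigr => i _.
    by rewrite /w mi_order_incr// exprSr.
  rewrite /w.
  have -> : L1norm (Bk k.+1) (g a) / hk k.+1 ^+ m =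
      2 ^+ m * L1norm (Bk k.+1) (g a) / hk k ^+ m.
    by rewrite hk1 exprMn exprVn invfM invrK mulrA mulrAC (mulrC _ (2 ^+ m)).
  have := ler_wpM2l (exprn_ge0 m (ler0n R 2)) H.
  have E2 : (2 : R) ^+ m * 2^-1 ^+ m = 1 by rewrite -exprMn divff// expr1n.
  have qV : 0 <= (hk k ^+ m)^-1 by rewrite invr_ge0 ltW.
  rewrite mulrDr [2 ^+ m * (2^-1 ^+ m * _)]mulrA E2 mul1r => /(ler_wpM2r qV).
  move=> /(ler_wpM2l p0) /le_trans; apply.
  rewrite mulrDl mulrDr lerD2l /hk exprVn.
  move: (\sum_(i < m) _) ((h / 2 ^+ k) ^+ m)^-1 (h ^+ mi_order a) (2 ^+ m) => s q p n.
  move: ((2 ^+ k)^-1) => z; rewrite le_eqVlt; apply/orP; left; apply/eqP; ring.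
have w0 a : (mi_order a < l)%N -> w a 0%N <= \sum_(i < m) w (mi_incr a i) 0%N.
  move=> al; rewrite /w /hk expr0 divr1 /Bk /nested_box /= expr0 divr1.
  have := sobolev_mean su al h0 BQ; rewrite mean0// normr0 add0r.
  have q0 : 0 <= (h ^+ m)^-1 by rewrite invr_ge0 exprn_ge0// ltW.
  have p0 : 0 <= h ^+ mi_order a by rewrite exprn_ge0// ltW.
  move=> /(ler_wpM2r q0)/(ler_wpM2l p0)/le_trans; apply.
  rewrite !mulr_sumr mulr_suml mulr_sumr; apply: ler_sum => i _.
  by rewrite mi_order_incr// exprSr !mulrA.
have wtop a k : mi_order a = l -> w a k <= 2 * S * (rho ^+ (2 * l - 1)) ^+ k.
  move=> al; have [_ sub _] := BkP k.
  have mB := @measurable_box R m c h.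
  have mBk : measurable (Bk k) by exact: measurable_box.
  have La : L2 (g a) by apply: sobolev_L2 su _; rewrite al.
  have i2 := integrableS measurable_cube mB BQ (L2_sq La).
  have i2k := integrableS mB mBk sub i2.
  have i1k := integrableS measurable_cube mBk (subset_trans sub BQ) (L2_integrable La).
  have N2 : \int[mu]_(y in Bk k) (g a y ^+ 2) <= \int[mu]_(y in box c h) (g a y ^+ 2).
    have := L1normS mBk mB sub i2; rewrite /L1norm.
    by under eq_Rintegral do rewrite ger0_norm ?sqr_ge0//;
      under [X in _ <= X -> _]eq_Rintegral do rewrite ger0_norm ?sqr_ge0//.
  (* Up to the factor 2 this is the bound to be proved for the average over the box. *)
  pose e := rho ^+ (m * k) * S / h ^+ l.
  have hl : 0 < h ^+ l by rewrite exprn_gt0.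
  have e0 : 0 < e by rewrite divr_gt0// mulr_gt0// exprn_gt0.
  have hkm : 0 < hk k ^+ m by rewrite exprn_gt0.
  have N1 : L1norm (Bk k) (g a) <=
      e * hk k ^+ m + e^-1 * \int[mu]_(y in box c h) (g a y ^+ 2).
    apply: le_trans (_ : _ <= e * hk k ^+ m + e^-1 * \int[mu]_(y in Bk k) (g a y ^+ 2)) _;
      last by rewrite lerD2l ler_wpM2l// invr_ge0 ltW.
    have ic := continuous_integrable_box (nested_corner x c h k) (ltW (hk0 k))
      (@cst_continuous _ _ e).
    have iz := integrableZl mBk e^-1 i2k.
    have -> : e * hk k ^+ m = \int[mu]_(y in Bk k) e.
      by rewrite /Rintegral (_ : (\int[_]_(_ in _) _)%E = (e * hk k ^+ m)%:E)//
        integral_cst_box ?(ltW (hk0 k)).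
    rewrite -RintegralZl// -RintegralD//; apply: le_Rintegral => //.
    - exact: integrable_norm.
    - exact: (integrableD mBk ic iz).
    - move=> y _ /=; rewrite -[g a y ^+ 2]real_normK ?num_real//.
      rewrite -(ler_pM2l e0) mulrDr mulVKf ?gt_eqF//.
      move: (e) (`|g a y|) (ltW e0) (normr_ge0 (g a y)) => t p; clear => t0 p0.
      by have := sqr_ge0 (t - p); rewrite sqrrB; nra.
  rewrite /w al.
  apply: (@le_trans _ _ (h ^+ l * e + h ^+ l * e)).
    rewrite -mulrDr ler_wpM2l ?(ltW hl)// ler_pdivrMr// mulrDl.
    apply: le_trans N1 _; rewrite lerD2l ler_pdivrMl// mulrA.
    have := top a al; rewrite mulrC -ler_pdivlMr ?exprn_gt0// => /le_trans; apply.
    rewrite ler_pdivrMr ?exprn_gt0// /e /hk mul2n -addnn exprD.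
    have -> : rho ^+ (m * k) * S / h ^+ l * (rho ^+ (m * k) * S / h ^+ l) *
       (h / 2 ^+ k) ^+ m * (h ^+ l * h ^+ l) =
       (rho ^+ (m * k) * rho ^+ (m * k) * (2 ^+ k)^-1 ^+ m) * (h ^+ m * S ^+ 2) *
       ((h ^+ l / h ^+ l) * (h ^+ l / h ^+ l)).
      by rewrite (exprMn _ h) expr2; move: (h ^+ l) => y; ring.
    rewrite divff ?gt_eqF// !mulr1 -exprD addnn -mul2n exprM rr mulnC exprM exprVn.
    by rewrite divff ?mul1r// gt_eqF// exprn_gt0// exprn_gt0.
  have -> : h ^+ l * e = S * rho ^+ (m * k).
    by rewrite /e mulrC divfK ?gt_eqF// mulrC.
  rewrite -exprM -[leLHS]mulr2n -[leLHS]mulr_natl -[leRHS]mulrA.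
  rewrite ler_pM2l// ler_pM2l// ler_eXn2l; last by lra.
  by rewrite leq_mul2r m2l orbT.
pose K : R := 2 ^+ m * m%:R.
have K0 : 0 <= K by rewrite mulr_ge0// exprn_ge0.
have C0 j : 0 <= sobolev_const_step j.
  by rewrite /sobolev_const_step mulr_ge0// exprn_ge0// mulr_ge0.
have K1 : m%:R <= K by rewrite ler_peMl// exprn_ege1// ler1n.
have chain j : (j < l)%N -> forall a k, mi_order a = (l - j)%N ->
    w a k <= sobolev_const_step j * S * (rho ^+ (2 * (l - j) - 1)) ^+ k.
  elim: j => [|j IH] jl a k al.
    by rewrite /sobolev_const_step expr0 mulr1 subn0 wtop// al subn0.
  have {}IH := IH (ltnW jl).
  have aL : (mi_order a < l)%N by rewrite al; lia.
  have ai i : mi_order (mi_incr a i) = (l - j)%N by rewrite mi_order_incr// al; lia.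
  have -> : sobolev_const_step j.+1 * S = 3 * (K * (sobolev_const_step j * S)).
    by rewrite /sobolev_const_step exprS -/K; ring.
  set E := sobolev_const_step j * S.
  have E0 : 0 <= E by rewrite mulr_ge0// ltW.
  have sumw k' : \sum_(i < m) w (mi_incr a i) k' <=
      m%:R * (E * (rho ^+ (2 * (l - j) - 1)) ^+ k').
    apply: (@le_trans _ _ (\sum_(i < m) (E * (rho ^+ (2 * (l - j) - 1)) ^+ k'))).
      by apply: ler_sum => i _; exact: IH.
    by rewrite sumr_const card_ord mulr_natl.
  apply: (@growth_up _ (w a) (K * E)).
  - apply: (le_trans r1); rewrite -[leLHS]expr1 ler_eXn2l; last by lra.
    by lia.
  - by rewrite mulr_ge0.
  - apply: le_trans (w0 _ aL) _; apply: le_trans (sumw 0%N) _.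
    by rewrite expr0 mulr1 ler_wpM2r.
  - move=> k'; apply: le_trans (wS _ _ aL) _; rewrite lerD2l.
    have -> : K * E * (rho ^+ (2 * (l - j.+1) - 1)) ^+ k' =
        2 ^+ m * (m%:R * (E * (rho ^+ (2 * (l - j) - 1)) ^+ k')) * 2^-1 ^+ k'.
      have -> : (2 * (l - j) - 1 = 2 * (l - j.+1) - 1 + 2)%N by lia.
      rewrite exprD rr !exprMn exprVn /K.
      move: ((rho ^+ _) ^+ k') => y.
      have z0 : (2 ^+ k' : R) != 0 by rewrite gt_eqF// exprn_gt0.
      by rewrite -!mulrA (mulfV z0) mulr1.
    by rewrite ler_wpM2r ?exprn_ge0// ler_wpM2l ?exprn_ge0.
pose a0 : multi_index m l := [ffun=> ord0].
have oa0 : mi_order a0 = 0%N.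
  by rewrite /mi_order; under eq_bigr do rewrite ffunE; rewrite sum_nat_const muln0.
have al0 : (mi_order a0 < l)%N by rewrite oa0.
have [cu _] : continuous u /\ (forall x, ~ @open_unit_cube R m x -> u x = 0) by case: su.
have gu : g a0 = u by case: su.
apply: (le_nested_averages cu h0 bx) => k.
rewrite -ler_pdivrMr; last by rewrite exprn_gt0//; exact: hk0.
have -> : L1norm (nested_box x c h k) u / (h / 2 ^+ k) ^+ m = w a0 k.
  by rewrite /w oa0 expr0 mul1r gu.
rewrite /sobolev_const -/K -mulrA -mulrA mulrA.
set E := sobolev_const_step l.-1 * S.
have E0 : 0 <= E by rewrite mulr_ge0// ltW.
have sumw k' : \sum_(i < m) w (mi_incr a0 i) k' <= m%:R * (E * rho ^+ k').
  apply: (@le_trans _ _ (\sum_(i < m) (E * rho ^+ k'))).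
    apply: ler_sum => i _; have := chain l.-1 _ (mi_incr a0 i) k'.
    have -> : (l - l.-1 = 1)%N by lia.
    by rewrite expr1; apply; [lia|rewrite mi_order_incr// oa0].
  by rewrite sumr_const card_ord mulr_natl.
rewrite -mulrA; apply: growth_down.
- by rewrite mulr_ge0.
- apply: le_trans (w0 _ al0) _; apply: le_trans (sumw 0%N) _.
  by rewrite expr0 mulr1 ler_wpM2r.
- move=> k'; apply: le_trans (wS _ _ al0) _; rewrite lerD2l.
  have -> : K * E * rho^-1 ^+ k' = 2 ^+ m * (m%:R * (E * rho ^+ k')) * 2^-1 ^+ k'.
    have -> : rho^-1 = rho * 2^-1.
      by rewrite -[X in _ * X^-1]rr expr2 invfM mulVKf// gt_eqF.
    by rewrite exprMn /K !mulrA.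
  by rewrite ler_wpM2r ?exprn_ge0// ler_wpM2l ?exprn_ge0.
Qed.

End local_sobolev.

(** * The two quadratic forms *)

Section definiteness.
Context {R : realType}.
Local Notation mu m := (lebesgue_rV R m).

Definition mi_first (m l : nat) : multi_index m.+1 l :=
  [ffun j => if j == ord0 then ord_max else ord0].

Lemma mi_order_first m l : mi_order (mi_first m l) = l.
Proof.
rewrite /mi_order big_ord_recl big1 => [|i _]; first by rewrite ffunE eqxx addn0.
by rewrite ffunE eq_sym (negbTE (neq_lift _ _)).
Qed.

Lemma friedrichs_limit m l u (g : multi_index m.+1 l -> 'rV[R]_m.+1 -> R) :
  sobolev_limit u g ->
  L1norm (@unit_cube R _) u <= L1norm (@unit_cube R _) (g (mi_first m l)).
Proof.
move=> su; have fl : (mi_order (mi_first m l) <= l)%N by rewrite mi_order_first.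
pose a0 : multi_index m.+1 l := [ffun=> ord0].
have oa0 : mi_order a0 = 0%N.
  by rewrite /mi_order; under eq_bigr do rewrite ffunE; rewrite sum_nat_const muln0.
have gu : g a0 = u by case: su.
apply/ler_addgt0Pr => e e0; have e2 : 0 < e / 2 by rewrite divr_gt0.
have [phi tphi phiP] := sobolev_approx1 su e2.
have vphi := test_vanishing tphi.
have sub W : W `<=` W by [].
have near b : (mi_order b <= l)%N ->
  [/\ L1norm (@unit_cube R _) (mi_partial b phi) <= L1norm (@unit_cube R _) (g b) + e / 2,
      L1norm (@unit_cube R _) (g b) <= L1norm (@unit_cube R _) (mi_partial b phi) + e / 2 &
      `|\int[mu m.+1]_(x in @unit_cube R _) mi_partial b phi x| <=
      `|\int[mu m.+1]_(x in @unit_cube R _) g b x| + e / 2].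
  move=> bl.
  by have := L1norm_near (@measurable_cube R m.+1) (sub _ _) (test_L2 b tphi)
    (sobolev_L2 su bl) (phiP b bl).
have [_ n1 _] := near a0 (ltac:(by rewrite oa0)).
have [n2 _ _] := near _ fl.
rewrite -gu; apply: (le_trans n1).
rewrite [X in _ <= _ + X](splitr e) addrA lerD2r; apply: le_trans n2.
have -> : mi_partial a0 phi = phi.
  rewrite mi_partialE (_ : mi_seq a0 = [::])//; apply/size0nil.
  by rewrite size_mi_seq.
rewrite mi_partialE (@partials_perm _ _ _ _ (nseq l ord0)); last 2 first.
- exact: vphi.1.
- apply/allP => j _ /=; rewrite count_mi_seq count_nseq ffunE /=.
  by case: (eqVneq j ord0) => _; rewrite /= ?mul1n ?mul0n.
elim: (l) => [|k IH] //=; apply: le_trans IH _.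
have vk := vanishing_partials (nseq k ord0) vphi.
have ik s : (mu m.+1).-integrable (@unit_cube R m.+1)
    (EFin \o foldr (@partial R m.+1) phi s).
  by apply: continuous_integrable_cube; exact: (vphi.1 s).1.
have mC := @measurable_cube R m.+1.
rewrite -lee_fin -(L1normE mC (ik (nseq k ord0))).
by rewrite -(L1normE mC (ik (ord0 :: nseq k ord0))); exact: friedrichs.
Qed.

(** If the top order derivatives vanish then so does [u] in L1, by the inequality of Friedrichs
    in the first coordinate, and [u] is continuous. *)
Lemma sobolev_definite m l u (g : multi_index m l -> 'rV[R]_m -> R) : (0 < m)%N ->
  sobolev_limit u g -> (forall a, mi_order a = l -> sqint (g a) = 0) -> u = fun=> 0.
Proof.
case: m u g => // m u g _ su g0.
have [cu u0] : continuous u /\ (forall x, ~ @open_unit_cube R m.+1 x -> u x = 0).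
  by case: su.
have L0 : L1norm (@unit_cube R _) u <= 0.
  apply: le_trans (friedrichs_limit su) _; apply/ler_addgt0Pl => e e0; rewrite addr0.
  have Lf : square_integrable (g (mi_first m l)).
    by apply: sobolev_L2 su _; rewrite mi_order_first.
  by apply: le_trans (L1_le_sqint e0 Lf) _; rewrite g0 ?mi_order_first// mulr0 addr0.
apply/funext => x; have [xC|/u0//] := pselect (@open_unit_cube R m.+1 x).
have bx : box (fun=> 0) 1 x.
  by move=> i; have /andP[-> /ltW] := xC i; rewrite add0r.
apply/eqP; rewrite -normr_le0.
apply: (le_nested_averages cu ltr01 bx) => k; rewrite mul0r.
apply: le_trans L0; have [_ sub _] := nested_boxP k ltr01 bx.
rewrite -unit_cube_box in sub.
apply: L1normS => //; [exact: measurable_box|exact: measurable_cube|].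
exact: continuous_integrable_cube.
Qed.

End definiteness.

Section forms.
Context {R : realType} {m l : nat}.
Implicit Types (u v : 'rV[R]_m -> R) (a : multi_index m l)
  (g : multi_index m l -> 'rV[R]_m -> R).
Local Notation mu := (lebesgue_rV R m).
Local Notation Q := (@unit_cube R m).
Local Notation L2 := (@square_integrable R m).

Lemma Rintegral_sum d (T : measurableType d) (nu : {measure set T -> \bar R})
    (D : set T) (I : Type) (s : seq I) (P : pred I) (f : I -> T -> R) : measurable D ->
  (forall i, P i -> nu.-integrable D (EFin \o f i)) ->
  nu.-integrable D (EFin \o (fun x => \sum_(i <- s | P i) f i x)) /\
  \int[nu]_(x in D) (\sum_(i <- s | P i) f i x) =
  \sum_(i <- s | P i) \int[nu]_(x in D) f i x.
Proof.
move=> mD fi; elim: s => [|i s [IH1 IH2]].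
  split; first by have := integrable0 nu D; apply: eq_integrable => // x _ /=; rewrite big_nil.
  by under eq_Rintegral do rewrite big_nil; rewrite Rintegral_cst// ?mul0r big_nil.
rewrite big_cons; case: ifPn => Pi; last first.
  by split; [move: IH1; apply: eq_integrable => // x _ /=; rewrite big_cons (negbTE Pi)|
    rewrite -IH2; apply: eq_Rintegral => x _; rewrite big_cons (negbTE Pi)].
have i2 := fi i Pi; split.
  by have := integrableD mD i2 IH1; apply: eq_integrable => // x _ /=; rewrite big_cons Pi.
by rewrite -IH2 -RintegralD//; apply: eq_Rintegral => x _; rewrite big_cons Pi.
Qed.

(** The form [I], as a function of families of derivatives instead of points of the
    completion: in this form it is visibly bilinear. *)
Definition top_form g g' : R :=
  \sum_(a : multi_index m l | mi_order a == l) \int[mu]_(x in Q) (g a x * g' a x).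

Lemma top_formC g g' : top_form g g' = top_form g' g.
Proof. by apply: eq_bigr => a _; apply: eq_Rintegral => x _; exact: mulrC. Qed.

Lemma top_form_ge0 g : 0 <= top_form g g.
Proof. by apply: sumr_ge0 => a _; apply: Rintegral_ge0 => x _; rewrite -expr2 sqr_ge0. Qed.

Lemma top_form_eq0 u g : (0 < m)%N -> sobolev_limit u g -> top_form g g = 0 ->
  u = fun=> 0.
Proof.
move=> m0 su /eqP; rewrite psumr_eq0 => [/allP H|a _]; last first.
  by apply: Rintegral_ge0 => x _; rewrite -expr2 sqr_ge0.
apply: (sobolev_definite m0 su) => a /eqP al.
have := H a (mem_index_enum a); rewrite al/= => /eqP <-.
by apply: eq_Rintegral => x _; rewrite expr2.
Qed.

Lemma sobolev_derivP u : H0 l u -> sobolev_limit u (fun a => sobolev_deriv a u).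
Proof. by move=> [g ug]; exact: (xgetI _ ug). Qed.

(** The derivatives selected by [sobolev_deriv] agree almost everywhere with any others. *)
Lemma I_formE u v g g' : sobolev_limit u g -> sobolev_limit v g' ->
  I_form l u v = top_form g g'.
Proof.
move=> su sv.
have du : sobolev_limit u (fun a => sobolev_deriv a u).
  by apply: sobolev_derivP; exists g.
have dv : sobolev_limit v (fun a => sobolev_deriv a v).
  by apply: sobolev_derivP; exists g'.
have L w k a : sobolev_limit w k -> mi_order a == l -> L2 (k a).
  by move=> sw /eqP al; apply: sobolev_L2 sw _; rewrite al.
rewrite /I_form /top_form (Rintegral_sum _ measurable_cube _).2; last first.
  by move=> a al; apply: L2_mul; [exact: L du al|exact: L dv al].
apply: eq_bigr => a al; rewrite /Rintegral; congr fine.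
apply: ae_eq_integral => //.
- exact: measurable_cube.
- exact: measurable_int (L2_mul (L _ _ _ du al) (L _ _ _ dv al)).
- exact: measurable_int (L2_mul (L _ _ _ su al) (L _ _ _ sv al)).
have al' : (mi_order a <= l)%N by rewrite (eqP al).
apply: filterS2 (sobolev_unique du su al') (sobolev_unique dv sv al').
by move=> x ux vx Qx /=; rewrite ux// vx.
Qed.

Lemma top_form_sum n (c d : 'I_n -> R) (G G' : 'I_n -> multi_index m l -> 'rV[R]_m -> R)
    (U U' : 'I_n -> 'rV[R]_m -> R) :
  (forall i, sobolev_limit (U i) (G i)) -> (forall i, sobolev_limit (U' i) (G' i)) ->
  top_form (fun a x => \sum_(i < n) c i * G i a x) (fun a x => \sum_(i < n) d i * G' i a x)
  = \sum_(i < n) \sum_(j < n) c i * d j * top_form (G i) (G' j).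
Proof.
move=> sU sU'.
have L w k a : sobolev_limit w k -> mi_order a == l -> L2 (k a).
  by move=> sw /eqP al; apply: sobolev_L2 sw _; rewrite al.
under [RHS]eq_bigr do under eq_bigr do rewrite mulr_sumr.
under [RHS]eq_bigr do rewrite exchange_big/=.
rewrite exchange_big/=; apply: eq_bigr => a al.
transitivity (\int[mu]_(x in Q) \sum_(i < n) \sum_(j < n)
    (c i * d j) * (G i a x * G' j a x)).
  apply: eq_Rintegral => x _; rewrite mulr_suml; apply: eq_bigr => i _.
  by rewrite mulr_sumr; apply: eq_bigr => j _; ring.
have ij i j : mu.-integrable Q (EFin \o (fun x => (c i * d j) * (G i a x * G' j a x))).
  have := integrableZl measurable_cube (c i * d j) (L2_mul (L _ _ _ (sU i) al) (L _ _ _ (sU' j) al)).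
  by apply: eq_integrable => //; exact: measurable_cube.
rewrite (Rintegral_sum _ measurable_cube _).2; last first.
  by move=> i _; exact: (Rintegral_sum _ measurable_cube (fun j _ => ij i j)).1.
apply: eq_bigr => i _; rewrite (Rintegral_sum _ measurable_cube _).2 //.
apply: eq_bigr => j _; rewrite RintegralZl//; first exact: measurable_cube.
exact: (L2_mul (L _ _ _ (sU i) al) (L _ _ _ (sU' j) al)).
Qed.

End forms.

(** * Eigenvalues and codimension *)

Section eigenvalues.
Context {R : realType} {m l : nat} (nu : {finite_measure set 'rV[R]_m -> \bar R}).
Hypothesis m_gt0 : (0 < m)%N.
Implicit Types (u v w f : 'rV[R]_m -> R) (a : multi_index m l)
  (g : multi_index m l -> 'rV[R]_m -> R).
Local Notation mu := (lebesgue_rV R m).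
Local Notation Q := (@unit_cube R m).
Local Notation G u := (fun a : multi_index m l => sobolev_deriv a u).

Lemma H0_integrable u v : H0 l u -> H0 l v ->
  nu.-integrable setT (EFin \o (fun x => u x * v x)).
Proof.
move=> [g su] [g' sv].
have [[cu u0] _ _ _] := su; have [[cv v0] _ _ _] := sv.
have cuv : continuous (fun x => u x * v x).
  by move=> x; apply: (@continuousM _ _ u v); [exact: cu|exact: cv].
have [M M0 HM] := continuous_bounded_box (fun=> 0) 1 cuv.
apply: measurable_bounded_integrable => //.
- by apply: fin_num_fun_lty; exact: fin_num_measure.
- exact: continuous_measurable_rV.
- exists M; split; first exact: num_real.
  move=> M' MM' x /= _; apply: le_trans (ltW MM').
  have [/HM//|xC] := pselect (forall i, 0 <= x ord0 i <= 0 + 1).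
  rewrite u0 ?mul0r ?normr0 ?(ltW M0)// => xo; apply: xC => j; rewrite add0r.
  by have /andP[/ltW -> /ltW ->] := xo j.
Qed.

Lemma J_formC u v : J_form nu u v = J_form nu v u.
Proof. by apply: eq_Rintegral => x _; exact: mulrC. Qed.

Lemma J_form_sum n (c d : 'I_n -> R) (U V : 'I_n -> 'rV[R]_m -> R) :
  (forall i, H0 l (U i)) -> (forall i, H0 l (V i)) ->
  J_form nu (fun x => \sum_(i < n) c i * U i x) (fun x => \sum_(i < n) d i * V i x) =
  \sum_(i < n) \sum_(j < n) c i * d j * J_form nu (U i) (V j).
Proof.
move=> HU HV.
have ij i j : nu.-integrable setT (EFin \o (fun x => (c i * d j) * (U i x * V j x))).
  have := integrableZl measurableT (c i * d j) (H0_integrable (HU i) (HV j)).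
  exact: eq_integrable.
transitivity (\int[nu]_x \sum_(i < n) \sum_(j < n) (c i * d j) * (U i x * V j x)).
  apply: eq_Rintegral => x _; rewrite mulr_suml; apply: eq_bigr => i _.
  by rewrite mulr_sumr; apply: eq_bigr => j _; ring.
rewrite (Rintegral_sum _ measurableT _).2; last first.
  by move=> i _; exact: (Rintegral_sum _ measurableT (fun j _ => ij i j)).1.
apply: eq_bigr => i _; rewrite (Rintegral_sum _ measurableT _).2 //.
apply: eq_bigr => j _; rewrite RintegralZl//.
exact: H0_integrable.
Qed.

Lemma J_form0 u : J_form nu u (fun=> 0) = 0.
Proof.
by rewrite /J_form; under eq_Rintegral do rewrite mulr0; rewrite Rintegral_cst// mul0r.
Qed.

Lemma sobolev_scale u g c : sobolev_limit u g ->
  sobolev_limit (fun x => c * u x) (fun a x => c * g a x).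
Proof.
move=> su; have := sobolev_lin c su (@sobolev0 R m l).
by under eq_fun do rewrite addr0; under [X in sobolev_limit _ X -> _]eq_fun do
  under eq_fun do rewrite addr0.
Qed.

(** As [t] is positive, [polyharmonic] takes the value [t f] either because this function
    represents [J(f, .)], or as its default value 0, in which case [f] vanishes. *)
Lemma eigenfunction_form t f w : 0 < t -> eigenspace_of l nu t f -> H0 l w ->
  J_form nu f w = t * top_form (G f) (G w).
Proof.
move=> t0 [Hf]; rewrite /polyharmonic; set P := [set v | _] => Ef Hw.
have Lf := sobolev_derivP Hf; have Lw := sobolev_derivP Hw.
have tE : I_form l (fun x => t * f x) w = t * top_form (G f) (G w).
  rewrite (I_formE (sobolev_scale t Lf) Lw) /top_form mulr_sumr.
  apply: eq_bigr => a /eqP al; rewrite -RintegralZl; last 2 first.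
  - exact: measurable_cube.
  - by apply: L2_mul; [apply: sobolev_L2 Lf _|apply: sobolev_L2 Lw _]; rewrite al.
  by apply: eq_Rintegral => x _; rewrite mulrA.
have [[v Pv]|nP] := pselect (exists v, P v).
  by have [_] := xgetI (fun=> 0) Pv; rewrite Ef => /(_ w Hw) ->.
move: Ef; rewrite xgetPN => [Ef|v Pv]; last by apply: nP; exists v.
have f0 : f = fun=> 0.
  apply/funext => x; have /esym/eqP := congr1 (fun k => k x) Ef.
  by rewrite mulf_eq0 gt_eqF//= => /eqP.
rewrite -(I_formE Lf Lw) f0 (I_formE (@sobolev0 R m l) Lw) J_formC J_form0.
rewrite /top_form big1 ?mulr0// => a _.
under eq_Rintegral do rewrite mul0r.
by rewrite Rintegral_cst ?mul0r//; exact: measurable_cube.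
Qed.

(** Any function representing [J(0, .) = 0] is [I]-orthogonal to itself, hence zero. *)
Lemma eigenspace0 t : eigenspace_of l nu t (fun=> 0).
Proof.
have S0 := @sobolev0 R m l; have H00 : H0 l (fun _ : 'rV[R]_m => (0 : R)) by exists (fun _ _ => 0).
split => //; rewrite mulr0 /polyharmonic; set P := [set v | _].
have P0 : P (fun=> 0).
  split => // w Hw; rewrite J_formC J_form0 (I_formE S0 (sobolev_derivP Hw)).
  rewrite /top_form big1// => a _; under eq_Rintegral do rewrite mul0r.
  by rewrite Rintegral_cst ?mul0r//; exact: measurable_cube.
have [Hv Pv] := xgetI (fun=> 0) P0; have Lv := sobolev_derivP Hv.
apply: (top_form_eq0 m_gt0 Lv).
by rewrite -(I_formE Lv Lv) -Pv// J_formC J_form0.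
Qed.

Lemma kernel_vector (N n : nat) (A : 'M[R]_(n.+1, N)) : (N <= n)%N ->
  exists2 c : 'rV[R]_n.+1, c != 0 & c *m A = 0.
Proof.
move=> Nn; have : kermx A != 0.
  rewrite kermx_eq0 /row_free; apply/negP => /eqP rA.
  by have := rank_leq_col A; rewrite rA ltnNge Nn.
by move=> /rowV0Pn[c /sub_kermxP cA c0]; exists c.
Qed.

(** The sequence [lam] takes the value [t] as often as the dimension of the eigenspace of [t],
    so the indices of this value can be matched with a basis of the eigenspace. *)
Lemma independent_eigenfunctions (lam : nat -> R) n :
  eigenvalue_sequence l nu lam -> 0 < lam n ->
  exists e : nat -> 'rV[R]_m -> R,
    (forall i, (i <= n)%N -> eigenspace_of l nu (lam i) (e i)) /\
    forall t (c : 'I_n.+1 -> R), 0 < t ->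
      (forall x, \sum_(i < n.+1 | lam i == t) c i * e i x = 0) ->
      forall i : 'I_n.+1, lam i = t -> c i = 0.
Proof.
move=> [ni lam0 _ mult] ln0.
have lpos i : (i <= n)%N -> 0 < lam i by move=> iN; apply: lt_le_trans ln0 (ni _ _ iN).
have base t : exists bb : nat -> 'rV[R]_m -> R, 0 < t ->
    (forall i, lam i = t -> eigenspace_of l nu t (bb i)) /\
    forall (c : 'I_n.+1 -> R),
      (forall x, \sum_(i < n.+1 | lam i == t) c i * bb i x = 0) ->
      forall i : 'I_n.+1, lam i = t -> c i = 0.
  have [t0|] := boolP (0 < t); last by exists (fun _ _ => 0).
  have [k [[b [bE bU]] /card_set_bijP[f fbij]]] := mult t t0.
  have fk i : lam i = t -> (f i < k)%N by move=> it; exact: (set_bij_homo fbij it).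
  pose bb i := if (insub (f i : nat) : option (ordinal k)) is Some j then b j else fun=> 0.
  have bbE i (it : lam i = t) : bb i = b (Ordinal (fk i it)).
    rewrite /bb; case: insubP => [j _ ji|]; last by rewrite fk.
    by congr b; apply: val_inj.
  exists bb => _; split => [i it|c c0 i it]; first by rewrite bbE.
  pose d j := \sum_(i < n.+1 | (lam i == t) && (f i == j :> nat)) c i.
  have [d' [_ d'U]] := bU _ (eigenspace0 t).
  have d0 : d' = (fun j : 'I_k => d j).
    apply: d'U; apply/funext => x; apply: etrans (esym (c0 x)) _.
    have ck (i0 : 'I_n.+1) : lam i0 == t -> c i0 * bb i0 x =
        \sum_(j < k | f i0 == j) c i0 * b j x.
      move=> /eqP i0t; rewrite (bigD1 (Ordinal (fk _ i0t)))//= big1 ?addr0 ?bbE//.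
      by move=> j /andP[/eqP fj]; rewrite -(inj_eq val_inj)/= fj eqxx.
    rewrite (eq_bigr _ ck) (exchange_big_dep xpredT)//=.
    by apply: eq_bigr => j _; rewrite /d mulr_suml.
  have d'0 : d' = fun=> 0.
    by apply: d'U; apply/funext => x; rewrite big1// => j _; rewrite mul0r.
  have : d (Ordinal (fk i it)) = 0.
    by have /(congr1 (fun p => p (Ordinal (fk i it)))) := d0; rewrite d'0.
  rewrite /d/= (bigD1 i) ?it ?eqxx//= big1 ?addr0// => j /andP[/andP[/eqP jt /eqP fj] ji].
  exfalso; move/negP: ji; apply; apply/eqP/val_inj.
  by apply: (set_bij_inj fbij) => //; rewrite inE.
have [bb bbP] := choice base.
exists (fun i => bb (lam i) i); split => [i iN|t c t0 c0 i it].
  by apply: (bbP (lam i) (lpos _ iN)).1.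
apply: ((bbP t t0).2 c _ i it) => x; apply: etrans _ (c0 x).
by apply: eq_bigr => j /eqP ->.
Qed.

(** The min-max argument.  A non-zero combination of the first [n + 1] eigenfunctions lies in the
    kernel of the functionals.  For this vector [J] is at least [lam n] times [I], while it
    is at most [tau] times [I]; and [I] does not vanish there by linear independence. *)
Lemma eigenvalue_le (lam : nat -> R) n tau
    (F : seq (set 'rV[R]_m * multi_index m l)) :
  eigenvalue_sequence l nu lam -> 0 <= tau -> (size F <= n)%N ->
  (forall p, p \in F -> [/\ measurable p.1, p.1 `<=` Q & (mi_order p.2 <= l)%N]) ->
  (forall u g, sobolev_limit u g ->
    (forall p, p \in F -> \int[mu]_(x in p.1) g p.2 x = 0) ->
    J_form nu u u <= tau * top_form g g) ->
  lam n <= tau.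
Proof.
move=> lamE tau0 Fn FP main.
have [ni lam0 _ _] := lamE.
have [ln0|] := boolP (0 < lam n); last by rewrite -leNgt => /le_trans; apply.
have [e [eE ind]] := independent_eigenfunctions lamE ln0.
have eH (i : 'I_n.+1) : H0 l (e i) by have [] := eE i (ltn_ord i).
pose g (i : 'I_n.+1) : multi_index m l -> 'rV[R]_m -> R := G (e i).
have eg (i : 'I_n.+1) : sobolev_limit (e i) (g i) := sobolev_derivP (eH i).
have lpos (i : 'I_n.+1) : 0 < lam i.
  by apply: lt_le_trans ln0 (ni _ _ _); rewrite -ltnS.
pose M i j := top_form (g i) (g j).
have JM (i j : 'I_n.+1) : J_form nu (e i) (e j) = lam i * M i j.
  by apply: eigenfunction_form => //; exact: (eE i (ltn_ord i)).
(* By the symmetry of [J], both [lam i] and [lam j] turn [M i j] into the same number. *)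
have M0 (i j : 'I_n.+1) : lam i != lam j -> M i j = 0.
  move=> ij; have /eqP : lam i * M i j = lam j * M i j.
    by rewrite -JM J_formC JM /M top_formC.
  by rewrite -subr_eq0 -mulrBl mulf_eq0 subr_eq0 (negbTE ij) => /eqP.
pose comb (c : 'I_n.+1 -> R) x := \sum_(i < n.+1) c i * e i x.
pose gcomb (c : 'I_n.+1 -> R) (a : multi_index m l) x := \sum_(i < n.+1) c i * g i a x.
have combP c : sobolev_limit (comb c) (gcomb c) by exact: sobolev_sum.
have IE c d : top_form (gcomb c) (gcomb d) = \sum_i \sum_j c i * d j * M i j.
  exact: (top_form_sum c d eg eg).
have JE c d : J_form nu (comb c) (comb d) = \sum_i \sum_j c i * d j * (lam i * M i j).
  rewrite (J_form_sum c d eH eH); apply: eq_bigr => i _; apply: eq_bigr => j _.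
  by rewrite JM.
have iW p i : p \in F -> mu.-integrable p.1 (EFin \o g i p.2).
  move=> /FP[mp pQ pl]; apply: (integrableS measurable_cube mp pQ).
  by apply: L2_integrable; exact: sobolev_L2 (eg i) pl.
pose A : 'M[R]_(n.+1, size F) := \matrix_(i, j)
  \int[mu]_(x in (tnth (in_tuple F) j).1) g i (tnth (in_tuple F) j).2 x.
have [cv cv0 cA] := kernel_vector A Fn.
pose c i := cv ord0 i.
have Fc p : p \in F -> \int[mu]_(x in p.1) gcomb c p.2 x = 0.
  move=> pF; have [mp _ _] := FP p pF.
  have /tnthP[j pj] : p \in in_tuple F by [].
  have := congr1 (fun B : 'rV_(size F) => B ord0 j) cA; rewrite !mxE => cAj.
  rewrite /gcomb (Rintegral_sum _ mp _).2; last first.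
    move=> i _; have := integrableZl mp (c i) (iW p i pF).
    exact: eq_integrable.
  apply: etrans cAj; apply: eq_bigr => i _.
  by rewrite RintegralZl//; [rewrite mxE -pj|exact: iW].
have J1 := main _ _ (combP c) Fc.
(* [J - lam n * I] is the square of a vector of the span. *)
pose s (i : 'I_n.+1) := Num.sqrt (lam i - lam n) * c i.
have J2 : lam n * top_form (gcomb c) (gcomb c) <= J_form nu (comb c) (comb c).
  rewrite -subr_ge0; have := top_form_ge0 (gcomb s); congr (_ <= _).
  rewrite JE !IE mulr_sumr -sumrB; apply: eq_bigr => i _.
  rewrite mulr_sumr -sumrB; apply: eq_bigr => j _.
  have [ij|/M0 ->] := eqVneq (lam i) (lam j); last by rewrite !mulr0 subr0.
  rewrite /s -ij; have d0 : 0 <= lam i - lam n.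
    by rewrite subr_ge0; apply: ni; rewrite -ltnS.
  have := sqr_sqrtr d0; move: (Num.sqrt _) (M i j) (c i) (c j) => r p q z rE.
  have -> : r * q * (r * z) * p = r ^+ 2 * (q * z * p) by ring.
  by rewrite rE; ring.
have := le_trans J2 J1; have := top_form_ge0 (gcomb c).
rewrite le_eqVlt => /predU1P[X0 _|X0]; last by rewrite ler_pM2r.
exfalso.
have u0 := top_form_eq0 m_gt0 (combP c) (esym X0).
move/negP: cv0; apply; apply/eqP/rowP => i; rewrite mxE -/(c i).
apply: (ind (lam i) c (lpos i) _ i erefl) => x.
pose d (j : 'I_n.+1) := if lam j == lam i then c j else 0.
have dE y : \sum_(j < n.+1 | lam j == lam i) c j * e j y = comb d y.
  rewrite big_mkcond; apply: eq_bigr => j _; rewrite /d.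
  by case: ifP; rewrite ?mul0r.
rewrite dE (top_form_eq0 m_gt0 (combP d))//.
have : J_form nu (comb d) (comb c) = 0 by rewrite u0 J_form0.
have -> : J_form nu (comb d) (comb c) = lam i * top_form (gcomb d) (gcomb d).
  rewrite JE IE mulr_sumr; apply: eq_bigr => j _.
  rewrite mulr_sumr; apply: eq_bigr => k _; rewrite /d.
  have [ji|] := eqVneq (lam j) (lam i); last by rewrite !(mul0r, mulr0).
  have [ki|ki] := eqVneq (lam k) (lam i); first by rewrite ji; ring.
  by rewrite (M0 j k) ?ji 1?eq_sym// !(mul0r, mulr0).
by move=> /eqP; rewrite mulf_eq0 gt_eqF//= => /eqP.
Qed.

End eigenvalues.

(** * Adaptive dyadic partitions *)

Lemma Rintegral_partition d (T : measurableType d) (R : realType)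
    (mu : {measure set T -> \bar R}) (I : finType) (P : pred I) (A : I -> set T)
    (W : set T) (f : T -> R) :
  measurable W -> (forall i, measurable (A i)) ->
  mu.-integrable W (EFin \o f) -> (forall i, P i -> A i `<=` W) ->
  (forall x, W x -> exists i, [/\ P i, A i x & forall j, P j -> A j x -> j = i]) ->
  \int[mu]_(x in W) f x = \sum_(i | P i) \int[mu]_(x in A i) f x.
Proof.
move=> mW mA iW AW WA.
rewrite Rintegral_mkcond.
under [RHS]eq_bigr do rewrite Rintegral_mkcond.
rewrite -(Rintegral_sum _ measurableT _).2; last first.
  move=> i Pi; have /(integrable_mkcond _ (mA i)) : mu.-integrable (A i) (EFin \o f).
    exact: integrableS mW (mA i) (AW i Pi) iW.
  by apply: eq_integrable => // x _; rewrite /= !patchE; case: ifP.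
apply: eq_Rintegral => x _; rewrite patchE; case: ifPn => [|xW].
  rewrite inE => /WA[i [Pi Ax Au]]; rewrite (bigD1 i)//= patchE mem_set// big1 ?addr0//.
  move=> j /andP[Pj ji]; rewrite patchE memNset// => Ajx.
  by move: ji; rewrite (Au j Pj Ajx) eqxx.
rewrite big1// => i Pi; rewrite patchE memNset// => Ax.
by move: xW; rewrite mem_set//; exact: AW Ax.
Qed.

Section cells.
Context {R : realType} {m : nat}.
Implicit Types n : nat.

Definition cell_index n : finType := {ffun 'I_m -> 'I_(2 ^ n)}.

Definition cell_corner n (p : cell_index n) : 'I_m -> R := fun i => (p i)%:R / 2 ^+ n.

Definition cell n (p : cell_index n) : set 'rV[R]_m := box (cell_corner p) (2 ^+ n)^-1.

Lemma half_ltn_expn n (j : 'I_(2 ^ n.+1)) : (j./2 < 2 ^ n)%N.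
Proof. by rewrite ltn_half_double -mul2n -expnS. Qed.

Definition parent n (q : cell_index n.+1) : cell_index n :=
  [ffun i => Ordinal (half_ltn_expn (q i))].

Lemma measurable_cell n (p : cell_index n) : measurable (cell p).
Proof. exact: measurable_box. Qed.

Lemma cellE n (p : cell_index n) x : cell p x <->
  forall i, (p i)%:R < 2 ^+ n * x ord0 i <= (p i).+1%:R.
Proof.
have h0 : 0 < (2 : R) ^+ n by rewrite exprn_gt0.
have E i : (cell_corner p i < x ord0 i <= cell_corner p i + (2 ^+ n)^-1) =
    ((p i)%:R < 2 ^+ n * x ord0 i <= (p i).+1%:R).
  rewrite /cell_corner ltr_pdivrMr// mulrC; congr (_ && _).
  by rewrite -[X in _ + X]mul1r -mulrDl natr1 ler_pdivlMr// mulrC.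
by split => H i; have := H i; rewrite E.
Qed.

Lemma cell_inj n (p q : cell_index n) x : cell p x -> cell q x -> p = q.
Proof.
move=> /cellE px /cellE qx; apply/ffunP => i; apply: val_inj => /=.
have /andP[p1 p2] := px i; have /andP[q1 q2] := qx i.
have pq : (p i < (q i).+1)%N by rewrite -(ltr_nat R) (lt_le_trans p1 q2).
have qp : (q i < (p i).+1)%N by rewrite -(ltr_nat R) (lt_le_trans q1 p2).
by apply/eqP; rewrite eqn_leq; apply/andP; split.
Qed.

Lemma cell_sub_parent n (q : cell_index n.+1) : cell q `<=` cell (parent q).
Proof.
move=> x /cellE qx; apply/cellE => i; have := qx i; rewrite ffunE /= exprS -mulrA.
have : (q i : nat)%:R = 2 * ((q i)./2)%:R + (odd (q i))%:R :> R.
  by rewrite -natrM -natrD mul2n addnC odd_double_half.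
have o0 : 0 <= (odd (q i))%:R :> R by [].
have o1 : (odd (q i))%:R <= 1 :> R by case: odd.
rewrite -!natr1 => -> /andP[H1 H2]; apply/andP; split; lra.
Qed.

Lemma cell_children n (p : cell_index n) x : cell p x ->
  exists q : cell_index n.+1, parent q = p /\ cell q x.
Proof.
move=> /cellE px.
pose b i := (p i).+1%:R + (p i)%:R < 2 ^+ n.+1 * x ord0 i.
have ltq i : (b i + (p i).*2 < 2 ^ n.+1)%N.
  have : ((p i).+1.*2 <= 2 ^ n.+1)%N by rewrite -mul2n expnS leq_mul2l/= ltn_ord.
  by apply: leq_trans; rewrite doubleS !ltnS; case: (b i).
exists [ffun i => Ordinal (ltq i)]; split.
  by apply/ffunP => i; apply: val_inj; rewrite !ffunE /= half_bit_double.
apply/cellE => i; have /andP[p1 p2] := px i; rewrite !ffunE /=.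
have E : (b i + (p i).*2)%:R = (b i)%:R + 2 * (p i)%:R :> R.
  by rewrite natrD -mul2n natrM.
rewrite -natr1 E exprS -mulrA; move: p2; rewrite -natr1 => p2.
have bt : b i -> (p i)%:R + 1 + (p i)%:R < 2 * (2 ^+ n * x ord0 i).
  by rewrite /b exprS -mulrA -[(p i).+1%:R]natr1.
have bf : ~~ b i -> 2 * (2 ^+ n * x ord0 i) <= (p i)%:R + 1 + (p i)%:R.
  by rewrite /b -leNgt exprS -mulrA -[(p i).+1%:R]natr1.
by case: (b i) bt bf => [/(_ isT) H _|_ /(_ isT) H] /=; apply/andP; split; lra.
Qed.

Lemma card_children n (p : cell_index n) :
  (#|[pred q : cell_index n.+1 | parent q == p]| <= 2 ^ m)%N.
Proof.
pose f (q : cell_index n.+1) : {ffun 'I_m -> bool} := [ffun i => odd (q i)].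
have -> : (2 ^ m)%N = #|{ffun 'I_m -> bool}| by rewrite card_ffun card_bool card_ord.
apply: (@leq_card_in _ _ f) => q q' /eqP qp /eqP q'p /ffunP ff.
apply/ffunP => i; apply: val_inj => /=.
rewrite -(odd_double_half (q i)) -(odd_double_half (q' i)).
have := ff i; rewrite !ffunE => ->; congr (_ + _.*2)%N.
have := congr1 (fun p : cell_index n => val (p i)) (etrans qp (esym q'p)).
by rewrite !ffunE.
Qed.

Lemma cell_sub_cube n (p : cell_index n) : cell p `<=` @unit_cube R m.
Proof.
move=> x /cellE px i; have /andP[p1 p2] := px i.
have h0 : 0 < (2 : R) ^+ n by rewrite exprn_gt0.
rewrite -(pmulr_rgt0 _ h0) (le_lt_trans _ p1)//= -(ler_pM2l h0) mulr1.
by rewrite (le_trans p2)// -natrX ler_nat.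
Qed.

Lemma cell0 (p : cell_index 0) : cell p = @unit_cube R m.
Proof.
apply/seteqP; split; first exact: cell_sub_cube.
move=> x xQ; apply/cellE => i; have := ltn_ord (p i).
rewrite [X in (_ < X)%N -> _]expn0 ltnS leqn0 => /eqP ->; rewrite expr0 mul1r.
exact: xQ.
Qed.

Lemma Rintegral_children n (p : cell_index n) (f : 'rV[R]_m -> R)
    (mu : {measure set 'rV[R]_m -> \bar R}) :
  mu.-integrable (cell p) (EFin \o f) ->
  \int[mu]_(x in cell p) f x =
  \sum_(q : cell_index n.+1 | parent q == p) \int[mu]_(x in cell q) f x.
Proof.
move=> ip; apply: Rintegral_partition => //.
- exact: measurable_cell.
- by move=> q; exact: measurable_cell.
- by move=> q /eqP <-; exact: cell_sub_parent.
move=> x /cell_children[q [qp qx]]; exists q; split => //; first exact/eqP.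
by move=> q' _ q'x; exact: cell_inj q'x qx.
Qed.

End cells.

Section adaptive_partition.
Context {R : realType} {m l : nat} (nu : {finite_measure set 'rV[R]_m -> \bar R}).
Hypotheses (m_gt0 : (0 < m)%N) (ml : (m < 2 * l)%N).
Implicit Types (u : 'rV[R]_m -> R) (a : multi_index m l)
  (g : multi_index m l -> 'rV[R]_m -> R) (n : nat).
Local Notation mu := (lebesgue_rV R m).
Local Notation Q := (@unit_cube R m).
Local Notation b := (2 * l - m)%N.
Local Notation C := (@sobolev_const R m l).

Definition mass (W : set 'rV[R]_m) : R := fine (nu W).

Lemma mass_ge0 W : 0 <= mass W.
Proof. exact/fine_ge0/measure_ge0. Qed.

Lemma massS W W' : measurable W -> measurable W' -> W `<=` W' -> mass W <= mass W'.
Proof.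
move=> mW mW' WW'; apply: fine_le; [exact: fin_num_measure..|].
by apply: le_measure; rewrite ?inE.
Qed.

(** With [h] the side of the cell, this is [nu(C) h ^ (2 l - m)], that is
    [nu(C) Lambda(C) ^ (2 l / m - 1)]: the constant with which the energy on the cell bounds
    the integral of [u ^ 2]. *)
Definition cell_value n (p : cell_index n) : R := mass (cell p) * (2 ^+ n)^-1 ^+ b.

Definition energy (W : set 'rV[R]_m) g : R :=
  \sum_(a : multi_index m l | mi_order a == l) \int[mu]_(x in W) (g a x ^+ 2).

Lemma energy_ge0 W g : 0 <= energy W g.
Proof. by apply: sumr_ge0 => a _; apply: Rintegral_ge0 => x _; exact: sqr_ge0. Qed.

(** The supremum of [u ^ 2] given by [local_sobolev], times the mass of the cell. *)
Lemma cell_estimate u g n (p : cell_index n) : sobolev_limit u g ->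
  (forall a, (mi_order a < l)%N -> \int[mu]_(y in cell p) g a y = 0) ->
  \int[nu]_(x in cell p) (u x ^+ 2) <= C ^+ 2 * cell_value p * energy (cell p) g.
Proof.
move=> su g0; set h : R := (2 ^+ n)^-1.
have h0 : 0 < h by rewrite invr_gt0 exprn_gt0.
have C0 : 0 <= C.
  by rewrite /sobolev_const /sobolev_const_step !mulr_ge0// ?exprn_ge0// !mulr_ge0// exprn_ge0.
have E0 := energy_ge0 (cell p) g.
have pt x : cell p x -> u x ^+ 2 <= C ^+ 2 * (h ^+ b * energy (cell p) g).
  move=> px; apply/ler_addgt0Pr => e e0.
  (* A margin, since [local_sobolev] asks for a positive bound; it costs at most [e]. *)
  pose d := e / (C ^+ 2 + 1).
  have d0 : 0 < d by rewrite divr_gt0// ltr_wpDl// sqr_ge0.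
  set T := h ^+ b * energy (cell p) g.
  have T0 : 0 <= T by rewrite mulr_ge0// exprn_ge0// ltW.
  have S0 : 0 < Num.sqrt (T + d) by rewrite sqrtr_gt0 ltr_wpDl.
  have S2 : Num.sqrt (T + d) ^+ 2 = T + d by rewrite sqr_sqrtr// addr_ge0// ltW.
  have top a : mi_order a = l ->
      h ^+ (2 * l) * \int[mu]_(y in cell p) (g a y ^+ 2) <= h ^+ m * Num.sqrt (T + d) ^+ 2.
    move=> al; rewrite S2 -[X in h ^+ X](subnKC (ltnW ml)) exprD -mulrA.
    rewrite ler_pM2l ?exprn_gt0//; apply: (@le_trans _ _ T); last by rewrite lerDl ltW.
    rewrite ler_wpM2l ?exprn_ge0 ?(ltW h0)// /energy (bigD1 a) ?al//= lerDl.
    by apply: sumr_ge0 => a' _; apply: Rintegral_ge0 => y _; exact: sqr_ge0.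
  have := local_sobolev ml su h0 (@cell_sub_cube R m n p) px g0 S0 top.
  rewrite -(@ler_pXn2r _ 2) ?nnegrE ?mulr_ge0 ?(ltW S0)// real_normK ?num_real//.
  move=> /le_trans; apply; rewrite exprMn S2 mulrDr lerD2l.
  have : d * (C ^+ 2 + 1) = e by rewrite /d divfK// gt_eqF// ltr_wpDl// sqr_ge0.
  by move: (ltW d0); move: (C ^+ 2) (d) => c t t0 <-; rewrite mulrDr mulr1 mulrC lerDl.
have mp := @measurable_cell R m n p.
set K := C ^+ 2 * _ in pt.
have K0 : 0 <= K by rewrite /K mulr_ge0 ?sqr_ge0// mulr_ge0// exprn_ge0// ltW.
have iu : nu.-integrable (cell p) (EFin \o (fun x => u x ^+ 2)).
  have Hu : H0 l u by exists g.
  have := integrableS measurableT mp (@subsetT _ _) (H0_integrable nu Hu Hu).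
  by apply: eq_integrable => // x _ /=; rewrite expr2.
apply: (@le_trans _ _ (\int[nu]_(x in cell p) K)).
  apply: le_Rintegral => //; apply: measurable_bounded_integrable => //.
  - by rewrite ltey_eq fin_num_measure.
  - by exists K; split; [exact: num_real|move=> M KM x _ /=; rewrite (ger0_norm K0) ltW].
rewrite Rintegral_cst// /K /cell_value -/h /mass.
by rewrite le_eqVlt; apply/orP; left; apply/eqP; ring.
Qed.

Variables (t s : R).
Hypotheses (t_gt0 : 0 < t) (s_gt0 : 0 < s).

Definition cell_weight n (p : cell_index n) : R := (cell_value p / t) `^ s.

(** A cell that has to be cut has weight at least one, so this sum over the descendants down to
    the given depth bounds the number of cuts. *)
Fixpoint tree_weight depth n (p : cell_index n) : R :=
  cell_weight p +
  if depth is d.+1 then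
    \sum_(q : cell_index n.+1 | parent q == p) @tree_weight d n.+1 q
  else 0.

Lemma tree_weight_ge0 depth n (p : cell_index n) : 0 <= tree_weight depth p.
Proof.
elim: depth n p => [|d IH] n p /=; first by rewrite addr0 powR_ge0.
by rewrite addr_ge0 ?powR_ge0// sumr_ge0.
Qed.

Lemma sum_tree_weight depth n :
  \sum_(p : cell_index n) tree_weight depth p =
  \sum_(j < depth.+1) \sum_(p : cell_index (j + n)) cell_weight p.
Proof.
elim: depth n => [|d IH] n.
  by rewrite big_ord1; apply: eq_bigr => p _; rewrite /= addr0.
rewrite big_split/= big_ord_recl; congr (_ + _).
transitivity (\sum_(q : cell_index n.+1) tree_weight d q).
  by rewrite [RHS](partition_big (@parent m n) xpredT).
rewrite IH; apply: eq_bigr => j _.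
by rewrite lift0 addSnnS.
Qed.

Definition num_multi_indices : nat := #|{: multi_index m l}|.

(** A cell of value at most [t] needs the means of all derivatives of order less than [l] on
    it; any other cell is cut and the functionals of its children are collected.  A cut
    replaces one cell by at most [2 ^ m] cells and is paid for by the weight of the cell. *)
Lemma adaptive_partition depth n (p : cell_index n) :
  mass setT * (2 ^+ (n + depth))^-1 ^+ b <= t ->
  exists F : seq (set 'rV[R]_m * multi_index m l),
  [/\ forall w, w \in F -> [/\ measurable w.1, w.1 `<=` Q & (mi_order w.2 <= l)%N],
      (size F)%:R <= num_multi_indices%:R * (1 + 2 ^+ m * tree_weight depth p) &
      forall u g, sobolev_limit u g ->
        (forall w, w \in F -> \int[mu]_(x in w.1) g w.2 x = 0) ->
        \int[nu]_(x in cell p) (u x ^+ 2) <= C ^+ 2 * t * energy (cell p) g].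
Proof.
elim: depth n p => [|d IH] n p small.
all: have [good|bad] := leP (cell_value p) t.
1,3: exists [seq (cell p, a) | a <- enum [pred a : multi_index m l | (mi_order a < l)%N]].
1,2: split.
1,4: by move=> w /mapP[a]; rewrite mem_enum inE => al ->; split;
  [exact: measurable_cell|exact: cell_sub_cube|exact: ltnW].
1,3: rewrite size_map -cardE; apply: (@le_trans _ _ num_multi_indices%:R);
  [by rewrite ler_nat max_card|
   by rewrite ler_peMr// lerDl mulr_ge0 ?exprn_ge0// tree_weight_ge0].
1,2: move=> u g su Fg; apply: (le_trans (cell_estimate (p := p) su _));
  [by move=> a al; apply: (Fg (cell p, a)); apply/mapP; exists a; rewrite ?mem_enum|
   by rewrite ler_wpM2r ?energy_ge0// ler_wpM2l// sqr_ge0].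
- exfalso; suff : cell_value p <= t by rewrite leNgt bad.
  apply: le_trans small; rewrite addn0 ler_wpM2r ?exprn_ge0 ?invr_ge0 ?exprn_ge0//.
  by apply: massS; [exact: measurable_cell|exact: measurableT|exact: subsetT].
have smallS : mass setT * (2 ^+ (n.+1 + d))^-1 ^+ b <= t by rewrite addSnnS.
have [F FP] := choice (fun q : cell_index n.+1 => IH n.+1 q smallS).
have w1 : 1 <= cell_weight p.
  apply: (@le_trans _ _ (1 `^ s)); first by rewrite powR1.
  apply: ge0_ler_powR.
  - exact: ltW.
  - by rewrite nnegrE.
  - by rewrite nnegrE divr_ge0 ?(ltW t_gt0)// mulr_ge0 ?mass_ge0// exprn_ge0// invr_ge0 exprn_ge0.
  - by rewrite ler_pdivlMr// mul1r ltW.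
pose E := enum [pred q : cell_index n.+1 | parent q == p].
have E_mem q : (q \in E) = (parent q == p) by rewrite mem_enum.
exists (flatten [seq F q | q <- E]); split.
- by move=> w /flatten_mapP[q _ wq]; have [H _ _] := FP q; exact: H.
- rewrite size_flatten /shape -map_comp sumnE big_map natr_sum big_enum/=.
  apply: (@le_trans _ _ (\sum_(q | parent q == p)
      num_multi_indices%:R * (1 + 2 ^+ m * tree_weight d q))).
    by apply: ler_sum => q _; have [] := FP q.
  rewrite -mulr_sumr ler_wpM2l//.
  rewrite big_split/= -mulr_sumr sumr_const mulrDr addrA lerD2r.
  apply: (@le_trans _ _ (2 ^+ m)).
    by rewrite -natrX ler_nat; exact: card_children.
  by rewrite ler_wpDl// ler_peMr// exprn_ge0.
- move=> u g su Fg; have Hu : H0 l u by exists g.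
  have mp := @measurable_cell R m n p.
  rewrite Rintegral_children; last first.
    have := integrableS measurableT mp (@subsetT _ _) (H0_integrable nu Hu Hu).
    by apply: eq_integrable => // x _ /=; rewrite expr2.
  have -> : energy (cell p) g = \sum_(q | parent q == p) energy (cell q) g.
    rewrite /energy exchange_big/=; apply: eq_bigr => a /eqP al.
    rewrite Rintegral_children//.
    apply: (integrableS measurable_cube mp (@cell_sub_cube R m n p)).
    by apply: L2_sq; apply: sobolev_L2 su _; rewrite al.
  rewrite mulr_sumr; apply: ler_sum => q qp.
  have [_ _ H] := FP q; apply: H su _ => w wq; apply: Fg.
  by apply/flatten_mapP; exists q; rewrite ?E_mem.
Qed.

(** The depth is chosen such that all the cells of that level have value at most [t]; the
    hypothesis on [n] then leaves room for all the functionals of the partition. *)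
Lemma eigenvalue_le_dyadic (lam : nat -> R) n K : eigenvalue_sequence l nu lam ->
  (forall N, \sum_(j < N) \sum_(p : cell_index j) (cell_value p) `^ s <= K) ->
  num_multi_indices%:R * (1 + 2 ^+ m * (K * t `^ (- s))) <= n%:R ->
  lam n <= C ^+ 2 * t.
Proof.
move=> lamE HK Hn.
have b0 : (0 < b)%N by rewrite subn_gt0.
have [d dt] : exists d, mass setT * (2 ^+ (0 + d))^-1 ^+ b <= t.
  exists (Num.truncn (mass setT / t)).+1; rewrite add0n.
  set d := (Num.truncn _).+1.
  have td : mass setT / t <= 2 ^+ d.
    apply: (ltW (lt_le_trans (truncnS_gt _) _)).
    by rewrite -natrX ler_nat ltnW// ltn_expl.
  have p0 : 0 < (2 : R) ^+ d by rewrite exprn_gt0.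
  apply: (@le_trans _ _ (mass setT * (2 ^+ d)^-1)).
    rewrite ler_wpM2l ?mass_ge0// -[leRHS]expr1 ler_wiXn2l// ?invr_ge0 ?(ltW p0)//.
    by rewrite invf_le1// exprn_ege1// ler1n.
  by rewrite ler_pdivrMr// mulrC -ler_pdivrMr.
have lt1 : (0 < 2 ^ 0)%N by [].
have p0 : @cell_index m 0 by exact: [ffun=> Ordinal lt1].
have [F [F1 F2 F3]] := @adaptive_partition d 0%N p0 dt.
apply: (@eigenvalue_le R m l nu m_gt0 lam n (C ^+ 2 * t) F) => //.
- by rewrite mulr_ge0 ?sqr_ge0// ltW.
- rewrite -(ler_nat R); apply: le_trans F2 _; apply: le_trans Hn.
  rewrite ler_wpM2l// lerD2l ler_wpM2l ?exprn_ge0//.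
  apply: (@le_trans _ _ (\sum_(p : cell_index 0) tree_weight d p)).
    rewrite (bigD1 p0)//= lerDl sumr_ge0// => q _; exact: tree_weight_ge0.
  rewrite sum_tree_weight.
  apply: (@le_trans _ _ ((\sum_(j < d.+1) \sum_(p : cell_index j) (cell_value p) `^ s)
      * t `^ (- s))); last by rewrite ler_wpM2r ?powR_ge0.
  rewrite mulr_suml; apply: ler_sum => j _; rewrite addn0 mulr_suml.
  apply: ler_sum => p _; rewrite /cell_weight powRM ?invr_ge0 ?(ltW t_gt0)//; last first.
    by rewrite mulr_ge0 ?mass_ge0// exprn_ge0// invr_ge0 exprn_ge0.
  by rewrite -powR_inv1 ?(ltW t_gt0)// -powRrM mulN1r.
- move=> u g su Fg.
  have [[cu u0] _ _ _] := su.
  have -> : J_form nu u u = \int[nu]_(x in cell p0) (u x ^+ 2).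
    rewrite cell0 Rintegral_mkcond; apply: eq_Rintegral => x _.
    rewrite patchE; case: ifPn => [_|]; first by rewrite expr2.
    rewrite notin_setE => xQ; rewrite u0 ?mulr0// => xo; apply: xQ => i.
    by have /andP[-> /ltW ->] := xo i.
  have -> : top_form g g = energy (cell p0) g.
    by rewrite cell0; apply: eq_bigr => a _; apply: eq_Rintegral => x _; rewrite expr2.
  exact: F3 su Fg.
Qed.

End adaptive_partition.

(** * Partition functions *)

Section limsup.
Context {R : realType}.
Local Open Scope ereal_scope.

Lemma limn_esup_le_near (u : nat -> \bar R) x n0 :
  (forall n, (n0 <= n)%N -> u n <= x) -> limn_esup u <= x.
Proof.
move=> H; apply: (@le_trans _ _ (ereal_sup (u @` [set n | (n0 <= n)%N]))).
  by apply: ereal_inf_lbound; exists [set n | (n0 <= n)%N] => //; exists n0.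
by apply: ge_ereal_sup => _ [n /= /H un <-].
Qed.

Lemma limn_esup_lt_near (u : nat -> \bar R) x : limn_esup u < x ->
  exists n0, forall n, (n0 <= n)%N -> u n < x.
Proof.
move=> /ereal_inf_lt[_ [V [n0 _ n0V] <-] Vx]; exists n0 => n n0n.
apply: le_lt_trans Vx; apply: ereal_sup_ubound; exists n => //.
exact: n0V.
Qed.

Lemma limn_esup_le_harmonic (u : nat -> \bar R) (x : R) n0 (v : nat -> R) :
  v n @[n --> \oo] --> 0%R ->
  (forall n, (n0 <= n)%N -> u n <= (x + v n)%:E) -> limn_esup u <= x%:E.
Proof.
move=> v0 H; apply/lee_addgt0Pr => e e0.
have [n1 _ Hn1] : \forall n \near \oo, (`|0 - v n| < e)%R.
  by move/cvgrPdist_lt : v0; exact.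
apply: (@limn_esup_le_near _ _ (maxn n0 n1)) => n; rewrite geq_max => /andP[nn0 nn1].
apply: le_trans (H n nn0) _; rewrite -EFinD lee_fin lerD2l.
have := Hn1 n nn1; rewrite /= sub0r normrN => /ltW; apply: le_trans.
exact: ler_norm.
Qed.

End limsup.

Section moments.
Context {R : realType} {m : nat} (nu : {finite_measure set 'rV[R]_m -> \bar R}).
Hypothesis nu_cube : nu (~` @open_unit_cube R m) = 0%E.
Hypothesis nu_neq0 : nu setT <> 0%E.
Implicit Types (n : nat) (s : R).
Local Notation mass := (mass nu).

Definition moment n s : R :=
  \sum_(p : @cell_index m n | 0 < mass (cell p)) mass (cell p) `^ s.

Lemma massE W : measurable W -> nu W = (mass W)%:E.
Proof. by move=> mW; rewrite /mass fineK// fin_num_measure. Qed.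

Lemma measurable_open_cube : measurable (@open_unit_cube R m).
Proof.
rewrite (_ : @open_unit_cube R m = \big[setI/setT]_(i < m)
    ((fun x : 'rV[R]_m => x ord0 i) @^-1` `]0, 1[%classic)).
  apply: bigsetI_measurable => i _; rewrite -[X in measurable X]setTI.
  exact: measurable_coord.
rewrite -bigcap_seq; apply/seteqP; split => x /=.
  by move=> bx i _; rewrite /= in_itv/=; exact: bx.
by move=> bx i; have := bx i (mem_index_enum i); rewrite /= in_itv.
Qed.

Lemma positive_meets_open_cube W : measurable W -> (0 < nu W)%E ->
  exists2 x, W x & @open_unit_cube R m x.
Proof.
move=> mW W0; apply: contrapT => H.
suff : (nu W <= 0)%E by rewrite leNgt W0.
rewrite -nu_cube; apply: le_measure; rewrite ?inE//.
  by apply: measurableC; exact: measurable_open_cube.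
by move=> x Wx xo; apply: H; exists x.
Qed.

Lemma cell_dyadic n (p : @cell_index m n) :
  cell p = @dyadic_cube R m n (fun i => Posz (p i)).
Proof.
apply/seteqP; split => x H i; have := H i; rewrite /cell_corner.
all: by rewrite -[X in _ / _ + X]mul1r -mulrDl natr1 -PoszD addn1.
Qed.

(** As [nu] is carried by the open unit cube, a dyadic cube of positive mass lies in the half-open
    one, and its index is a tuple of numbers between 0 and [2 ^ n - 1]. *)
Lemma dyadic_cubesE n :
  dyadic_cubes nu n = @cell R m n @` [set p : @cell_index m n | 0 < mass (cell p)].
Proof.
apply/seteqP; split => [_ [[p ->] Cp]|_ [p /= p0 <-]]; last first.
  split; last by rewrite [X in (_ < X)%E](massE (measurable_cell p)) lte_fin.
  by exists (fun i => Posz (p i)); exact: cell_dyadic.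
have h0 : 0 < (2 : R) ^+ n by rewrite exprn_gt0.
have mC : measurable (@dyadic_cube R m n p).
  rewrite (_ : dyadic_cube _ _ = box (fun i => (p i)%:~R / 2 ^+ n) (2 ^+ n)^-1).
    exact: measurable_box.
  have E i : (p i + 1)%:~R / 2 ^+ n = (p i)%:~R / 2 ^+ n + (2 ^+ n)^-1 :> R.
    by rewrite intrD mulrDl mul1r.
  by apply/seteqP; split => x H i; have := H i; rewrite /= E.
have [x px xo] := positive_meets_open_cube mC Cp.
have pn i : exists k : 'I_(2 ^ n), p i = Posz k.
  have /andP[x1 x2] := px i; have /andP[x3 x4] := xo i.
  have q0 : 0 <= p i.
    have := lt_le_trans x3 x2; rewrite pmulr_lgt0 ?invr_gt0// ltr0z.
    by rewrite -ltzD1.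
  have qn : (p i < (2 ^ n)%N)%R.
    have := lt_trans x1 x4; rewrite ltr_pdivrMr// mul1r -natrX.
    by rewrite -[X in _ < X]/((Posz (2 ^ n))%:~R) ltr_int.
  have kn : (`|p i| < 2 ^ n)%N by rewrite -ltz_nat gez0_abs.
  by exists (Ordinal kn); rewrite /= gez0_abs.
have [k kE] := choice pn.
pose q : @cell_index m n := [ffun i => k i].
have E : @dyadic_cube R m n p = cell q.
  rewrite cell_dyadic; congr dyadic_cube; apply/funext => i.
  by rewrite kE /q ffunE.
exists q; last by rewrite E.
by rewrite /= -lte_fin -(massE (measurable_cell q)) -E.
Qed.

Lemma esum_moment n s : (\esum_(C in dyadic_cubes nu n) nu C `^ s = (moment n s)%:E)%E.
Proof.
pose E := enum [pred p : @cell_index m n | 0 < mass (cell p)].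
have EE : [set p : @cell_index m n | 0 < mass (cell p)] = [set` E].
  by apply/seteqP; split => p /=; rewrite mem_enum.
rewrite dyadic_cubesE EE.
rewrite (@reindex_esum _ _ _ [set` E] _ (@cell R m n)); last first.
  apply: inj_bij => p q; rewrite !inE /= !mem_enum !inE => p0 _ pq.
  have [x px _] : exists2 x, cell p x & @open_unit_cube R m x.
    apply: positive_meets_open_cube; first exact: measurable_cell.
    by rewrite (massE (measurable_cell p)) lte_fin.
  by apply: (cell_inj px); rewrite -pq.
rewrite esum_fset; [|exact: finite_seq|by move=> p _; exact: poweR_ge0].
rewrite -fsbig_seq ?enum_uniq// big_enum/= /moment -sumEFin.
by apply: eq_bigr => p _; rewrite [X in (X `^ _)%E](massE (measurable_cell p)).
Qed.

Lemma mass_cube : mass (@unit_cube R m) = mass setT.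
Proof.
have mQ := @measurable_cube R m.
have : (nu setT = nu (@unit_cube R m) + nu (~` @unit_cube R m))%E.
  rewrite -measureU//; [by rewrite setUv|exact: measurableC|by rewrite setICr].
have -> : nu (~` @unit_cube R m) = 0%E.
  apply/eqP; rewrite eq_le measure_ge0 andbT -nu_cube; apply: le_measure.
  - by rewrite inE; exact: measurableC.
  - by rewrite inE; apply: measurableC; exact: measurable_open_cube.
  - by move=> x xQ xo; apply: xQ => i; have /andP[-> /ltW ->] := xo i.
by rewrite adde0 /mass => ->.
Qed.

Lemma massT_gt0 : 0 < mass setT.
Proof.
rewrite lt_neqAle mass_ge0 andbT eq_sym; apply/eqP => H.
by apply: nu_neq0; rewrite massE ?H.
Qed.

Lemma sum_mass n : \sum_(p : @cell_index m n) mass (cell p) = mass setT.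
Proof.
elim: n => [|n IH].
  rewrite (eq_bigr (fun=> mass (@unit_cube R m))); last by move=> p _; rewrite cell0.
  rewrite sumr_const card_ffun !card_ord expn0 exp1n mulr1n.
  exact: mass_cube.
rewrite -[RHS]IH (partition_big (@parent m n) xpredT)//=.
apply: eq_bigr => p _.
have cst1 (W : set 'rV[R]_m) : measurable W -> \int[nu]_(x in W) 1 = mass W.
  by move=> mW; rewrite Rintegral_cst// mul1r.
have := @Rintegral_children R m n p (fun=> 1) nu; rewrite cst1; last exact: measurable_cell.
move=> ->.
  by apply: eq_bigr => q _; rewrite cst1//; exact: measurable_cell.
apply: finite_measure_integrable_cst; exact: measurable_cell.
Qed.

End moments.

Section real_sequences.
Context {R : realType}.

Lemma bounded_geometric_sums (a : nat -> R) A r n0 : 0 < r < 1 -> 0 <= A ->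
  (forall n, 0 <= a n) -> (forall n, (n0 <= n)%N -> a n <= A * r ^+ n) ->
  exists2 K, 0 < K & forall N, \sum_(j < N) a j <= K.
Proof.
move=> /andP[r0 r1] A0 a0 aA.
pose B := A + \sum_(j < n0) a j / r ^+ j.
have S0 : 0 <= \sum_(j < n0) a j / r ^+ j.
  by apply: sumr_ge0 => j _; rewrite divr_ge0// exprn_ge0// ltW.
have B0 : 0 <= B by rewrite addr_ge0.
have aB n : a n <= B * r ^+ n.
  have rn : 0 < r ^+ n by rewrite exprn_gt0.
  have [/aA/le_trans|nn0] := leqP n0 n.
    by apply; rewrite ler_pM2r// lerDl.
  rewrite -ler_pdivrMr// /B (bigD1 (Ordinal nn0))//= addrCA lerDl addr_ge0//.
  by apply: sumr_ge0 => j _; rewrite divr_ge0// exprn_ge0// ltW.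
have d0 : 0 < 1 - r by rewrite subr_gt0.
have H N : (1 - r) * \sum_(j < N) a j <= B * (1 - r ^+ N).
  elim: N => [|N IH]; first by rewrite big_ord0 expr0 subrr !mulr0.
  rewrite big_ord_recr/= mulrDr; apply: le_trans (lerD IH (ler_wpM2l (ltW d0) (aB N))) _.
  rewrite exprS; move: (r ^+ N) => y.
  by rewrite le_eqVlt; apply/orP; left; apply/eqP; ring.
exists (B / (1 - r) + 1); first by rewrite ltr_wpDl// divr_ge0// ltW.
move=> N; apply: (@le_trans _ _ (B / (1 - r))); last by rewrite lerDl.
rewrite ler_pdivlMr// mulrC; apply: le_trans (H N) _.
by rewrite ler_piMr// lerBlDr lerDl exprn_ge0// ltW.
Qed.

Lemma cvg_div_ln (c : R) (N : nat -> R) : (forall n, n.+1%:R <= N n) ->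
  c / ln (N n) @[n --> \oo] --> 0.
Proof.
move=> HN; apply/cvgrPdist_lt => e e0.
exists (Num.truncn (expR (`|c| / e))).+1 => // n /= nn.
have En : expR (`|c| / e) < N n.
  apply: lt_le_trans (truncnS_gt _) _; apply: le_trans (HN n).
  by rewrite ler_nat ltnW.
have N0 : 0 < N n by apply: lt_trans En; exact: expR_gt0.
have L : `|c| / e < ln (N n) by rewrite -ltr_expR lnK.
have L0 : 0 < ln (N n) by apply: le_lt_trans L; rewrite divr_ge0// ltW.
rewrite sub0r normrN normrM normfV (gtr0_norm L0) ltr_pdivrMr// mulrC.
by rewrite -ltr_pdivrMr.
Qed.

Lemma powR_le_affine (x a s : R) : 0 < x -> 0 < a -> 0 < s < 1 ->
  x `^ s <= a `^ s + x * a `^ (s - 1).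
Proof.
move=> x0 a0 /andP[s0 s1]; have [xa|ax] := leP x a.
  apply: (@le_trans _ _ (a `^ s)); last by rewrite lerDl mulr_ge0 ?(ltW x0)// powR_ge0.
  by apply: ge0_ler_powR; rewrite ?nnegrE ?(ltW x0) ?(ltW a0) ?(ltW s0).
apply: (@le_trans _ _ (x * a `^ (s - 1))); last by rewrite lerDr powR_ge0.
have -> : x `^ s = x * x `^ (s - 1).
  rewrite -[X in X * _](@powRr1 _ x) ?(ltW x0)// -powRD; last by rewrite (gt_eqF x0) implybT.
  by rewrite addrC subrK.
rewrite ler_pM2l// -(opprB 1 s) !powRN lef_pV2 ?posrE ?powR_gt0//.
by apply: ge0_ler_powR; rewrite ?nnegrE ?(ltW x0) ?(ltW a0)// ?subr_ge0 ltW.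
Qed.

End real_sequences.

Section partition_functions.
Context {R : realType} {m : nat} (nu : {finite_measure set 'rV[R]_m -> \bar R}).
Hypothesis nu_cube : nu (~` @open_unit_cube R m) = 0%E.
Hypothesis nu_neq0 : nu setT <> 0%E.
Implicit Types (n : nat) (s : R).
Local Notation mass := (mass nu).
Local Notation moment := (moment nu).
Local Notation M := (mass setT).

Let ln2 : 0 < ln (2 : R). Proof. by rewrite ln_gt0// ltr1n. Qed.

Lemma moment_gt0 n s : 0 < moment n s.
Proof.
have [p p0] : exists p : @cell_index m n, 0 < mass (cell p).
  apply: contrapT => H; have := massT_gt0 nu_neq0.
  rewrite -(sum_mass nu_cube n) big1 ?ltxx// => p _; apply/eqP.
  rewrite eq_le mass_ge0 andbT leNgt; apply/negP => p0; apply: H; by exists p.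
rewrite /moment (bigD1 p)//= ltr_pwDl ?powR_gt0// sumr_ge0// => q _.
exact: powR_ge0.
Qed.

Lemma beta_nE n s : (0 < n)%N ->
  beta_n nu n s = (ln (moment n s) / ln (2 ^+ n))%:E.
Proof.
move=> n0; rewrite /beta_n esum_moment// lne_EFin ?moment_gt0//.
rewrite inver ifF ?EFinM//; apply/negbTE.
by rewrite lnXn// mulrn_eq0 negb_or -lt0n n0 gt_eqF.
Qed.

Lemma moment_full n s : 0 < s ->
  \sum_(p : @cell_index m n) mass (cell p) `^ s = moment n s.
Proof.
move=> s0; rewrite [RHS]big_mkcond; apply: eq_bigr => p _.
case: ifPn => //; rewrite lt_neqAle mass_ge0 andbT negbK eq_sym => /eqP ->.
by rewrite powR0// gt_eqF.
Qed.

Lemma mass_cell_le n (p : @cell_index m n) : mass (cell p) <= M.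
Proof. by apply: massS => //; exact: measurable_cell. Qed.

(** Each mass is at most the total mass [M]. *)
Lemma moment_decreasing n s s0 : s0 <= s -> moment n s <= M `^ (s - s0) * moment n s0.
Proof.
move=> ss; rewrite mulr_sumr; apply: ler_sum => p p0.
have -> : mass (cell p) `^ s = mass (cell p) `^ (s - s0) * mass (cell p) `^ s0.
  by rewrite -powRD ?subrK// (gt_eqF p0) implybT.
rewrite ler_wpM2r ?powR_ge0//; apply: ge0_ler_powR.
- by rewrite subr_ge0.
- by rewrite nnegrE mass_ge0.
- by rewrite nnegrE mass_ge0.
- exact: mass_cell_le.
Qed.

Lemma moment0 n : moment n 0 = #|[pred p : @cell_index m n | 0 < mass (cell p)]|%:R.
Proof. by rewrite -sum1_card natr_sum; apply: eq_bigr => p _; rewrite powRr0. Qed.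

(** Each mass is compared with the inverse of the number of cells.  The constant is not the
    optimal [M ^ s] of the Hoelder inequality, but it disappears in the exponents. *)
Lemma moment_concave n s : 0 < s < 1 -> moment n s <= (1 + M) * moment n 0 `^ (1 - s).
Proof.
move=> s01; set N := moment n 0; have N0 : 0 < N by exact: moment_gt0.
have a0 : 0 < N^-1 by rewrite invr_gt0.
have NE : N^-1 `^ (s - 1) = N `^ (1 - s).
  by rewrite -powR_inv1 ?(ltW N0)// -powRrM mulN1r opprB.
apply: (@le_trans _ _ (\sum_(p : @cell_index m n | 0 < mass (cell p))
    (N^-1 `^ s + mass (cell p) * N^-1 `^ (s - 1)))).
  by apply: ler_sum => p p0; exact: powR_le_affine.
rewrite big_split/= -mulr_suml NE mulrDl mul1r; apply: lerD.
  rewrite sumr_const -mulr_natl -[X in X * _]moment0 -/N.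
  rewrite -powR_inv1 ?(ltW N0)// -powRrM mulN1r -[X in X * _](@powRr1 _ N) ?(ltW N0)//.
  by rewrite -powRD// (gt_eqF N0) implybT.
rewrite ler_wpM2r ?powR_ge0// -(sum_mass nu_cube n) [leRHS](bigID (fun p => 0 < mass (cell p)))/=.
by rewrite lerDl sumr_ge0// => p _; exact: mass_ge0.
Qed.

Lemma ln_pow2_gt0 n : (0 < n)%N -> 0 < ln ((2 : R) ^+ n).
Proof. by move=> n0; rewrite lnXn// pmulrn_lgt0. Qed.

Let pow2_ge n : n.+1%:R <= (2 : R) ^+ n.
Proof. by rewrite -natrX ler_nat ltn_expl. Qed.

Lemma moment0_ge1 n : 1 <= moment n 0.
Proof.
by have := moment_gt0 n 0; rewrite moment0 ltr0n ler1n.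
Qed.

Lemma beta0_real : exists d, [/\ beta nu 0 = d%:E, 0 <= d & d <= m%:R].
Proof.
have ub : (beta nu 0 <= m%:R%:E)%E.
  apply: (@limn_esup_le_near _ _ _ 1) => n n0.
  rewrite beta_nE// lee_fin ler_pdivrMr ?ln_pow2_gt0// mulr_natl -lnXn ?exprn_gt0//.
  rewrite ler_ln ?posrE ?moment_gt0 ?exprn_gt0// moment0 -!natrX ler_nat.
  by apply: leq_trans (max_card _) _; rewrite card_ffun !card_ord.
have lb : (0 <= beta nu 0)%E.
  rewrite leNgt; apply/negP => /limn_esup_lt_near[n0 /(_ (maxn 1 n0) (leq_maxr _ _))].
  rewrite beta_nE ?leq_maxl// lte_fin ltNge => /negP; apply.
  apply: divr_ge0; first exact/ln_ge0/moment0_ge1.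
  by apply/ltW/ln_pow2_gt0; exact: leq_maxl.
have bfin : beta nu 0 \is a fin_num.
  by rewrite ge0_fin_numE// (le_lt_trans ub)// ltry.
exists (fine (beta nu 0)); rewrite fineK//; split => //.
  exact: fine_ge0.
by rewrite -lee_fin fineK.
Qed.

End partition_functions.

(** * The asymptotic estimates *)

Section spectral_exponent.
Context {R : realType} {m : nat} (nu : {finite_measure set 'rV[R]_m -> \bar R}).
Hypothesis nu_cube : nu (~` @open_unit_cube R m) = 0%E.
Hypothesis nu_neq0 : nu setT <> 0%E.
Implicit Types (n : nat) (s b d : R).
Local Notation M := (mass nu setT).

(** The factor [1 + M] of [moment_concave] contributes only a term of order [1 / n]. *)
Lemma beta_concave s d : 0 < s < 1 -> beta nu 0 = d%:E ->
  (beta nu s <= ((1 - s) * d)%:E)%E.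
Proof.
move=> s01 b0; apply/lee_addgt0Pr => e e0; rewrite -EFinD.
have [n0 Hn0] : exists n0, forall n, (n0 <= n)%N -> (beta_n nu n 0 < (d + e)%:E)%E.
  by apply: limn_esup_lt_near; rewrite [X in (X < _)%E]b0 lte_fin ltrDl.
apply: (@limn_esup_le_harmonic _ _ _ (maxn 1 n0)
  (fun n => ln (1 + M) / ln (2 ^+ n))).
  by apply: cvg_div_ln => n; rewrite -natrX ler_nat ltn_expl.
move=> n; rewrite geq_max => /andP[n1 nn0]; have := Hn0 n nn0.
rewrite !beta_nE// lte_fin lee_fin => H.
have L := @ln_pow2_gt0 R n n1.
have M0 : 0 < 1 + M by rewrite ltr_pwDl// mass_ge0.
have N0 := moment_gt0 nu_cube nu_neq0 n 0.
have := moment_concave nu_cube nu_neq0 n s01.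
rewrite -ler_ln ?posrE ?moment_gt0 ?mulr_gt0 ?powR_gt0//.
rewrite lnM ?posrE ?powR_gt0// ln_powR => /(ler_wpM2r (ltW (_ : 0 < (ln (2 ^+ n : R))^-1))).
rewrite invr_gt0 => /(_ L)/le_trans; apply; rewrite mulrDl addrC lerD2r -mulrA.
apply: (@le_trans _ _ ((1 - s) * (d + e))).
  by rewrite ler_wpM2l ?(ltW H)// subr_ge0; case/andP: s01 => _ /ltW.
rewrite mulrDr lerD2l; case/andP: s01 => s0 _.
by rewrite ler_piMl ?(ltW e0)// lerBlDr lerDl ltW.
Qed.

Lemma s_param_ge0 b : (0 <= s_param nu b)%E.
Proof. by apply: le_ereal_inf_tmp => _ [s [s0 _] <-]; rewrite lee_fin ltW. Qed.

(** By concavity [beta s - b s <= (1 - s) d - b s], which is negative for every [s] between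
    [d / (b + d)] and 1. *)
Lemma s_param_le_dim b d : 0 < b -> beta nu 0 = d%:E -> 0 <= d ->
  (s_param nu b <= (d / (b + d))%:E)%E.
Proof.
move=> b0 dE d0; have bd : 0 < b + d by rewrite ltr_pwDl.
have q0 : 0 <= d / (b + d) by rewrite divr_ge0// ltW.
have q1 : d / (b + d) < 1 by rewrite ltr_pdivrMr// mul1r ltrDr.
have key s : d / (b + d) < s -> s < 1 -> (s_param nu b <= s%:E)%E.
  move=> qs s1; have s0 : 0 < s := le_lt_trans q0 qs.
  apply: ereal_inf_lbound; exists s => //; split => //.
  have s01 : 0 < s < 1 by rewrite s0.
  rewrite sube_le0; apply: le_trans (beta_concave s01 dE) _.
  rewrite lee_fin; move: qs; rewrite ltr_pdivrMr// => qs.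
  by move: qs; nra.
apply/lee_addgt0Pr => e e0; rewrite -EFinD.
have [H|H] := ltP (d / (b + d) + e) 1; first by apply: key => //; rewrite ltrDl.
apply: (@le_trans _ _ ((d / (b + d) + 1) / 2)%:E).
  by apply: key; move: q1; move: (d / _) => q q1; lra.
by rewrite lee_fin; move: H q1; move: (d / _) => q H q1; lra.
Qed.

(** Since [beta s0 <= b s0], the sum of [nu(C) ^ s0] over a high level [n] is at most
    [2 ^ (n (b s0 + e))].  The same bound holds for the exponent [s] up to a
    factor, while the sides of the cells contribute [2 ^ (- n b s)]; half of the gap
    [b (s - s0)] is spent on [e], and the other half makes the series converge. *)
Lemma partition_sums_bounded (l : nat) s s0 : (m < 2 * l)%N -> 0 < s0 -> s0 < s ->
  (beta nu s0 <= (((2 * l)%:R - m%:R) * s0)%:E)%E ->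
  exists2 K, 0 < K &
  forall N, \sum_(j < N) \sum_(p : @cell_index m j) (cell_value (l := l) nu p) `^ s <= K.
Proof.
move=> ml s00 ss; have -> : (2 * l)%:R - m%:R = (2 * l - m)%:R :> R.
  by rewrite natrB// ltnW.
set bn := (2 * l - m)%N; have b0 : 0 < bn%:R :> R by rewrite ltr0n subn_gt0.
move=> Hb; have s_gt0 := lt_trans s00 ss.
pose e := bn%:R * (s - s0) / 2; have e0 : 0 < e.
  by rewrite divr_gt0// mulr_gt0// subr_gt0.
have [n0 Hn0] : exists n0, forall n, (n0 <= n)%N ->
    (beta_n nu n s0 < (bn%:R * s0 + e)%:E)%E.
  apply: limn_esup_lt_near; apply: le_lt_trans Hb _.
  by rewrite lte_fin ltrDl.
pose q := (2 : R) `^ (- (bn%:R * s)).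
have val n : \sum_(p : @cell_index m n) (cell_value (l := l) nu p) `^ s =
    q ^+ n * moment nu n s.
  rewrite -(moment_full nu n s_gt0) mulr_sumr; apply: eq_bigr => p _.
  rewrite /cell_value powRM ?mass_ge0 ?exprn_ge0 ?invr_ge0 ?exprn_ge0// mulrC.
  congr (_ * _).
  have -> : (2 ^+ n)^-1 ^+ bn = (2 : R) `^ (- (n%:R * bn%:R)).
    by rewrite powRN powRrM !powR_mulrn ?exprn_ge0 ?powR_ge0// exprVn.
  rewrite -powRrM -[RHS]powR_mulrn ?powR_ge0// -powRrM; congr (_ `^ _).
  by move: (n%:R : R) (bn%:R : R) => x y; ring.
apply: (@bounded_geometric_sums _
  (fun n => \sum_(p : @cell_index m n) (cell_value (l := l) nu p) `^ s) (M `^ (s - s0)) (2 `^ (- e)) (maxn 1 n0)).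
- rewrite powR_gt0//= powRN invf_lt1 ?powR_gt0//.
  by rewrite /powR pnatr_eq0/= expR_gt1 mulr_gt0// ln_gt0// ltr1n.
- exact: powR_ge0.
- by move=> n; rewrite sumr_ge0// => p _; exact: powR_ge0.
move=> n; rewrite geq_max => /andP[n1 nn0]; rewrite val.
have := Hn0 n nn0; rewrite beta_nE// lte_fin ltr_pdivrMr ?ln_pow2_gt0// => H.
have {}H : moment nu n s0 <= (2 `^ (bn%:R * s0 + e)) ^+ n.
  rewrite -ler_ln ?posrE ?moment_gt0 ?exprn_gt0 ?powR_gt0//.
  by rewrite lnXn ?powR_gt0// ln_powR; move: H; rewrite lnXn// -mulrnAr => /ltW.
apply: (@le_trans _ _ (q ^+ n * (M `^ (s - s0) * (2 `^ (bn%:R * s0 + e)) ^+ n))).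
  rewrite ler_wpM2l ?exprn_ge0 ?powR_ge0//.
  apply: le_trans (moment_decreasing nu n (ltW ss)) _.
  by rewrite ler_wpM2l ?powR_ge0.
rewrite mulrCA -exprMn /q -powRD; last by rewrite pnatr_eq0 implybT.
rewrite (_ : - (bn%:R * s) + (bn%:R * s0 + e) = - e)//.
by rewrite /e; field.
Qed.

(** The threshold [t] is chosen such that the number of functionals is about [n]; hence
    [t] is of order [n ^ (- 1 / s)], and so is [lam n]. *)
Lemma eigenvalue_exponent (l : nat) (lam : nat -> R) s s0 : (0 < m)%N ->
  (m < 2 * l)%N -> eigenvalue_sequence l nu lam -> 0 < s0 -> s0 < s ->
  (beta nu s0 <= (((2 * l)%:R - m%:R) * s0)%:E)%E ->
  (limn_esup (fun n => lne (lam n)%:E / (ln n.+1%:R)%:E) <= (- s^-1)%:E)%E.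
Proof.
move=> m0 ml lamE s00 ss Hb; have s_gt0 := lt_trans s00 ss.
have [K K0 HK] := partition_sums_bounded ml s00 ss Hb.
pose k : R := (@num_multi_indices m l)%:R + 1.
have k0 : 0 < k by rewrite ltr_wpDl.
(* With [t ^ (- s) = n / D] the functionals on the cut cells number at most [n / 2]. *)
pose D := 2 * k * 2 ^+ m * K.
have D0 : 0 < D by rewrite !mulr_gt0// exprn_gt0.
pose C2 : R := @sobolev_const R m l ^+ 2 + 1.
have C0 : 0 < C2 by rewrite ltr_wpDl// sqr_ge0.
have bound n : 2 * k <= n%:R -> lam n <= C2 * (n%:R / D) `^ (- s^-1).
  move=> nk; have n0 : 0 < n%:R :> R by apply: lt_le_trans nk; rewrite mulr_gt0.
  set t := (n%:R / D) `^ (- s^-1).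
  have t0 : 0 < t by rewrite powR_gt0// divr_gt0.
  have tE : t `^ (- s) = n%:R / D.
    by rewrite /t -powRrM mulrNN mulVf ?gt_eqF// powRr1// divr_ge0// ltW.
  apply: (@le_trans _ _ (@sobolev_const R m l ^+ 2 * t)); last first.
    by rewrite ler_wpM2r ?(ltW t0)// lerDl.
  apply: (eigenvalue_le_dyadic m0 ml t0 s_gt0 lamE HK); rewrite tE.
  apply: (@le_trans _ _ (k * (1 + 2 ^+ m * (K * (n%:R / D))))).
    rewrite ler_wpM2r ?lerDl// addr_ge0// !mulr_ge0 ?exprn_ge0 ?(ltW K0)//.
    by rewrite invr_ge0 ltW.
  have -> : k * (1 + 2 ^+ m * (K * (n%:R / D))) = k + n%:R / 2.
    rewrite mulrDr mulr1; congr (_ + _); rewrite /D.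
    have p0 : (2 : R) ^+ m != 0 by rewrite gt_eqF// exprn_gt0.
    have k1 : k != 0 by rewrite gt_eqF.
    have K1 : K != 0 by rewrite gt_eqF.
    by move: (2 ^+ m) p0 (n%:R : R) => P p0 x; field; rewrite p0 k1 K1.
  by move: nk; move: (n%:R : R) => x; lra.
pose c := ln C2 + (ln D + ln 2) / s.
apply: (@limn_esup_le_harmonic _ _ _ (Num.truncn (2 * k)).+1
  (fun n => c / ln (n.+1%:R))); first exact: cvg_div_ln.
move=> n nk.
have nk' : 2 * k <= n%:R.
  by apply: (ltW (lt_le_trans (truncnS_gt _) _)); rewrite ler_nat.
have n0 : 0 < n%:R :> R by apply: lt_le_trans nk'; rewrite mulr_gt0.
have n1 : (0 < n)%N by rewrite -(ltr_nat R).
have L : 0 < ln (n.+1%:R : R) by rewrite ln_gt0// ltr1n ltnS.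
have [l0|l0] := leP (lam n) 0.
  rewrite le0_lneNy ?lee_fin// inver gt_eqF// gt0_mulNye ?leNye//.
  by rewrite lte_fin invr_gt0.
rewrite lne_EFin// inver gt_eqF// -EFinM lee_fin ler_pdivrMr// mulrDl divfK ?gt_eqF//.
have := bound n nk'; rewrite -ler_ln ?posrE ?mulr_gt0 ?powR_gt0 ?divr_gt0//.
rewrite lnM ?posrE ?powR_gt0 ?divr_gt0// ln_powR ln_div ?posrE// => /le_trans; apply.
have Ln : ln (n.+1%:R : R) - ln 2 <= ln n%:R.
  rewrite lerBlDr -lnM ?posrE// ler_ln ?posrE ?mulr_gt0//.
  by rewrite -natrM ler_nat muln2 -addnn -addn1 leq_add2l.
have si : 0 < s^-1 by rewrite invr_gt0.
have := ler_wpM2l (ltW si) Ln; rewrite /c.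
move: (s^-1) (ln C2) (ln D) (ln 2) (ln n.+1%:R) (ln n%:R) => r c2 dd l2 y x H.
have -> : (c2 + (dd + l2) * r) = c2 + r * dd + r * l2 by ring.
by move: H; rewrite !mulrBr mulNr; lra.
Qed.

End spectral_exponent.

Theorem theorem4p3 (R : realType) (m l : nat)
  (nu : {finite_measure set 'rV[R]_m -> \bar R}) (lam : nat -> R)
  (m_gt0 : (0 < m)%N) (l_gt0 : (0 < l)%N) (ml : (m < 2 * l)%N)
  (nu_cube : nu (~` @open_unit_cube R m) = 0%E)
  (nu_neq0 : nu setT <> 0%E)
  (lamE : eigenvalue_sequence l nu lam) :
  let b : R := (2 * l)%:R - m%:R in
  [/\ (limn_esup (fun n => lne (lam n)%:E / (ln n.+1%:R)%:E)
         <= - (s_param nu b)^-1)%E,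
      (- (s_param nu b)^-1 <= - (b%:E / upper_minkowski_dim nu + 1))%E &
      (- (b%:E / upper_minkowski_dim nu + 1)
         <= (- ((2 * l)%:R / m%:R))%:E)%E].
Proof.
move=> b; have b0 : 0 < b by rewrite subr_gt0 ltr_nat.
have bE : b = (2 * l)%:R - m%:R by [].
clearbody b.
have mr0 : 0 < m%:R :> R by rewrite ltr0n.
have [d [dE d0 dm]] := beta0_real nu_cube nu_neq0.
rewrite /upper_minkowski_dim [beta nu 0]dE.
have P0 := s_param_ge0 nu b.
have Pd := s_param_le_dim nu_cube nu_neq0 b0 dE d0.
split.
- have key s : (s_param nu b < s%:E)%E ->
      (limn_esup (fun n => lne (lam n)%:E / (ln n.+1%:R)%:E) <= (- s^-1)%:E)%E.
    move=> /ereal_inf_lt[_ [s0 [s00 Hb] <-]]; rewrite lte_fin => ss.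
    apply: (eigenvalue_exponent nu_cube nu_neq0 m_gt0 ml lamE s00 ss).
    by move: Hb; rewrite sube_le0 bE.
  move: (limn_esup _) key => L key.
  move: P0 Pd key; case: (s_param nu b) => [p| |]//; rewrite !lee_fin => p0 pd key.
  have [p00|p00] := eqVneq p 0.
    rewrite p00 inve0 /= leeNy_eq; case: L key => [r|H|]//.
      move=> H; have : (r%:E <= (- (`|r| + 1))%:E)%E.
        have := H (`|r| + 1)^-1; rewrite invrK; apply.
        by rewrite p00 lte_fin invr_gt0 ltr_wpDl.
      by rewrite lee_fin lerNr => h; have := ler_norm (- r); rewrite normrN; lra.
    by have := H 1; rewrite p00 lte_fin ltr01 => /(_ isT).
  have pp : 0 < p by rewrite lt_neqAle eq_sym p00.
  rewrite inver (negbTE p00) /=; apply/lee_addgt0Pr => e e0.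
  have q0 : 0 < (p^-1 - Num.min e (p^-1 / 2)).
    rewrite subr_gt0 gt_min; apply/orP; right.
    by rewrite ltr_pdivrMr// ltr_pMr ?invr_gt0// ltr1n.
  have min0 : 0 < Num.min e (p^-1 / 2) by rewrite lt_min e0 divr_gt0// invr_gt0.
  (* The minimum with [p^-1 / 2] keeps the chosen exponent positive. *)
  apply: (le_trans (key (p^-1 - Num.min e (p^-1 / 2))^-1 _)).
    rewrite lte_fin -[ltLHS]invrK ltf_pV2 ?posrE ?invr_gt0//.
    by rewrite ltrBlDr ltrDl.
  rewrite invrK -EFinD lee_fin opprB addrC lerD2l.
  by rewrite ge_min lexx.
- rewrite leeN2.
  have [dz|dnz] := eqVneq d 0.
    have -> : s_param nu b = 0%E.
      by apply/eqP; rewrite eq_le P0 andbT (le_trans Pd)// dz mul0r.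
    by rewrite inve0 leey.
  have dp : 0 < d by rewrite lt_neqAle eq_sym dnz.
  rewrite inver (negbTE dnz) -EFinM -EFinD.
  move: P0 Pd; case: (s_param nu b) => [p| |]//; rewrite !lee_fin => p0 pd.
  have [->|p00] := eqVneq p 0; first by rewrite inve0 leey.
  have pp : 0 < p by rewrite lt_neqAle eq_sym p00.
  rewrite inver (negbTE p00) lee_fin.
  have -> : b / d + 1 = (d / (b + d))^-1.
    by rewrite invf_div mulrDl divff.
  by rewrite lef_pV2 ?posrE// divr_gt0// addr_gt0.
- have -> : (- ((2 * l)%:R / m%:R) = - (b / m%:R + 1) :> R)%R.
    by rewrite bE mulrBl divff ?gt_eqF// subrK.
  rewrite EFinN leeN2.
  have [->|dnz] := eqVneq d 0.
    by rewrite inve0 gt0_muley ?lte_fin// addye// leey.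
  have dp : 0 < d by rewrite lt_neqAle eq_sym dnz.
  rewrite inver (negbTE dnz) -EFinM -EFinD lee_fin lerD2r.
  by rewrite ler_pM2l// lef_pV2 ?posrE.
Qed.
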